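(* Let $\vec{x}_s,\vec{x}_f\in\mathbb{R}^d$, let $T_k\to+\infty$, let $\psi_k=\psi_{T_k}$ be the minimizer of $S_{T_k}$ over absolutely continuous paths on $[0,T_k]$ from $\vec{x}_s$ to $\vec{x}_f$, and let $\phi_k:[0,1]\to\mathbb{R}^d$ be the normalized arclength reparametrization of $\psi_k$. Let $\phi^\star$ be the uniform limit on $[0,1]$ of a subsequence of $\{\phi_k\}$. Then, with $E^\star=\max_{\vec{x}\in\mathbb{R}^d}U(\vec{x})$, the path $\phi^\star$ passes through a critical point (a point where $U$ attains its maximum over $\mathbb{R}^d$) and $\phi^\star$ is an extremal of $\hat S_{E^\star}$.
   Context: Setting. $\varepsilon>0$ is fixed, $V\in C^7(\mathbb{R}^d)$, and $U(\vec{x})=\varepsilon\Delta V(\vec{x})-\frac12|\nabla V(\vec{x})|^2$. For $T>0$ and an absolutely continuous $\psi:[0,T]\to\mathbb{R}^d$, $S_T[\psi]=\int_0^T\big(\frac12|\dot\psi|^2-U(\psi)\big)dt$ (the Onsager–Machlup functional of the drift $-\nabla V$, up to the constant $V(\vec{x}_f)-V(\vec{x}_s)$). Standing assumptions: (A1) $V$ has a local minimizer $\vec{x}_m$ with $\nabla V(\vec{x}_m)=0$ and $\nabla^2V(\vec{x}_m)$ positive definite. (A2) $U$ attains its maximum over $\mathbb{R}^d$ and its maximum points lie in a bounded domain. (A3) For every $E\in\mathbb{R}$ the level set $\{U=E\}$ is a finite union of pairwise disjoint closed connected sets. (A4) The set $\Lambda$ of critical points, i.e. of points $\vec{x}^\star$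 with $U(\vec{x}^\star)=\max_{\mathbb{R}^d}U$, is discrete without accumulation points. (A5) $\nabla^2U(\vec{x})$ has no zero eigenvalue for each $\vec{x}\in\Lambda$. (A6) For all $\vec{x}_s,\vec{x}_f\in\mathbb{R}^d$ and $T>0$, $S_T$ has a unique minimizer $\psi_T$ among absolutely continuous $\psi$ on $[0,T]$ with $\psi(0)=\vec{x}_s$, $\psi(T)=\vec{x}_f$. (A7) For all $\vec{x}_s,\vec{x}_f$ there is $M=M(\vec{x}_s,\vec{x}_f)>0$, independent of $T$, with $\int_0^T|\dot\psi_T|\,dt\le M$ for all $T>0$. Arclength reparametrization. With $L=\int_0^T|\dot\psi_T|dt$ (presupposed positive), $\ell(t)=L^{-1}\int_0^t|\dot\psi_T|ds$ and $\ell^{-1}(\alpha)=\inf\{t\in[0,T]:\ell(t)\ge\alpha\}$, the reparametrized path is $\phi(\alpha)=\psi_T(\ell^{-1}(\alpha))$, $\alpha\in[0,1]$; it has $|\phi'|\equiv L$. Geometric functional and extremals. $\hat S_E[\phi]=\int_0^1\sqrt{2E-2U(\phi)}\,|\phi'|\,d\alpha$ for absolutely continuous $\phi$ on $[0,1]$ with $U(\phi)\le E$, and $+\infty$ otherwise. A path $\phi$ is an extremal of $\hat S_E$ if it satisfies the weak Euler–Lagrange equation $$\int_0^1\sqrt{2E-2U(\phi)}\,\frac{\phi'}{|\phi'|}\cdot\Phi'\,d\alpha-\int_0^1\frac{|\phi'|\,\nabla U(\phi)\cdot\Phi}{\sqrt{2E-2U(\phi)}}\,d\alpha=0\qquad\text{for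 all }\Phi\in C_0^\infty([0,1];\mathbb{R}^d).$$ *)

(* Defs.v *)
From HB Require Import structures.
From mathcomp Require Import all_boot all_order all_algebra.
From mathcomp Require Import all_classical all_reals all_analysis.

Set Implicit Arguments.
Unset Strict Implicit.
Unset Printing Implicit Defensive.

Import Order.TTheory GRing.Theory Num.Theory.
Import numFieldNormedType.Exports.

Local Open Scope classical_set_scope.
Local Open Scope ring_scope.

Section Euclidean.
Context {R : realType} {d : nat}.
Implicit Types (u v x : 'rV[R]_d) (f : 'rV[R]_d -> R).

Definition dot u v : R := \sum_i u ord0 i * v ord0 i.

(* The library norm on 'rV_d is the sup norm; [enorm] is the Euclidean one. *)
Definition enorm v : R := Num.sqrt (dot v v).

Definition partial (i : 'I_d) f x : R := 'D_(delta_mx ord0 i) f x.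

Fixpoint is_Ck (k : nat) f : Prop :=
  continuous f /\
  if k is k'.+1 then
    forall i, (forall x, derivable f x (delta_mx ord0 i)) /\
              is_Ck k' (partial i f)
  else True.

Definition grad f x : 'rV[R]_d := \row_i partial i f x.

Definition hess f x : 'M[R]_d := \matrix_(i, j) partial i (partial j f) x.

Definition laplacian f x : R := \tr (hess f x).

Definition pos_def (A : 'M[R]_d) : Prop :=
  forall v, v != 0 -> 0 < dot (v *m A) v.

Definition is_maximum f (m : R) : Prop := range f m /\ ubound (range f) m.

Definition critical_set f : set 'rV[R]_d := [set x | is_maximum f (f x)].

Definition OM_potential (eps : R) (V : 'rV[R]_d -> R) x : R :=
  eps * laplacian V x - 2^-1 * enorm (grad V x) ^+ 2.

End Euclidean.

(* Paths in R^d are functions on the whole of R; only their restriction to the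
   relevant interval [a, b] is ever meaningful. In particular [derive1] is only
   used under integrals over [a, b] or almost everywhere on [a, b], so that its
   two-sidedness at the endpoints plays no role. *)
Section Paths.
Context {R : realType} {d : nat}.
Notation mu := (@lebesgue_measure R).
Implicit Types (psi phi Phi : R -> 'rV[R]_d) (U : 'rV[R]_d -> R).

Definition abs_cont (a b : R) psi : Prop :=
  forall e : R, 0 < e -> exists2 delta : R, 0 < delta &
    forall (n : nat) (s t : 'I_n -> R),
      (forall i, a <= s i /\ s i <= t i /\ t i <= b) ->
      trivIset setT (fun i => `]s i, t i[%classic) ->
      \sum_i (t i - s i) < delta ->
      \sum_i enorm (psi (t i) - psi (s i)) < e.

(* The integral is extended-real valued: it is +oo when U is bounded above and
   |psi'|^2 is not integrable. *)
Definition OM_action U (T : R) psi : \bar R :=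
  (\int[mu]_(t in `[0%R, T])
     (2^-1 * enorm (derive1 psi t) ^+ 2 - U (psi t))%:E)%E.

Definition admissible (T : R) (xs xf : 'rV[R]_d) psi : Prop :=
  [/\ abs_cont 0 T psi, psi 0 = xs & psi T = xf].

Definition is_minimizer U (T : R) xs xf psi : Prop :=
  admissible T xs xf psi /\
  forall chi, admissible T xs xf chi ->
    (OM_action U T psi <= OM_action U T chi)%E.

Definition arclength (t : R) psi : R :=
  \int[mu]_(s in `[0%R, t]) enorm (derive1 psi s).

Definition rel_arclength (T : R) psi (t : R) : R :=
  (arclength T psi)^-1 * arclength t psi.

Definition arclength_reparam (T : R) psi (alpha : R) : 'rV[R]_d :=
  psi (inf [set t | t \in `[0, T] /\ alpha <= rel_arclength T psi t]).

Definition geom_action U (E : R) phi : \bar R :=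
  if `[< abs_cont 0 1 phi /\
         (forall alpha, alpha \in `[0, 1] -> U (phi alpha) <= E) >]
  then (\int[mu]_(alpha in `[0%R, 1%R])
          (Num.sqrt (2 * E - 2 * U (phi alpha)) *
           enorm (derive1 phi alpha))%:E)%E
  else +oo%E.

Definition test_path Phi : Prop :=
  [/\ forall (n : nat) (t : R), derivable (derive1n n Phi) t 1,
      Phi 0 = 0 & Phi 1 = 0].

Definition EL_term1 U (E : R) phi Phi (alpha : R) : R :=
  Num.sqrt (2 * E - 2 * U (phi alpha)) *
  dot ((enorm (derive1 phi alpha))^-1 *: derive1 phi alpha)
      (derive1 Phi alpha).

Definition EL_term2 U (E : R) phi Phi (alpha : R) : R :=
  enorm (derive1 phi alpha) * dot (grad U (phi alpha)) (Phi alpha) /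
  Num.sqrt (2 * E - 2 * U (phi alpha)).

(* The first two clauses, and integrability, make the weak Euler-Lagrange
   equation meaningful: phi lies in the domain of the functional, and neither
   |phi'| nor sqrt(2E - 2U(phi)), which occur as denominators, vanishes on a
   set of positive measure; thus the convention 0^-1 = 0 is immaterial. *)
Definition is_extremal U (E : R) phi : Prop :=
  [/\ (geom_action U E phi < +oo)%E,
      {ae mu, forall alpha, alpha \in `[0, 1] ->
         derive1 phi alpha != 0 /\ U (phi alpha) < E} &
      forall Phi, test_path Phi ->
        [/\ mu.-integrable `[0%R, 1%R] (EFin \o EL_term1 U E phi Phi),
            mu.-integrable `[0%R, 1%R] (EFin \o EL_term2 U E phi Phi) &
            \int[mu]_(alpha in `[0%R, 1%R]) EL_term1 U E phi Phi alpha -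
            \int[mu]_(alpha in `[0%R, 1%R]) EL_term2 U E phi Phi alpha = 0]].

End Paths.

Section Assumptions.
Context {R : realType} {d : nat}.
Implicit Types (U V : 'rV[R]_d -> R).

Definition has_nondeg_local_min V : Prop :=
  exists xm, [/\ (\forall x \near xm, V xm <= V x),
                 grad V xm = 0 & pos_def (hess V xm)].

Definition has_bounded_maxima U : Prop :=
  (exists m, is_maximum U m) /\ bounded_set (critical_set U).

Definition tame_level_sets U : Prop :=
  forall E : R, exists (n : nat) (C : 'I_n -> set 'rV[R]_d),
    [/\ forall i, closed (C i) /\ connected (C i),
        trivIset setT C &
        [set x | U x = E] = \bigcup_i C i].

Definition discrete_critical_set U : Prop :=
  critical_set U `<=` isolated (critical_set U) /\
  limit_point (critical_set U) = set0.

Definition nondeg_critical_points U : Prop :=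
  forall x, critical_set U x -> ~~ eigenvalue (hess U x) 0.

Definition unique_minimizers U : Prop :=
  forall (xs xf : 'rV[R]_d) (T : R), 0 < T ->
    exists2 psi, is_minimizer U T xs xf psi &
      forall chi, is_minimizer U T xs xf chi -> {in `[0, T], chi =1 psi}.

Definition bounded_arclengths U : Prop :=
  forall xs xf : 'rV[R]_d, exists2 M : R, 0 < M &
    forall (T : R) psi, 0 < T -> is_minimizer U T xs xf psi ->
      arclength T psi <= M.

End Assumptions.

(* Main.v *)
Require Import Defs.
From HB Require Import structures.
From mathcomp Require Import all_boot all_order all_algebra.
From mathcomp Require Import all_classical all_reals all_analysis.
From mathcomp Require Import measurable_realfun lra ring.

Set Implicit Arguments.
Unset Strict Implicit.
Unset Printing Implicit Defensive.

Import Order.TTheory GRing.Theory Num.Theory.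
Import numFieldNormedType.Exports.

Local Open Scope classical_set_scope.
Local Open Scope ring_scope.

(** Idea. A minimizer solves Newton's equation X'' = - grad U(X), by Du Bois-Reymond, and so
    conserves the energy E = |X'|^2/2 + U(X). Comparison with a path that waits at a maximum point
    of U, and the existence of a time of speed at most M/T, force E_k -> E* and make the limit meet
    the set U = E*.

    Where U(phi* ) < E*, the arclength parametrization controls the second order expansions of
    phi_k and of the momentum p_k = X_k' uniformly in k. Hence phi* is differentiable there with
    constant speed L* = lim L_k, and p = sqrt(2E* - 2U(phi* )) phi*'/L* satisfies
    p' = - L* grad U(phi* ) / sqrt(2E* - 2U(phi* )), which is the Euler-Lagrange equation.

    The contact set U(phi* ) = E* is discrete: near a nondegenerate maximum point x*, the function
    y.X'/sqrt(|y|^2 + e^2), with y = X - x*, has derivative at least c|X'|, so the length between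
    two visits close to x* tends to 0. Since |p| = sqrt(2E* - 2U(phi* )) is at most a constant
    times the distance to the contact set, p is Lipschitz across it, and integrating (p.Phi)'
    gives the weak equation. *)

(** * Absolutely continuous functions *)

(** Minimizers are only absolutely continuous, so the Euler equation cannot be written at the start.
    The fundamental theorem of calculus for such paths is built first, from Stieltjes measures and
    Radon-Nikodym.

    Uniform convergence of the phi_k says nothing about their derivatives. The expansions with a
    quadratic remainder uniform in k serve twice: compared at two indices they make the directions a
    Cauchy sequence, and in the limit they become expansions of the limit path and of p.
    Differentiating p, and not the velocity, avoids second derivatives of the limit.

    The danger L_k -> 0 is excluded as follows. The limit contains its two end points and a maximum
    point, so it is constant only if xs = xf is a maximum point; but then the constant path would
    beat psi_k, whose length is positive.

    E_k may lie on either side of E*.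

    The quotient grad U / sqrt(2E* - 2U) stays bounded at the contact set because |grad U|^2 <= C
    (E* - U) on bounded sets. *)

Section AbsolutelyContinuous.
Context {R : realType}.
Notation mu := (@lebesgue_measure R).
Implicit Types (a b : R) (F G : R -> R) (l : seq (R * R)).

Definition apart (x y : R * R) := (x.2 <= y.1) || (y.2 <= x.1).

Definition disjoint_family a b l :=
  all (fun x => [&& a <= x.1, x.1 <= x.2 & x.2 <= b]) l && pairwise apart l.

(** Lists replace the families indexed by ordinals of [abs_cont]: splitting one interval into the
    pieces of a partition is then a concatenation. *)
Definition scalar_ac a b F := forall e : R, 0 < e -> exists2 delta : R, 0 < delta &
  forall l, disjoint_family a b l -> \sum_(x <- l) (x.2 - x.1) < delta ->
  \sum_(x <- l) `|F x.2 - F x.1| < e.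

Lemma apart_sym : symmetric apart.
Proof. by move=> x y; rewrite /apart orbC. Qed.

Lemma disjoint_family_cat a b l1 l2 :
  disjoint_family a b (l1 ++ l2) =
  [&& disjoint_family a b l1, disjoint_family a b l2 & allrel apart l1 l2].
Proof.
rewrite /disjoint_family all_cat pairwise_cat.
by case: (all _ l1); case: (all _ l2); case: (pairwise _ l1);
   case: (pairwise _ l2); case: (allrel _ _ _).
Qed.

Definition consecutive (c : R) (s : seq R) := zip (c :: s) s.

Lemma consecutive_disjoint c s : path <%O c s ->
  disjoint_family c (last c s) (consecutive c s) /\
  \sum_(x <- consecutive c s) (x.2 - x.1) = last c s - c.
Proof.
elim: s c => [c _|d s IH c /= /andP[cd ds]].
  by rewrite /consecutive /disjoint_family/= big_nil subrr.
have [/andP[H1 H2] H3] := IH _ ds.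
have dl : d <= last d s.
  by apply: (@itv_partition_le _ _ _ _ s); split.
rewrite /consecutive /= /disjoint_family/= lexx (ltW cd)/= dl/=; split.
  rewrite H2 andbT; apply/andP; split.
    by apply: sub_all H1 => x /and3P[dx -> ->]; rewrite (le_trans (ltW cd) dx).
  by apply: sub_all H1 => x /and3P[dx _ _]; rewrite /apart dx.
by rewrite big_cons -[zip _ _]/(consecutive d s) H3/=; lra.
Qed.

Lemma variation_consecutive c d F s : itv_partition c d s ->
  variation c d F s = \sum_(x <- consecutive c s) `|F x.2 - F x.1|.
Proof.
move=> cds; rewrite variation_zip// /consecutive.
elim: s c {cds} => [c|x s IH c]; first by rewrite /= !big_nil.
by rewrite /= !big_cons IH.
Qed.

(* Refining the intervals of a disjoint family keeps it disjoint, with the same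
   total length. *)
Lemma scalar_ac_TV a b F (e delta : R) :
  (forall l, disjoint_family a b l -> \sum_(x <- l) (x.2 - x.1) < delta ->
    \sum_(x <- l) `|F x.2 - F x.1| < e) ->
  forall l1 l2, disjoint_family a b (l1 ++ l2) ->
    \sum_(x <- l1 ++ l2) (x.2 - x.1) < delta ->
  (\sum_(x <- l1) total_variation x.1 x.2 F +
    (\sum_(x <- l2) `|F x.2 - F x.1|)%:E <= e%:E)%E.
Proof.
move=> H; elim=> [l2 dl2 sl2|[c d] l1 IH l2 dl2 sl2].
  by rewrite big_nil add0e lee_fin ltW// H.
rewrite big_cons -addeA [X in (X <= _)%E]addeC.
have cd : c <= d by case/andP: dl2 => /= /andP[/and3P[]].
(* The head interval is traded for the pieces of an arbitrary partition, which join [l2]; the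
   supremum over partitions is taken at the end. *)
have key s : itv_partition c d s ->
    (\sum_(j <- l1) total_variation j.1 j.2 F +
      (\sum_(x <- l2) `|F x.2 - F x.1|)%:E + (variation c d F s)%:E <= e%:E)%E.
  move=> cds; rewrite (variation_consecutive _ cds).
  case: cds => cs /eqP ld; have [dc sc] := consecutive_disjoint cs.
  rewrite ld in dc sc.
  rewrite -addeA -EFinD [X in X%:E]addrC -big_cat/=; apply: IH.
    move: dl2; rewrite -cat1s -catA !disjoint_family_cat => /and3P[d1].
    move=> /and3P[dl1 dl2 a12]; rewrite allrel1l all_cat => /andP[ac1 ac2].
    have dcab : disjoint_family a b (consecutive c s).
      case/andP: dc => dc1 dc2; apply/andP; split=> //; apply: sub_all dc1 => x.
      move: d1; rewrite /disjoint_family/= !andbT => /and3P[ac _ db].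
      by move=> /and3P[cx -> xd]; rewrite (le_trans ac cx) (le_trans xd db).
    have sub (l : seq (R * R)) : all (apart (c, d)) l -> allrel apart (consecutive c s) l.
      move=> /allP al; apply/allrelP => x y xc yl.
      have := al _ yl; case/andP: dc => /allP /(_ _ xc)/and3P[cx _ xd] _.
      rewrite /apart/= => /orP[dy|yc]; first by rewrite (le_trans xd dy).
      by rewrite (le_trans yc cx) orbT.
    rewrite dl1 dcab dl2 sub// allrel_catr a12 andbT /=.
    by rewrite allrelC (eq_allrel (fun x y => apart_sym y x)) sub.
  move: sl2; rewrite /= big_cons/= !big_cat/= sc.
  by move=> /=; lra.
set S := (\sum_(j <- l1) _ + _)%E in key *.
(* Finiteness allows [S] to be subtracted before passing to the supremum; [key] at a single
   partition gives it. *)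
have SE : S \is a fin_num.
  have S0 : (0 <= S)%E.
    apply: adde_ge0; last by rewrite lee_fin sumr_ge0.
    rewrite big_seq; apply: sume_ge0 => -[x y] /= xl; apply: total_variation_ge0.
    case/andP: dl2 => /= /andP[_ /allP dl2 _].
    by have := dl2 (x, y); rewrite mem_cat xl => /(_ isT)/and3P[].
  rewrite ge0_fin_numE//.
  move: cd; rewrite le_eqVlt => /predU1P[cd|cd].
    apply: (@le_lt_trans _ _ e%:E); last exact: ltry.
    have := key [::]; rewrite /variation/= big_nil adde0; apply.
    by split=> //=; rewrite cd.
  apply: (@le_lt_trans _ _ e%:E); last exact: ltry.
  apply: le_trans (key [:: d] (itv_partition1 cd)).
  by rewrite leeDl// lee_fin sumr_ge0.
rewrite -leeBrDl//; apply: ge_ereal_sup => _ [_ [s cds <-] <-].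
by rewrite leeBrDl// key.
Qed.

Lemma scalar_ac_uniform a b F e : scalar_ac a b F -> 0 < e ->
  exists2 delta : R, 0 < delta & forall x y, a <= x -> x <= y -> y <= b ->
    y - x < delta -> `|F y - F x| < e.
Proof.
move=> acF /acF[delta delta0 H]; exists delta => // x y ax xy yb yx.
have := H [:: (x, y)]; rewrite !big_cons !big_nil !addr0/=; apply => //.
by rewrite /disjoint_family/= ax xy yb.
Qed.

(** Over an interval shorter than [delta] the variation is at most 1, and [[a, d]] is exhausted by
    steps of length [delta / 2]. *)
Lemma scalar_ac_TV_lt a b F : scalar_ac a b F -> forall d, a <= d -> d <= b ->
  (total_variation a d F < +oo)%E.
Proof.
move=> acF; have [delta delta0 H] := acF _ ltr01.
have short c d : a <= c -> c <= d -> d <= b -> d - c < delta ->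
    (total_variation c d F < +oo)%E.
  move=> ac cd db dc; apply: (@le_lt_trans _ _ 1%:E); last exact: ltry.
  have := @scalar_ac_TV a b F 1 delta H [:: (c, d)] [::].
  rewrite /= !big_cons !big_nil !adde0/= addr0; apply => //.
  by rewrite /disjoint_family/= ac cd db.
suff step n d : a <= d -> d <= b -> d - a <= (delta / 2) *+ n ->
    (total_variation a d F < +oo)%E.
  move=> d ad db; apply: (step (Num.truncn ((d - a) / (delta / 2))).+1) => //.
  by rewrite -mulr_natr -ler_pdivrMl ?divr_gt0// mulrC ltW// truncnS_gt.
elim: n d => [|n IH] d ad db.
  rewrite mulr0n subr_le0 => da; have -> : d = a by apply/eqP; rewrite eq_le ad da.
  by rewrite total_variationxx.
rewrite mulrS => dn.
have [da|da] := ltP (d - delta / 2) a; first by apply: short => //; lra.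
rewrite (@total_variationD _ a d (d - delta / 2))//; last lra.
by apply: lte_add_pinfty; [apply: IH; lra|apply: short; lra].
Qed.

Definition tv a F (t : R) := fine (total_variation a t F).

Lemma tvE a b F x y : scalar_ac a b F -> a <= x -> x <= y -> y <= b ->
  total_variation x y F = (tv a F y - tv a F x)%:E.
Proof.
move=> acF ax xy yb.
have fin d : a <= d -> d <= b -> total_variation a d F \is a fin_num.
  by move=> ad db; rewrite ge0_fin_numE ?total_variation_ge0// (scalar_ac_TV_lt acF).
rewrite EFinB /tv !fineK ?fin//; [|lra..].
by rewrite (total_variationD F ax xy) addeAC subee ?add0e// fin//; lra.
Qed.

Lemma tv_ge a b F x y : scalar_ac a b F -> a <= x -> x <= y -> y <= b ->
  `|F y - F x| <= tv a F y - tv a F x.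
Proof.
move=> acF ax xy yb.
by rewrite -lee_fin -(tvE acF)// total_variation_ge.
Qed.

Lemma scalar_ac_tv a b F : scalar_ac a b F -> scalar_ac a b (tv a F).
Proof.
move=> acF e e0; have [delta delta0 H] := acF _ (divr_gt0 e0 (ltr0n _ 2)).
exists delta => // l dl sl.
have := @scalar_ac_TV a b F (e / 2) delta H l [::].
rewrite cats0 big_nil adde0 => /(_ dl sl) le_e.
apply: (@le_lt_trans _ _ (e / 2)); last lra.
rewrite -lee_fin -sumEFin; apply: le_trans le_e; rewrite le_eqVlt; apply/orP; left.
apply/eqP; rewrite big_seq [RHS]big_seq; apply: eq_bigr => x xl.
case/andP: dl => /allP/(_ _ xl)/and3P[ax xy yb] _.
by rewrite (tvE acF)// ger0_norm// (le_trans _ (tv_ge acF ax xy yb)).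
Qed.

(** Precomposition with [clamp] extends a function known on [[a, b]] to the whole line, so that
    plain continuity can replace continuity within a subspace. *)
Definition clamp a b (t : R) := Num.max a (Num.min t b).

Lemma clamp_itv a b t : a <= b -> a <= clamp a b t /\ clamp a b t <= b.
Proof.
by move=> ab; rewrite /clamp; split; [rewrite le_max lexx|rewrite ge_max ab ge_min lexx orbT].
Qed.

Lemma clamp_id a b t : a <= t -> t <= b -> clamp a b t = t.
Proof. by move=> at_ tb; rewrite /clamp (min_idPl tb) (max_idPr at_). Qed.

Lemma clamp_le a b s t : s <= t -> clamp a b s <= clamp a b t.
Proof. by move=> st; rewrite /clamp; case: (leP s b) => ?; case: (leP t b) => ?; case: (leP a s) => ?; case: (leP a t) => ?; case: (leP a b) => ?; lra. Qed.

Lemma clamp_dist a b s t : a <= b -> s <= t -> clamp a b t - clamp a b s <= t - s.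
Proof. by move=> ab st; rewrite /clamp; case: (leP s b) => ?; case: (leP t b) => ?; case: (leP a s) => ?; case: (leP a t) => ?; case: (leP a b) => ?; lra. Qed.

(** * Densities of nondecreasing absolutely continuous functions *)

Section NondecreasingAC.
Variables (a b : R) (G : R -> R).
Hypotheses (ab : a <= b) (acG : scalar_ac a b G)
  (ndG : forall x y, a <= x -> x <= y -> y <= b -> G x <= G y).

Definition ext_clamp (t : R) := G (clamp a b t).

Lemma ext_clamp_nd : nondecreasing ext_clamp.
Proof.
move=> x y xy; apply: ndG; last by case: (clamp_itv y ab).
  by case: (clamp_itv x ab).
exact: clamp_le.
Qed.

Lemma ext_clamp_uniform (e : R) : 0 < e ->
  exists2 delta : R, 0 < delta & forall x y, `|x - y| < delta ->
    `|ext_clamp x - ext_clamp y| < e.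
Proof.
move=> /(scalar_ac_uniform acG)[delta delta0 H]; exists delta => // x y.
wlog xy : x y / x <= y.
  move=> W; have [/W//|/ltW/W] := leP x y.
  by rewrite distrC [X in _ -> X < e]distrC.
rewrite distrC ger0_norm ?subr_ge0// => xyd; rewrite distrC; apply: H.
- by case: (clamp_itv x ab).
- exact: clamp_le.
- by case: (clamp_itv y ab).
- by apply: le_lt_trans xyd; apply: clamp_dist.
Qed.

Lemma ext_clamp_rc : right_continuous ext_clamp.
Proof.
apply: right_continuousW => x; apply/cvgrPdist_lt => e e0.
have [delta delta0 H] := ext_clamp_uniform e0.
by near=> y; apply: H; near: y; exact: cvgr_dist_lt.
Unshelve. all: by end_near. Qed.

HB.instance Definition _ := isCumulative.Build R _ R ext_clamp ext_clamp_nd ext_clamp_rc.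

Notation nu := (lebesgue_stieltjes_measure ext_clamp).

Lemma ext_clamp_itv s t : s <= t -> nu `]s, t]%classic = (ext_clamp t - ext_clamp s)%:E.
Proof.
move=> st; rewrite /lebesgue_stieltjes_measure /measure_extension.
rewrite measurable_mu_extE/=; last exact: is_ocitv.
by rewrite wlength_itv_bnd.
Qed.

Let mD : measurable (`]a, b]%classic : set (measurableTypeR R)).
Proof. exact: measurable_itv. Qed.

Let nuD : (nu `]a, b]%classic < +oo)%E.
Proof. by rewrite ext_clamp_itv// ltry. Qed.

(** A null set lies in an open set of measure less than [delta]. Its components are disjoint
    intervals, and absolute continuity bounds the sum of the increments of [G] over any finitely
    many of them. *)
Lemma ext_clamp_dominated : nu `<< mu.
Proof.
apply/null_content_dominatesP => A mA muA.
suff le_e (e : R) : 0 < e -> (nu A <= e%:E)%E.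
  apply/eqP; rewrite eq_le measure_ge0 andbT; apply/lee_addgt0Pr => e e0.
  by rewrite add0e le_e.
move=> e0; have [delta delta0 H] := acG e0.
have [U [oU AU muU]] := @lebesgue_regularity_outer R A delta mA
  (eq_ind_r (fun x => (x < +oo)%E) (ltry 0) muA) delta0.
have mU : measurable (U : set (measurableTypeR R)) by exact: open_measurable.
have {}muU : (mu U < delta%:E)%E.
  apply: le_lt_trans muU; rewrite -[X in (mu X <= _)%E](setDUK AU).
  apply: le_trans (measureU2 _ mA _) _; first exact: measurableD.
  by rewrite muA add0e.
apply: (@le_trans _ _ (nu U)); first by apply: le_measure => //; rewrite inE.
pose I := open_disjoint_itv oU.
have oI i : open (I i) by exact: open_disjoint_itv_open.
have mI i : measurable (I i : set (measurableTypeR R)) by exact: open_measurable.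
(* Finite measure rules out unbounded components, and openness fixes the kind of the end points. *)
have IE i : exists st : R * R, st.1 <= st.2 /\ I i = `]st.1, st.2[%classic.
  have muI : (mu (I i) < +oo)%E.
    apply: (@le_lt_trans _ _ (mu U)); last by rewrite (lt_trans muU)// ltry.
    apply: le_measure; rewrite ?inE//; rewrite [X in _ `<=` X](open_disjoint_itv_bigcup oU).
    exact: bigcup_sup.
  have /is_intervalP : is_interval (I i) by exact: open_disjoint_itv_is_interval.
  have empty (J : interval R) : ~~ (J.1 < J.2)%O -> exists st : R * R,
      st.1 <= st.2 /\ [set` J] = `]st.1, st.2[%classic.
    case: J => l r /= lr; exists (0, 0); split => //.
    by rewrite !set_itv_ge//= bnd_simp ltxx.
  case: (Rhull (I i)) muI => l r muI IE; rewrite IE in muI *.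
  have [lr|lr] := boolP (l < r)%O; last exact: empty.
  move: muI; rewrite lebesgue_measure_itv/=.
  case: l r IE lr => [bx x|[]] [by_ y|[]] IE lr //=; rewrite ?ltry ?ltNyr//= => _.
  have E : [set` Interval (BSide bx x) (BSide by_ y)] = `]x, y[%classic.
    by rewrite -(interior_itv_bnd x y bx by_) -IE; exact/esym/interior_id.
  exists (x, y); split => //=.
  by move: lr; clear; case: bx; case: by_; rewrite bnd_simp // => /ltW.
have /choice[st stP] := IE.
rewrite [in X in (X <= _)%E](open_disjoint_itv_bigcup oU) measure_semi_bigcup//; last 2 first.
- exact: open_disjoint_itv_trivIset.
- by rewrite -open_disjoint_itv_bigcup.
apply: lime_le; first by apply: is_cvg_nneseries.
apply: nearW => n.
(* The components may leave [[a, b]]: clamping their end points does not lengthen them and leaves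
   the increments of [ext_clamp] unchanged. *)
pose J := [seq i <- iota 0 n | (st i).1 < (st i).2].
pose l := [seq (clamp a b (st i).1, clamp a b (st i).2) | i <- J].
have lenJ : \sum_(i <- J) ((st i).2 - (st i).1) < delta.
  rewrite -lte_fin; apply: le_lt_trans muU.
  have -> : (\sum_(i <- J) ((st i).2 - (st i).1))%:E = mu (\bigcup_(i in [set` J]) I i).
    have finJ : finite_set [set` J] by exact: finite_seq.
    have trivJ : trivIset [set` J] I.
      apply/trivIsetP => i j _ _ ij.
      by have /trivIsetP/(_ i j Logic.I Logic.I ij) := (@open_disjoint_itv_trivIset _ _ oU).
    rewrite measure_fin_bigcup//.
    rewrite -fsbig_seq ?filter_uniq ?iota_uniq// -sumEFin big_seq [RHS]big_seq.
    apply: eq_bigr => i; rewrite mem_filter => /andP[sti _].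
    have [_ ->] := stP i.
    by rewrite [RHS]lebesgue_measure_itv/= lte_fin sti EFinB.
  apply: le_measure; rewrite ?inE//.
    by apply: fin_bigcup_measurable.
  rewrite [X in _ `<=` X](open_disjoint_itv_bigcup oU).
  exact: bigcup_subset.
have dl : disjoint_family a b l.
  apply/andP; split.
    apply/allP => z /mapP[i]; rewrite mem_filter => /andP[sti _] ->/=.
    by rewrite (clamp_itv _ ab).1 (clamp_itv _ ab).2 clamp_le// ltW.
  have Juniq : pairwise (fun i j => i != j) J.
    by rewrite -uniq_pairwise filter_uniq// iota_uniq.
  rewrite pairwise_map; apply: sub_in_pairwise (allss J) Juniq => i j.
  rewrite !mem_filter => /andP[sti _] /andP[stj _] ij.
  have /trivIsetP/(_ i j Logic.I Logic.I ij) := @open_disjoint_itv_trivIset _ _ oU.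
  rewrite -/I (stP i).2 (stP j).2 /apart/= => /seteqP[/= ij0 _].
  have [ji|ij'] := leP (st i).2 (st j).1; first by rewrite clamp_le.
  have [ji|ji] := leP (st j).2 (st i).1; first by rewrite [X in _ || X]clamp_le ?orbT.
  exfalso; pose m := (Num.max (st i).1 (st j).1 + Num.min (st i).2 (st j).2) / 2.
  apply: (ij0 m); rewrite /= !in_itv/= /m.
  case: (leP (st i).1 (st j).1) => ?; case: (leP (st i).2 (st j).2) => ?;
    by split; apply/andP; split; lra.
have sl : \sum_(x <- l) (x.2 - x.1) < delta.
  apply: le_lt_trans lenJ; rewrite big_map big_seq [leRHS]big_seq; apply: ler_sum => i.
  by rewrite mem_filter => /andP[/ltW sti _]; exact: clamp_dist.
have {H dl sl} := H _ dl sl => /ltW; rewrite -lee_fin; apply: le_trans.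
rewrite big_map big_filter /index_iota subn0 -sumEFin [leRHS]big_mkcond/=.
apply: lee_sum => i _; have [sti IiE] := stP i.
case: ifPn => sti'.
  apply: (@le_trans _ _ (nu `](st i).1, (st i).2]%classic)).
    by apply: le_measure; rewrite ?inE// -/I IiE; apply: subset_itvl; rewrite bnd_simp.
  rewrite ext_clamp_itv// lee_fin ger0_norm// subr_ge0.
  exact: ext_clamp_nd.
by rewrite -/I IiE set_itv_ge ?measure0// bnd_simp -leNgt leNgt.
Qed.

(** [g] is the Radon-Nikodym density of the Stieltjes measure restricted to []a, b]]; the half-open
    interval gives [[a, x]] exactly the mass [G x - G a]. *)
Lemma nondecreasing_ac_integral : exists g : R -> R,
  [/\ measurable_fun setT g, mu.-integrable `[a, b] (EFin \o g) &
    forall x, a <= x -> x <= b -> G x - G a = \int[mu]_(t in `[a, x]) g t].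
Proof.
pose nuab := mfrestr mD nuD.
have dom : nuab `<< mu.
  apply/null_content_dominatesP => A mA muA.
  apply/eqP; rewrite eq_le measure_ge0 andbT -((null_content_dominatesP _ _).1 ext_clamp_dominated A mA muA).
  by apply: le_measure; rewrite ?inE//; exact: measurableI.
have [f [f0 ffin intf fE]] := radon_nikodym_sigma_finite dom.
have fK : EFin \o (fine \o f) = f by apply/funext => x /=; rewrite fineK.
exists (fine \o f); split.
- by apply/measurable_EFinP; rewrite fK; exact: measurable_int intf.
- by rewrite fK; apply: integrableS intf.
move=> x ax xb.
rewrite /Rintegral -[G x - G a]/(fine (G x - G a)%:E); congr fine.
transitivity (\int[mu]_(t in `[a, x]) f t)%E; last first.
  by apply: eq_integral => t _; rewrite fineK.
rewrite -fE; last exact: measurable_itv.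
rewrite /nuab /mfrestr /mrestr.
have E : `[a, x]%classic `&` `]a, b]%classic = `]a, x]%classic :> set R.
  apply/seteqP; split=> t /=; rewrite !in_itv/=.
    by move=> [/andP[_ ->] /andP[->]].
  by move=> /andP[at_ tx]; rewrite (ltW at_) tx at_ (le_trans tx).
transitivity (nu `]a, x]%classic); last by rewrite -[in LHS]E.
by rewrite ext_clamp_itv// /ext_clamp !clamp_id.
Qed.

End NondecreasingAC.

Lemma scalar_ac_sub a b F G : scalar_ac a b F -> scalar_ac a b G ->
  scalar_ac a b (fun t => F t - G t).
Proof.
move=> acF acG e e0; have e20 : 0 < e / 2 by rewrite divr_gt0.
have [d1 d10 H1] := acF _ e20; have [d2 d20 H2] := acG _ e20.
exists (Num.min d1 d2); first by rewrite lt_min d10.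
move=> l dl; rewrite lt_min => /andP[/(H1 _ dl) l1 /(H2 _ dl) l2].
apply: (@le_lt_trans _ _ (\sum_(x <- l) (`|F x.2 - F x.1| + `|G x.2 - G x.1|))).
  apply: ler_sum => x _.
  rewrite (_ : F x.2 - G x.2 - (F x.1 - G x.1) = (F x.2 - F x.1) - (G x.2 - G x.1)); last by ring.
  exact: ler_normB.
by rewrite big_split/=; lra.
Qed.

(** Jordan decomposition: [tv a F] and [tv a F - F] are both nondecreasing and absolutely
    continuous, and [F] is their difference. *)
Lemma scalar_ac_integral a b F : a <= b -> scalar_ac a b F -> exists f : R -> R,
  [/\ measurable_fun setT f, mu.-integrable `[a, b] (EFin \o f) &
    forall x, a <= x -> x <= b -> F x - F a = \int[mu]_(t in `[a, x]) f t].
Proof.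
move=> ab acF; have acV := scalar_ac_tv acF.
have [g1 [mg1 ig1 g1E]] : exists g : R -> R,
  [/\ measurable_fun setT g, mu.-integrable `[a, b] (EFin \o g) &
    forall x, a <= x -> x <= b -> tv a F x - tv a F a = \int[mu]_(t in `[a, x]) g t].
  apply: nondecreasing_ac_integral => // x y ax xy yb.
  by rewrite -subr_ge0 (le_trans _ (tv_ge acF ax xy yb)).
have [g2 [mg2 ig2 g2E]] : exists g : R -> R,
  [/\ measurable_fun setT g, mu.-integrable `[a, b] (EFin \o g) &
    forall x, a <= x -> x <= b -> (tv a F x - F x) - (tv a F a - F a) =
      \int[mu]_(t in `[a, x]) g t].
  apply: (@nondecreasing_ac_integral _ _ (fun x => tv a F x - F x)) => //.
    exact: scalar_ac_sub.
  move=> x y ax xy yb; have := tv_ge acF ax xy yb.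
  by move=> /(le_trans (ler_norm _)); lra.
exists (fun t => g1 t - g2 t); split.
- exact: measurable_funB.
- rewrite (_ : _ \o _ = (EFin \o g1) \- (EFin \o g2))%E; last exact/funext.
  exact: integrableB.
- move=> x ax xb; rewrite RintegralB//.
  + by rewrite -g1E// -g2E//; ring.
  + by apply: integrableS ig1 => //; apply: subset_itvl; rewrite bnd_simp.
  + by apply: integrableS ig2 => //; apply: subset_itvl; rewrite bnd_simp.
Qed.

(** Lebesgue differentiation of the density extended by zero: near an interior point its primitive
    from minus infinity is [F - F a]. *)
Lemma integral_derive_ae a b F (f : R -> R) :
  measurable_fun setT f -> mu.-integrable `[a, b] (EFin \o f) ->
  (forall x, a <= x -> x <= b -> F x - F a = \int[mu]_(t in `[a, x]) f t) ->
  {ae mu, forall x, a < x -> x < b -> is_derive x 1 F (f x)}.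
Proof.
move=> mf intf FE; pose g := f \_ `[a, b].
have mI : measurable (`[a, b]%classic : set (measurableTypeR R)) by exact: measurable_itv.
have gE : EFin \o g = (EFin \o f) \_ `[a, b] by rewrite /g -restrict_EFin.
have intg : mu.-integrable setT (EFin \o g).
  by rewrite gE -integrable_mkcond.
have locg : locally_integrable setT g.
  exact: integrable_locally_restrict.
have intNy y : mu.-integrable `]-oo, y] (EFin \o g).
  by apply: integrableS intg => //; exact: measurable_itv.
have := FTC1Ny intNy locg.
apply: filterS => [|x H]; first exact: (ae_filter_ringOfSetsType mu).
move: H => H ax xb; have [dG GE] := H.
have gx : g x = f x by rewrite /g patchE mem_set//= in_itv/= !ltW.
rewrite -gx -GE.
have near_eq : \forall t \near x, \int[mu]_(y in `]-oo, t]) g y + F a = F t.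
  near=> t; have ta : a < t by near: t; exact: lt_nbhsr.
  have tb : t < b by near: t; exact: lt_nbhsl.
  apply/eqP; rewrite eq_sym -subr_eq; apply/eqP; rewrite FE; [|lra..].
  rewrite -Rintegral_mkcondr; congr Rintegral.
  apply/seteqP; split=> y /=; rewrite !in_itv/=.
    by move=> /andP[-> yt]; rewrite yt (le_trans yt (ltW tb)).
  by move=> [-> /andP[-> _]].
apply: near_eq_is_derive near_eq _; rewrite derive1E -[X in is_derive _ _ _ X]addr0.
by apply: is_deriveD; exact/derivableP.
Unshelve. all: by end_near. Qed.

End AbsolutelyContinuous.

(** * Euclidean calculus on row vectors *)

Section Euclid.
Context {R : realType} {d : nat}.
Implicit Types (u v w x y : 'rV[R]_d) (a b : R).

Lemma dotC u v : dot u v = dot v u.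
Proof. by apply: eq_bigr => i _; rewrite mulrC. Qed.

Lemma dotDl u v w : dot (u + v) w = dot u w + dot v w.
Proof. by rewrite -big_split; apply: eq_bigr => i _; rewrite !mxE mulrDl. Qed.

Lemma dotZl a u v : dot (a *: u) v = a * dot u v.
Proof. by rewrite /dot mulr_sumr; apply: eq_bigr => i _; rewrite !mxE mulrA. Qed.

Lemma dotNl u v : dot (- u) v = - dot u v.
Proof. by rewrite -scaleN1r dotZl mulN1r. Qed.

Lemma dotBl u v w : dot (u - v) w = dot u w - dot v w.
Proof. by rewrite dotDl dotNl. Qed.

Lemma dotDr u v w : dot w (u + v) = dot w u + dot w v.
Proof. by rewrite !(dotC w) dotDl. Qed.

Lemma dotZr a u v : dot v (a *: u) = a * dot v u.
Proof. by rewrite !(dotC v) dotZl. Qed.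

Lemma dotNr u v : dot v (- u) = - dot v u.
Proof. by rewrite !(dotC v) dotNl. Qed.

Lemma dotBr u v w : dot w (u - v) = dot w u - dot w v.
Proof. by rewrite !(dotC w) dotBl. Qed.

Lemma dot0l v : dot 0 v = 0.
Proof. by rewrite -(scale0r (0 : 'rV_d)) dotZl mul0r. Qed.

Lemma dot0r v : dot v 0 = 0.
Proof. by rewrite dotC dot0l. Qed.

Lemma dot_ge0 v : 0 <= dot v v.
Proof. by apply: sumr_ge0 => i _; rewrite -expr2 sqr_ge0. Qed.

Lemma enorm_ge0 v : 0 <= enorm v.
Proof. exact: sqrtr_ge0. Qed.

Lemma enorm_sqr v : enorm v ^+ 2 = dot v v.
Proof. by rewrite sqr_sqrtr// dot_ge0. Qed.

Lemma coord_le_enorm v i : `|v ord0 i| <= enorm v.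
Proof.
rewrite -(ler_pXn2r (ltn0Sn 1)) ?nnegrE ?enorm_ge0//.
rewrite enorm_sqr real_normK ?num_real// /dot (bigD1 i)//= -expr2 lerDl.
by apply: sumr_ge0 => j _; rewrite -expr2 sqr_ge0.
Qed.

Lemma mx_norm_le_enorm v : `|v| <= enorm v.
Proof.
rewrite /Num.Def.normr/= mx_normrE bigmax_le ?enorm_ge0// => -[i j] _.
by rewrite ord1 coord_le_enorm.
Qed.

Lemma enorm0 : enorm (0 : 'rV[R]_d) = 0.
Proof. by rewrite /enorm dot0l sqrtr0. Qed.

Lemma enorm_eq0 v : (enorm v == 0) = (v == 0).
Proof.
apply/eqP/eqP => [v0|->]; last exact: enorm0.
by apply/normr0_eq0/eqP; rewrite eq_le normr_ge0 andbT -v0 mx_norm_le_enorm.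
Qed.

Lemma enorm_gt0 v : (0 < enorm v) = (v != 0).
Proof. by rewrite lt_neqAle enorm_ge0 andbT eq_sym enorm_eq0. Qed.

Lemma enormZ a v : enorm (a *: v) = `|a| * enorm v.
Proof.
by rewrite /enorm dotZl dotZr mulrA -expr2 sqrtrM ?sqr_ge0// sqrtr_sqr.
Qed.

Lemma enormN v : enorm (- v) = enorm v.
Proof. by rewrite -scaleN1r enormZ normrN1 mul1r. Qed.

Lemma enormB u v : enorm (u - v) = enorm (v - u).
Proof. by rewrite -enormN opprB. Qed.

(** Cauchy-Schwarz, by expanding the square of [enorm v *: u - enorm u *: v]. *)
Lemma dot_le u v : dot u v <= enorm u * enorm v.
Proof.
have [->|u0] := eqVneq u 0; first by rewrite dot0l enorm0 mul0r.
have [->|v0] := eqVneq v 0; first by rewrite dot0r enorm0 mulr0.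
have eu : 0 < enorm u by rewrite enorm_gt0.
have ev : 0 < enorm v by rewrite enorm_gt0.
have := dot_ge0 (enorm v *: u - enorm u *: v).
rewrite !(dotBl, dotBr, dotZl, dotZr) -!enorm_sqr (dotC v u).
rewrite (_ : _ - _ = 2 * (enorm u * enorm v) * (enorm u * enorm v - dot u v)); last by ring.
by rewrite pmulr_rge0 ?subr_ge0// !mulr_gt0.
Qed.

Lemma normr_dot_le u v : `|dot u v| <= enorm u * enorm v.
Proof. by rewrite ler_norml dot_le andbT lerNl -dotNl -(enormN u) dot_le. Qed.

Lemma enormD u v : enorm (u + v) <= enorm u + enorm v.
Proof.
rewrite -(ler_pXn2r (ltn0Sn 1)) ?nnegrE ?addr_ge0 ?enorm_ge0//.
rewrite enorm_sqr !(dotDl, dotDr) sqrrD !enorm_sqr (dotC v u).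
by have := dot_le u v; lra.
Qed.

Lemma enorm_sub_le u v : enorm u <= enorm v + enorm (u - v).
Proof. by rewrite (le_trans _ (enormD _ _))// addrC subrK. Qed.

Lemma enorm_dist u v : `|enorm u - enorm v| <= enorm (u - v).
Proof.
rewrite ler_norml; have := enorm_sub_le u v; have := enorm_sub_le v u.
by rewrite (enormB v u) => ? ?; apply/andP; split; lra.
Qed.

(** The crude factor [d.+1] is positive in every dimension, zero included, so later estimates can
    divide by it. *)
Lemma enorm_le_mx_norm v : enorm v <= d.+1%:R * `|v|.
Proof.
rewrite -(ler_pXn2r (ltn0Sn 1)) ?nnegrE ?enorm_ge0 ?mulr_ge0//.
rewrite enorm_sqr exprMn; apply: (@le_trans _ _ (\sum_(i < d) `|v| ^+ 2)).
  apply: ler_sum => i _; rewrite -expr2 -real_normK ?num_real//.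
  rewrite ler_pXn2r ?nnegrE// {2}/Num.Def.normr/= mx_normrE.
  exact: (le_bigmax _ _ (ord0, i)).
rewrite sumr_const card_ord -[leLHS]mulr_natl ler_wpM2r ?sqr_ge0//.
by rewrite -natrX ler_nat (leq_trans (leqnSn d))// leq_pmulr.
Qed.

Lemma cvg_enorm {T : Type} {F : set_system T} {FF : Filter F} (f : T -> 'rV[R]_d) x :
  f @ F --> x <-> forall e, 0 < e -> \forall t \near F, enorm (f t - x) < e.
Proof.
split=> [/cvgrPdist_lt fx e e0|fx].
  have d0 : 0 < d.+1%:R :> R by rewrite ltr0n.
  have := fx _ (divr_gt0 e0 d0); apply: filterS => t.
  rewrite distrC ltr_pdivlMr// mulrC; apply: le_lt_trans; exact: enorm_le_mx_norm.
apply/cvgrPdist_lt => e e0; apply: filterS (fx _ e0) => t; apply: le_lt_trans.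
by rewrite distrC mx_norm_le_enorm.
Qed.

Lemma cvg_dot {T : Type} {F : set_system T} {FF : Filter F} (f g : T -> 'rV[R]_d) x y :
  f @ F --> x -> g @ F --> y -> (fun t => dot (f t) (g t)) @ F --> dot x y.
Proof.
move=> fx gy; apply: cvg_big => [|i _]; first exact: add_continuous.
have cc := @coord_continuous R 1 d ord0 i.
by apply: cvgM; [apply: cvg_comp fx (cc x)|apply: cvg_comp gy (cc y)].
Qed.

Lemma cvg_norm_enorm {T : Type} {F : set_system T} {FF : Filter F} (f : T -> 'rV[R]_d) x :
  f @ F --> x -> (fun t => enorm (f t)) @ F --> enorm x.
Proof.
by move=> fx; apply: cvg_comp (cvg_dot fx fx) _; exact: sqrt_continuous.
Qed.

Lemma enorm_continuous : continuous (@enorm R d).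
Proof. by move=> x; exact: (@cvg_norm_enorm _ (nbhs x) _ id x (@cvg_id _ _)). Qed.

Lemma enorm_ball_bounded (f : 'rV[R]_d -> R) r : continuous f ->
  exists2 C : R, 0 < C & forall x, enorm x <= r -> `|f x| <= C.
Proof.
move=> cf; have cpt : compact [set x : 'rV[R]_d | enorm x <= r].
  apply: bounded_closed_compact.
    exists r; split; first exact: num_real.
    move=> M rM x /= xr; apply: le_trans (mx_norm_le_enorm x) _.
    by rewrite (le_trans xr)// ltW.
  have -> : [set x : 'rV[R]_d | enorm x <= r] = enorm @^-1` [set y | y <= r] by [].
  apply: closed_comp; last exact: closed_le.
  by move=> x _; exact: enorm_continuous.
have : compact (f @` [set x : 'rV[R]_d | enorm x <= r]).
  by apply: continuous_compact => //; apply: continuous_subspaceT.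
move=> /compact_bounded[M [_ HM]].
exists (`|M| + 1); first by rewrite ltr_pwDr.
move=> x xr; apply: (HM (`|M| + 1)); last by exists x.
by rewrite (le_lt_trans (ler_norm M))// ltrDl.
Qed.

End Euclid.

(** * Derivatives with explicit remainders and mean value inequalities *)

Section Derivatives.
Context {R : realType}.

Lemma is_derive_eps {W : normedModType R} (f : R -> W) (t : R) (l : W) :
  is_derive t 1 f l <-> forall e : R, 0 < e -> exists2 delta : R, 0 < delta &
    forall h, `|h| < delta -> `|f (t + h) - f t - h *: l| <= e * `|h|.
Proof.
split=> [[df <-] e e0|H].
  have /cvgrPdist_le/(_ _ e0)[delta /= delta0 H] : (fun h => h^-1 *: (f (h *: (1 : R) + t) - f t)) @ 0^' --> 'D_1 f t.
    exact: df.
  exists delta => // h hd; have [->|h0] := eqVneq h 0.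
    by rewrite addr0 subrr scale0r subr0 !normr0 mulr0.
  have := H h; rewrite /ball_/= sub0r normrN => /(_ hd h0) {H}.
  have nh : 0 < `|h| by rewrite normr_gt0.
  rewrite -(ler_pM2r nh).
  rewrite mulrC -normrZ scalerBr scalerA divff// scale1r distrC /GRing.scale/= mulr1.
  by rewrite [h + t]addrC.
have cvgl : (fun h => h^-1 *: (f (h *: (1 : R) + t) - f t)) @ 0^' --> l.
  apply/cvgrPdist_le => e e0; have [delta delta0 {}H] := H _ e0.
  exists delta => //= h; rewrite /ball_/= sub0r normrN => hd h0.
  have := H h hd; rewrite -ler_pdivrMr ?normr_gt0//; apply: le_trans.
  have -> : l - h^-1 *: (f (h *: (1 : R) + t) - f t) = - (h^-1 *: (f (t + h) - f t - h *: l)).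
    by rewrite [in RHS]scalerBr scalerA mulVf// scale1r opprB /GRing.scale/= mulr1 [h + t]addrC.
  by rewrite normrN normrZ normfV mulrC.
by apply: DeriveDef; [apply/cvg_ex; exists l|exact: cvg_lim].
Qed.

Lemma MVT_closed (f df : R -> R) (a b : R) : a <= b ->
  (forall t : R, a <= t -> t <= b -> is_derive t 1 f (df t)) ->
  exists2 c, a <= c /\ c <= b & f b - f a = df c * (b - a).
Proof.
move=> ab H.
have [c||c] := @MVT_segment R f df a b ab.
- by rewrite in_itv/= => /andP[ac cb]; apply: H; exact: ltW.
- apply: derivable_within_continuous => t; rewrite in_itv/= => /andP[ta tb].
  by have [] := H t ta tb.
- by rewrite in_itv/= => /andP[ac cb] E; exists c.
Qed.

Lemma MVT_approx (f df : R -> R) (c e h : R) :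
  (forall t : R, `|t| <= `|h| -> is_derive t 1 f (df t)) ->
  (forall t : R, `|t| <= `|h| -> `|df t - c| <= e) ->
  `|f h - f 0 - c * h| <= e * `|h|.
Proof.
move=> H He.
have [h0|h0] := leP 0 h.
  have [t|t [t0 th] ->] := @MVT_closed f df 0 h h0.
    by move=> t0 th; apply: H; rewrite !ger0_norm.
  by rewrite subr0 -mulrBl normrM ler_wpM2r// He// !ger0_norm.
have [t|t [t0 th] E] := @MVT_closed f df h 0 (ltW h0).
  by move=> ht t0; apply: H; rewrite !ler0_norm ?lerN2// ltW.
have -> : f h - f 0 - c * h = - (f 0 - f h + c * h) by ring.
rewrite E normrN sub0r mulrN addrC -mulrBl normrM distrC ler_wpM2r// He//.
by rewrite !ler0_norm ?lerN2// ltW.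
Qed.

Lemma is_derive_rV {d} (f : R -> 'rV[R]_d) (t : R) (l : 'rV[R]_d) :
  is_derive t 1 f l <-> forall i, is_derive t 1 (fun s => f s ord0 i) (l ord0 i).
Proof.
split=> [[df <-] i|H].
  apply: DeriveDef; first by have /derivable_mxP := df; exact.
  by rewrite derive_mx// mxE.
have df : derivable f t 1.
  by apply/derivable_mxP => i j; rewrite ord1; have [] := H j.
apply: DeriveDef => //; rewrite derive_mx//; apply/rowP => j; rewrite mxE.
by have [_] := H j.
Qed.

Lemma is_derive_dot {d} (f g : R -> 'rV[R]_d) (t : R) (u v : 'rV[R]_d) :
  is_derive t 1 f u -> is_derive t 1 g v ->
  is_derive t 1 (fun s => dot (f s) (g s)) (dot (f t) v + dot u (g t)).
Proof.
move=> /is_derive_rV df /is_derive_rV dg.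
have -> : (fun s => dot (f s) (g s)) = \sum_i (fun s => f s ord0 i * g s ord0 i).
  by apply/funext => s; rewrite fct_sumE.
rewrite /dot -big_split/=; apply: is_derive_sum => i.
have D := is_deriveM (df i) (dg i); apply: is_derive_eq D _.
by rewrite /GRing.scale/= [X in _ + X]mulrC.
Qed.

Lemma is_derive_const {W : normedModType R} (c : W) (t : R) : is_derive t 1 (fun=> c) 0.
Proof. exact: is_derive_cst. Qed.

(* Project on the direction of the increment. *)
Lemma MVT_enorm {d} (f df : R -> 'rV[R]_d) (a b C : R) : a <= b ->
  (forall t : R, a <= t -> t <= b -> is_derive t 1 f (df t)) ->
  (forall t : R, a <= t -> t <= b -> enorm (df t) <= C) ->
  enorm (f b - f a) <= C * (b - a).
Proof.
move=> ab H HC; set u := f b - f a.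
have [->|u0] := eqVneq u 0.
  rewrite enorm0 mulr_ge0 ?subr_ge0// (le_trans (enorm_ge0 (df a)))// HC//.
have [t|t [ta tb]] := @MVT_closed (fun s => dot u (f s)) (fun s => dot u (df s)) a b ab.
  move=> ta tb; apply: is_derive_eq; first exact: is_derive_dot (is_derive_const _ _) (H t ta tb).
  by rewrite dot0l addr0.
rewrite -dotBr -/u -enorm_sqr expr2 => E.
have eu : 0 < enorm u by rewrite enorm_gt0.
rewrite -(ler_pM2l eu) E mulrA ler_wpM2r ?subr_ge0//.
by apply: le_trans (dot_le _ _) _; rewrite ler_wpM2l ?enorm_ge0// HC.
Qed.

(** * Functions of class C^k on R^d *)

Section Smooth.
Context {d : nat}.
Implicit Types (f g : 'rV[R]_d -> R) (x y v : 'rV[R]_d) (i j : 'I_d).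

Lemma is_CkS k f : is_Ck k.+1 f -> is_Ck k f.
Proof.
elim: k f => [|k IH] f [cf H]; first by split.
by split=> // i; have [df Ci] := H i; split => //; exact: IH.
Qed.

Lemma is_Ck_cont k f : is_Ck k f -> forall x, f @ nbhs x --> f x.
Proof. by case: k => [[]|k []]. Qed.
Arguments is_Ck_cont {k f} _ x.

Lemma is_Ck_partial k f i : is_Ck k.+1 f -> is_Ck k (partial i f).
Proof. by move=> [_ /(_ i)[]]. Qed.

Lemma is_Ck_derivable k f i x : is_Ck k.+1 f -> derivable f x (delta_mx ord0 i).
Proof. by move=> [_ /(_ i)[]]. Qed.
Arguments is_Ck_derivable {k f} i x _.

Lemma is_Ck_cst k (c : R) : is_Ck k (fun _ : 'rV[R]_d => c).
Proof.
elim: k c => [|k IH] c.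
  split; last by [].
  exact: cst_continuous.
split; first exact: cst_continuous.
move=> i; split=> [x|]; first exact: derivable_cst.
rewrite (_ : partial i _ = fun=> 0); first exact: IH.
by apply/funext => x; rewrite /partial derive_cst.
Qed.

Lemma is_CkD k f g : is_Ck k f -> is_Ck k g -> is_Ck k (fun x => f x + g x).
Proof.
elim: k f g => [|k IH] f g Cf Cg.
  split; last by [].
  by move=> x; exact: (@cvgD _ _ _ _ (nbhs_filter x) _ _ _ _ (is_Ck_cont Cf x) (is_Ck_cont Cg x)).
split; first by move=> x; exact: (@cvgD _ _ _ _ (nbhs_filter x) _ _ _ _ (is_Ck_cont Cf x) (is_Ck_cont Cg x)).
move=> i; have df x := is_Ck_derivable i x Cf; have dg x := is_Ck_derivable i x Cg.
split=> [x|]; first exact: derivableD.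
rewrite (_ : partial i _ = fun x => partial i f x + partial i g x).
  by apply: IH; exact: is_Ck_partial.
by apply/funext => x; rewrite /partial deriveD.
Qed.

Lemma is_CkM k f g : is_Ck k f -> is_Ck k g -> is_Ck k (fun x => f x * g x).
Proof.
elim: k f g => [|k IH] f g Cf Cg.
  split; last by [].
  by move=> x; exact: (@cvgM _ _ _ (nbhs_filter x) _ _ _ _ (is_Ck_cont Cf x) (is_Ck_cont Cg x)).
split; first by move=> x; exact: (@cvgM _ _ _ (nbhs_filter x) _ _ _ _ (is_Ck_cont Cf x) (is_Ck_cont Cg x)).
move=> i; have df x := is_Ck_derivable i x Cf; have dg x := is_Ck_derivable i x Cg.
split=> [x|]; first exact: derivableM.
rewrite (_ : partial i _ = fun x => f x * partial i g x + g x * partial i f x).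
  apply: is_CkD; first exact: (IH _ _ (is_CkS Cf) (is_Ck_partial i Cg)).
  exact: (IH _ _ (is_CkS Cg) (is_Ck_partial i Cf)).
by apply/funext => x; rewrite /partial deriveM.
Qed.

Lemma is_Ck_sum k n (F : 'I_n -> 'rV[R]_d -> R) :
  (forall m, is_Ck k (F m)) -> is_Ck k (fun x => \sum_m F m x).
Proof.
elim: n F => [|n IH] F CF.
  rewrite (_ : (fun x => _) = fun=> 0); first exact: is_Ck_cst.
  by apply/funext => x; rewrite big_ord0.
rewrite (_ : (fun x => _) = fun x => \sum_(m < n) F (widen_ord (leqnSn n) m) x + F ord_max x).
  by apply: is_CkD => //; apply: IH.
by apply/funext => x; rewrite big_ord_recr.
Qed.

Lemma is_Ck_OM_potential k eps (V : 'rV[R]_d -> R) :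
  is_Ck k.+2 V -> is_Ck k (OM_potential eps V).
Proof.
move=> CV; rewrite (_ : OM_potential eps V = fun x =>
    eps * (\sum_i partial i (partial i V) x) +
    (- 2^-1) * \sum_i partial i V x * partial i V x).
  apply: is_CkD; apply: is_CkM; try exact: is_Ck_cst; apply: is_Ck_sum => i.
    exact/is_Ck_partial/is_Ck_partial.
  by apply: is_CkM; apply: is_Ck_partial; exact: is_CkS.
apply/funext => x; rewrite /OM_potential /laplacian /mxtrace enorm_sqr /dot mulNr.
by congr (_ * _ - _ * _); apply: eq_bigr => i _; rewrite !mxE.
Qed.

Lemma grad_continuous k f : is_Ck k.+1 f -> continuous (grad f).
Proof.
move=> Cf x; apply: (@cvg_enorm R d _ (nbhs x) (nbhs_filter x) (grad f) (grad f x)).2 => e e0.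
have e1 : 0 < e / d.+1%:R by rewrite divr_gt0.
have H i : \forall y \near x, `|partial i f x - partial i f y| < e / d.+1%:R.
  by have /cvgrPdist_lt/(_ _ e1) := is_Ck_cont (is_Ck_partial i Cf) x.
have := filter_forall (nbhs_filter x) H; apply: filterS => y Hy.
apply: le_lt_trans (enorm_le_mx_norm _) _; rewrite mulrC -ltr_pdivlMr//.
rewrite /Num.Def.normr/= mx_normrE bigmax_lt// => -[i j] _.
by rewrite ord1 !mxE distrC Hy.
Qed.

(** The corners of a staircase from 0 to [v] with edges parallel to the axes, along which only
    partial derivatives enter. *)
Definition trunc_row (n : nat) v : 'rV[R]_d := \row_j (if (j < n)%N then v ord0 j else 0).

Lemma enorm_trunc_row n v (h : R) i : `|h| <= `|v ord0 i| -> (i = n :> nat) ->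
  `|trunc_row n v + h *: delta_mx ord0 i| <= enorm v.
Proof.
move=> hv iE; rewrite {1}/Num.Def.normr/= mx_normrE bigmax_le ?enorm_ge0// => -[k j] _ /=.
rewrite !mxE /= (ord1 k) eqxx/= -iE; case: eqVneq => [->|ji].
  by rewrite ltnn add0r mulr1 (le_trans hv)// coord_le_enorm.
by rewrite mulr0 addr0; case: ifP; rewrite ?normr0 ?enorm_ge0 ?coord_le_enorm.
Qed.

Lemma is_derive_line k f i x (t : R) : is_Ck k.+1 f ->
  is_derive t 1 (fun s : R => f (x + s *: delta_mx ord0 i)) (partial i f (x + t *: delta_mx ord0 i)).
Proof.
move=> Cf; have df := is_Ck_derivable i (x + t *: delta_mx ord0 i) Cf.
have E : (fun h : R => h^-1 *: ((fun s : R => f (x + s *: delta_mx ord0 i)) (h *: (1 : R) + t) -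
      (fun s : R => f (x + s *: delta_mx ord0 i)) t)) =
    (fun h : R => h^-1 *: (f (h *: delta_mx ord0 i + (x + t *: delta_mx ord0 i)) -
      f (x + t *: delta_mx ord0 i))).
  apply/funext => h /=; have -> : h *: (1 : R) = h by exact: mulr1.
  rewrite scalerDl.
  by rewrite [x + (_ + _)]addrCA.
by apply: DeriveDef; rewrite /derivable /partial /derive E.
Qed.

(** The increment telescopes along the staircase of [trunc_row]. On each of the [d] edges the mean
    value theorem and the continuity of one partial derivative leave an error of at most
    [e / d.+1 * enorm v]. *)
Lemma C1_differentiable k f x : is_Ck k.+1 f -> forall e, 0 < e ->
  exists2 delta : R, 0 < delta & forall v, enorm v < delta ->
    `|f (x + v) - f x - dot (grad f x) v| <= e * enorm v.
Proof.
move=> Cf e e0; have e1 : 0 < e / d.+1%:R by rewrite divr_gt0.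
have H i : \forall y \near x, `|partial i f x - partial i f y| <= e / d.+1%:R.
  by have /cvgrPdist_le/(_ _ e1) := is_Ck_cont (is_Ck_partial i Cf) x.
have /nbhs_normP[delta/= delta0 {}H] := filter_forall (nbhs_filter x) H.
exists delta => // v vd.
have step n : (n <= d)%N ->
    `|f (x + trunc_row n v) - f x - \sum_(i < d | (i < n)%N) partial i f x * v ord0 i| <=
      e / d.+1%:R * enorm v *+ n.
  elim: n => [_|n IH nd].
    rewrite (_ : trunc_row 0 v = 0); last by apply/rowP => j; rewrite !mxE ltn0.
    by rewrite addr0 subrr big_pred0// ?mulr0n subr0 normr0.
  have nd' := ltnW nd; pose i := Ordinal nd.
  have tE : trunc_row n.+1 v = trunc_row n v + v ord0 i *: delta_mx ord0 i.
    apply/rowP => j; rewrite !mxE eqxx/=; case: eqVneq => [->|ji].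
      by rewrite ltnS leqnn ltnn add0r mulr1.
    rewrite mulr0 addr0 ltnS leq_eqVlt; case: eqP => //= jn.
    by move/eqP: ji; case; exact: val_inj.
  have sE : \sum_(j < d | (j < n.+1)%N) partial j f x * v ord0 j =
      \sum_(j < d | (j < n)%N) partial j f x * v ord0 j + partial i f x * v ord0 i.
    rewrite (bigD1 i)//= addrC; congr (_ + _); apply: eq_bigl => j.
    rewrite ltnS leq_eqVlt -val_eqE/=; case: ltngtP => //.
  pose y := x + trunc_row n v.
  have := @MVT_approx (fun s : R => f (y + s *: delta_mx ord0 i))
    (fun s : R => partial i f (y + s *: delta_mx ord0 i)) (partial i f x) (e / d.+1%:R) (v ord0 i).
  rewrite scale0r addr0 => HM.
  have {}HM : `|f (y + v ord0 i *: delta_mx ord0 i) - f y - partial i f x * v ord0 i| <=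
      e / d.+1%:R * enorm v.
    apply: (@le_trans _ _ (e / d.+1%:R * `|v ord0 i|)).
      apply: HM => t tv; first exact: is_derive_line Cf.
      rewrite distrC; apply: H => /=; rewrite /y -addrA opprD addNKr normrN.
      by apply: le_lt_trans vd; exact: enorm_trunc_row.
    by rewrite ler_wpM2l ?coord_le_enorm// ltW.
  rewrite tE sE addrA -/y mulrSr.
  have -> : f (y + v ord0 i *: delta_mx ord0 i) - f x -
      (\sum_(j < d | (j < n)%N) partial j f x * v ord0 j + partial i f x * v ord0 i) =
    (f y - f x - \sum_(j < d | (j < n)%N) partial j f x * v ord0 j) +
    (f (y + v ord0 i *: delta_mx ord0 i) - f y - partial i f x * v ord0 i) by ring.
  by apply: le_trans (ler_normD _ _) _; rewrite lerD// IH.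
have := step d (leqnn d).
rewrite (_ : trunc_row d v = v); last by apply/rowP => j; rewrite !mxE ltn_ord.
have -> : \sum_(i < d | (i < d)%N) partial i f x * v ord0 i = dot (grad f x) v.
  by apply: eq_big => [i|i _]; rewrite ?ltn_ord// mxE.
move=> /le_trans; apply; rewrite -mulr_natr mulrAC ler_wpM2r ?enorm_ge0//.
by rewrite -mulrA ger_pMr// mulrC ler_pdivrMr// mul1r ler_nat.
Qed.

Lemma is_derive_comp_C1 k f (g : R -> 'rV[R]_d) (t : R) (v : 'rV[R]_d) : is_Ck k.+1 f ->
  is_derive t 1 g v -> is_derive t 1 (fun s => f (g s)) (dot (grad f (g t)) v).
Proof.
move=> Cf dg; apply/is_derive_eps => e e0.
pose K := enorm v + 1; pose G := enorm (grad f (g t)) + 1.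
have K0 : 0 < K by rewrite ltr_wpDl ?enorm_ge0.
have G0 : 0 < G by rewrite ltr_wpDl ?enorm_ge0.
have [d1 d10 H1] := C1_differentiable (g t) Cf (divr_gt0 e0 (mulr_gt0 (ltr0n R 2) K0)).
pose D : R := d.+1%:R; have D0 : 0 < D by rewrite ltr0n.
(* Division by [D] converts the library norm into [enorm]. The 1 ensures that the increment of [g]
   is at most [K * |h|], and [e / (2 * G)] gives this remainder half of the total error. *)
pose e2 := Num.min 1 (e / (2 * G)) / D.
have e20 : 0 < e2 by rewrite divr_gt0// lt_min ltr01 divr_gt0// mulr_gt0.
have [d2 d20 H2] := (is_derive_eps g t v).1 dg _ e20.
exists (Num.min d2 (d1 / K)); first by rewrite lt_min d20 divr_gt0.
move=> h; rewrite lt_min => /andP[hd2 hd1].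
set w := g (t + h) - g t.
have {H2} rem : enorm (w - h *: v) <= Num.min 1 (e / (2 * G)) * `|h|.
  apply: le_trans (enorm_le_mx_norm _) _.
  have := H2 h hd2; rewrite -(ler_pM2l D0) => /le_trans; apply.
  by rewrite /e2 mulrA [D * _]mulrC divfK// gt_eqF.
have wK : enorm w <= K * `|h|.
  have : enorm w <= enorm (h *: v) + enorm (w - h *: v) by exact: enorm_sub_le.
  rewrite enormZ => /le_trans; apply; rewrite /K mulrDl mul1r mulrC lerD2l.
  by apply: le_trans rem _; rewrite ler_piMl// ge_min lexx.
have gE : g (t + h) = g t + w by rewrite /w [RHS]addrC subrK.
clearbody w.
have -> : f (g (t + h)) - f (g t) - h *: dot (grad f (g t)) v =
    (f (g t + w) - f (g t) - dot (grad f (g t)) w) + dot (grad f (g t)) (w - h *: v).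
  by rewrite -gE dotBr dotZr /GRing.scale/=; ring.
apply: le_trans (ler_normD _ _) _; rewrite (splitr e) mulrDl; apply: lerD.
  apply: le_trans (H1 w _) _.
    by apply: le_lt_trans wK _; rewrite mulrC -ltr_pdivlMr.
  apply: (@le_trans _ _ (e / (2 * K) * (K * `|h|))).
    by rewrite ler_wpM2l// divr_ge0 ?mulr_ge0// ltW.
  by rewrite mulrA le_eqVlt; apply/orP; left; apply/eqP; congr (_ * _); field; rewrite gt_eqF.
apply: le_trans (normr_dot_le _ _) _.
apply: (@le_trans _ _ (G * (e / (2 * G) * `|h|))).
  apply: ler_pM; rewrite ?enorm_ge0//; first by rewrite lerDl.
  by apply: le_trans rem _; rewrite ler_wpM2r// ge_min lexx orbT.
by rewrite mulrA le_eqVlt; apply/orP; left; apply/eqP; congr (_ * _); field; rewrite gt_eqF.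
Qed.

Lemma is_derive_segment x v (s : R) : is_derive s 1 (fun s : R => x + s *: v) v.
Proof.
apply/is_derive_eps => e e0; exists 1 => // h _.
have -> : x + (s + h) *: v - (x + s *: v) - h *: v = 0.
  by apply/rowP => j; rewrite !mxE; ring.
by rewrite normr0 mulr_ge0// ltW.
Qed.

Lemma enorm_segment x y r (s : R) : 0 <= s -> s <= 1 -> enorm x <= r -> enorm y <= r ->
  enorm (x + s *: (y - x)) <= r.
Proof.
move=> s0 s1 xr yr.
rewrite (_ : _ + _ = (1 - s) *: x + s *: y); last by apply/rowP => j; rewrite !mxE; ring.
apply: le_trans (enormD _ _) _; rewrite !enormZ !ger0_norm ?subr_ge0//.
have -> : r = (1 - s) * r + s * r by ring.
by apply: lerD; rewrite ler_wpM2l// subr_ge0.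
Qed.

Lemma MVT_segment_grad k f x y : is_Ck k.+1 f -> exists s : R,
  [/\ 0 <= s, s <= 1 & f y - f x = dot (grad f (x + s *: (y - x))) (y - x)].
Proof.
move=> Cf; have [s [s0 s1]] := @MVT_closed (fun s : R => f (x + s *: (y - x)))
  (fun s => dot (grad f (x + s *: (y - x))) (y - x)) 0 1 ler01
  (fun s _ _ => is_derive_comp_C1 Cf (is_derive_segment x (y - x) s)).
rewrite subr0 mulr1 scale1r scale0r addr0 [x + _]addrC subrK => E.
by exists s.
Qed.

Lemma C1_lipschitz k f r : is_Ck k.+1 f -> exists2 C : R, 0 < C &
  forall x y, enorm x <= r -> enorm y <= r -> `|f y - f x| <= C * enorm (y - x).
Proof.
move=> Cf; have [C C0 HC] : exists2 C : R, 0 < C & forall x, enorm x <= r -> `|enorm (grad f x)| <= C.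
  apply: (@enorm_ball_bounded R d (fun x => enorm (grad f x))) => x.
  apply: (@continuous_comp _ _ _ (grad f) (@enorm R d)); first exact: (grad_continuous Cf).
  exact: enorm_continuous.
exists C => // x y xr yr; have [s [s0 s1 ->]] := MVT_segment_grad x y Cf.
apply: le_trans (normr_dot_le _ _) _; rewrite ler_wpM2r ?enorm_ge0//.
by rewrite -[enorm _]ger0_norm ?enorm_ge0//; apply: HC; exact: enorm_segment.
Qed.

Lemma grad_lipschitz k f r : is_Ck k.+2 f -> exists2 C : R, 0 < C &
  forall x y, enorm x <= r -> enorm y <= r -> enorm (grad f y - grad f x) <= C * enorm (y - x).
Proof.
move=> Cf.
have /choice[C HC] : forall i, exists C : R, 0 < C /\
    forall x y, enorm x <= r -> enorm y <= r -> `|partial i f y - partial i f x| <= C * enorm (y - x).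
  by move=> i; have [C C0 HC] := C1_lipschitz r (is_Ck_partial i Cf); exists C.
have S0 : 0 <= \sum_i C i by apply: sumr_ge0 => i _; rewrite ltW// (HC i).1.
exists (d.+1%:R * (\sum_i C i + 1)); first by rewrite mulr_gt0// ltr_wpDl.
move=> x y xr yr; apply: le_trans (enorm_le_mx_norm _) _; rewrite -mulrA ler_wpM2l//.
rewrite {1}/Num.Def.normr/= mx_normrE bigmax_le ?mulr_ge0 ?enorm_ge0 ?addr_ge0// => -[i j] _.
rewrite ord1 !mxE; apply: le_trans ((HC j).2 x y xr yr) _; rewrite ler_wpM2r ?enorm_ge0//.
rewrite (bigD1 j)//= -addrA lerDl addr_ge0// sumr_ge0// => m _.
by rewrite ltW// (HC m).1.
Qed.

Lemma taylor2 k f r : is_Ck k.+2 f -> exists2 C : R, 0 < C &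
  forall x y, enorm x <= r -> enorm y <= r ->
    `|f y - f x - dot (grad f x) (y - x)| <= C * enorm (y - x) ^+ 2.
Proof.
move=> Cf; have [C C0 HC] := grad_lipschitz r Cf; exists C => // x y xr yr.
have [s [s0 s1 ->]] := MVT_segment_grad x y Cf.
rewrite -dotBl; apply: le_trans (normr_dot_le _ _) _; rewrite expr2 mulrA ler_wpM2r ?enorm_ge0//.
apply: (@le_trans _ _ (C * enorm (x + s *: (y - x) - x))).
  by apply: HC => //; exact: enorm_segment.
by rewrite ler_wpM2l ?(ltW C0)// addrC addKr enormZ ger0_norm// ler_piMl// enorm_ge0.
Qed.

(* A step along the gradient cannot overshoot the maximum. *)
Lemma grad_le_gap k f m r : is_Ck k.+2 f -> (forall x, f x <= m) -> exists2 C : R, 0 < C &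
  forall x, enorm x <= r -> enorm (grad f x) ^+ 2 <= C * (m - f x).
Proof.
move=> Cf fm.
have [G G0 HG] : exists2 C : R, 0 < C & forall x, enorm x <= r -> `|enorm (grad f x)| <= C.
  apply: (@enorm_ball_bounded R d (fun x => enorm (grad f x))) => x.
  apply: (@continuous_comp _ _ _ (grad f) (@enorm R d)); first exact: (grad_continuous Cf).
  exact: enorm_continuous.
have [C C0 HC] := taylor2 (r + G) Cf.
(* Step size along the gradient: [s <= 1] stays in the ball of radius [r + G], and [s * C <= 1/2]
   keeps half of the linear gain after the quadratic loss. *)
pose s := (2 * (C + 1))^-1; have s0 : 0 < s by rewrite invr_gt0 mulr_gt0// ltr_wpDr// ltW.
have s1 : s <= 1 by rewrite invf_le1 ?mulr_gt0// ?ltr_wpDr ?ltW//; lra.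
have sC : s * C <= 2^-1.
  by rewrite /s invfM -mulrA ler_piMr ?invr_ge0// mulrC ler_pdivrMr ?mul1r; lra.
exists (2 / s); first by rewrite divr_gt0.
move=> x xr; set g := grad f x.
have gG : enorm g <= G by have := HG x xr; rewrite ger0_norm ?enorm_ge0.
have := HC x (x + s *: g).
have r1 : enorm x <= r + G by rewrite (le_trans xr)// lerDl ltW.
have r2 : enorm (x + s *: g) <= r + G.
  apply: le_trans (enormD _ _) _; rewrite lerD// enormZ gtr0_norm//.
  by apply: le_trans gG; rewrite ler_piMl ?enorm_ge0.
move=> /(_ r1 r2); rewrite -/g [x + _]addrC addrK dotZr -enorm_sqr enormZ (gtr0_norm s0) exprMn.
rewrite ler_norml => /andP[H _]; have := fm (s *: g + x).
move: H; set E := enorm g ^+ 2; set F := f _ => H Fm.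
have E0 : 0 <= E by rewrite sqr_ge0.
have : s * E / 2 <= m - f x.
  have : C * (s ^+ 2 * E) <= s * E / 2.
    have -> : C * (s ^+ 2 * E) = s * E * (s * C) by ring.
    by rewrite ler_wpM2l// mulr_ge0// ltW.
  by lra.
rewrite -ler_pdivrMl ?divr_gt0// invf_div; apply: le_trans.
by rewrite mulrAC.
Qed.

Lemma mulmx_enorm_bound (A : 'M[R]_d) : exists2 C : R, 0 < C & forall v, enorm (v *m A) <= C * enorm v.
Proof.
exists (d.+1%:R * (\sum_j \sum_i `|A i j| + 1)).
  by rewrite mulr_gt0// ltr_wpDl//; apply: sumr_ge0 => j _; apply: sumr_ge0.
move=> v; apply: le_trans (enorm_le_mx_norm _) _; rewrite -mulrA ler_wpM2l//.
have S0 : 0 <= \sum_j \sum_i `|A i j| by apply: sumr_ge0 => j _; apply: sumr_ge0.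
rewrite {1}/Num.Def.normr/= mx_normrE bigmax_le ?mulr_ge0 ?enorm_ge0 ?addr_ge0// => -[k j] _.
rewrite ord1 mxE; apply: le_trans (ler_norm_sum _ _ _) _.
apply: (@le_trans _ _ (\sum_i `|A i j| * enorm v)).
  by apply: ler_sum => i _; rewrite normrM mulrC ler_wpM2l// coord_le_enorm.
rewrite -mulr_suml ler_wpM2r ?enorm_ge0//.
apply: (@le_trans _ _ (\sum_j0 \sum_i `|A i j0|)); last by rewrite lerDl.
by rewrite [leRHS](bigD1 j)//= lerDl; apply: sumr_ge0 => l _; apply: sumr_ge0.
Qed.

Lemma grad_expansion k f x : is_Ck k.+2 f -> grad f x = 0 -> forall e, 0 < e ->
  exists2 delta : R, 0 < delta & forall v, enorm v < delta ->
    enorm (grad f (x + v) - v *m hess f x) <= e * enorm v.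
Proof.
move=> Cf gx0 e e0; have e1 : 0 < e / d.+1%:R by rewrite divr_gt0.
have /choice[D HD] : forall j, exists D : R, 0 < D /\ forall v, enorm v < D ->
    `|partial j f (x + v) - partial j f x - dot (grad (partial j f) x) v| <= e / d.+1%:R * enorm v.
  by move=> j; have [D D0 HD] := C1_differentiable x (is_Ck_partial j Cf) e1; exists D.
have D0 j : 0 < (D j)^-1 by rewrite invr_gt0 (HD j).1.
have S0 : 0 <= \sum_j (D j)^-1 by apply: sumr_ge0 => j _; rewrite ltW.
(* Smaller than every [D j], and well defined also when there is no index. *)
exists (\sum_j (D j)^-1 + 1)^-1; first by rewrite invr_gt0 ltr_wpDl.
move=> v vd; apply: le_trans (enorm_le_mx_norm _) _; rewrite mulrC -ler_pdivlMr// mulrAC.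
have E0 : 0 <= e / d.+1%:R * enorm v by rewrite mulr_ge0 ?enorm_ge0// ltW.
rewrite {1}/Num.Def.normr/= mx_normrE bigmax_le// => -[i j] _.
rewrite ord1 !mxE; have -> : \sum_j0 v ord0 j0 * hess f x j0 j = dot (grad (partial j f) x) v.
  by apply: eq_bigr => l _; rewrite !mxE mulrC.
have -> : partial j f (x + v) = partial j f (x + v) - partial j f x.
  by have /rowP/(_ j) := gx0; rewrite !mxE => ->; rewrite subr0.
apply: (HD j).2; apply: lt_le_trans vd _; rewrite -[leRHS]invrK lef_pV2 ?posrE ?ltr_wpDl//.
by rewrite (bigD1 j)//= -addrA lerDl addr_ge0// sumr_ge0// => l _; rewrite ltW.
Qed.

(* Invertibility of the Hessian H gives |grad f| >= c |v| near x, hence a quadratic gap by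
   [grad_le_gap]; the gap in turn forces the form v H v to be negative definite. *)
Lemma nondegenerate_maximum k f m x : is_Ck k.+2 f -> (forall y, f y <= m) -> f x = m ->
  ~~ eigenvalue (hess f x) 0 -> exists r c : R, [/\ 0 < r, 0 < c &
    forall v, enorm v <= r -> c * enorm v ^+ 2 <= m - f (x + v) /\
      dot (grad f (x + v)) v <= - (c * enorm v ^+ 2)].
Proof.
move=> Cf fm fx nev; set H := hess f x.
have gx0 : grad f x = 0.
  have [C C0 /(_ x (lexx _))] := grad_le_gap (enorm x) Cf fm.
  rewrite fx subrr mulr0 => g0; apply/eqP; rewrite -enorm_eq0 -sqrf_eq0.
  by rewrite eq_le g0 sqr_ge0.
have Hu : H \in unitmx.
  rewrite -row_free_unit; apply: inj_row_free => v vH0; apply/eqP/negPn/negP => v0.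
  by move/negP: nev; apply; apply/eigenvalueP; exists v => //; rewrite scale0r.
have [K K0 HK] := mulmx_enorm_bound (invmx H).
have lowH v : enorm v <= K * enorm (v *m H) by have := HK (v *m H); rewrite mulmxK.
have [C C0 HC] := grad_le_gap (enorm x + 1) Cf fm.
(* [K] bounds the inverse Hessian, so |v H| >= 2 b |v|, and the error [e <= b] of the expansion
   costs at most half of this. The gap constant [c] then follows from [grad_le_gap]; [e <= c / 4]
   serves the bound on the form. *)
pose b := (2 * K)^-1; have b0 : 0 < b by rewrite invr_gt0 mulr_gt0.
pose c := b ^+ 2 / C; have c0 : 0 < c by rewrite divr_gt0// exprn_gt0.
pose e := Num.min b (c / 4); have e0 : 0 < e by rewrite lt_min b0 divr_gt0.
have eb : e <= b by rewrite ge_min lexx.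
have ec : e <= c / 4 by rewrite ge_min lexx orbT.
have [delta delta0 Hd] := grad_expansion Cf gx0 e0.
exists (Num.min 1 (delta / 2)), (c / 4); split.
- by rewrite lt_min ltr01 divr_gt0.
- by rewrite divr_gt0.
have gap v : enorm v <= Num.min 1 (delta / 2) -> c * enorm v ^+ 2 <= m - f (x + v).
  rewrite le_min => /andP[v1 vd]; have vd' : enorm v < delta by lra.
  have {}Hd := Hd v vd'.
  have g1 : b * enorm v <= enorm (grad f (x + v)).
    have h1 := enorm_sub_le (v *m H) (grad f (x + v)).
    have h2 := lowH v; rewrite enormB in h1.
    have h3 : 2 * b * enorm v <= enorm (v *m H).
      have -> : 2 * b = K^-1 by rewrite /b; field; rewrite gt_eqF.
      by rewrite ler_pdivrMl.
    have h4 : e * enorm v <= b * enorm v by rewrite ler_wpM2r ?enorm_ge0.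
    by lra.
  have g2 := HC (x + v) _.
  have {}g2 : enorm (grad f (x + v)) ^+ 2 <= C * (m - f (x + v)).
    by apply: g2; apply: le_trans (enormD _ _) _; rewrite lerD2l.
  rewrite /c mulrAC ler_pdivrMr// mulrC [leRHS]mulrC -exprMn; apply: le_trans g2.
  by rewrite mulrC ler_pXn2r ?nnegrE ?mulr_ge0 ?enorm_ge0 ?(ltW b0).
move=> v vr; have gv := gap v vr; have q0 : 0 <= enorm v ^+ 2 by rewrite sqr_ge0.
have cq0 : 0 <= c * enorm v ^+ 2 by rewrite mulr_ge0// ltW.
split; first by apply: le_trans gv; rewrite mulrAC ler_pdivrMr//; lra.
have [->|v0] := eqVneq v 0; first by rewrite dot0r enorm0 expr0n mulr0 oppr0.
have cq1 : 0 < c * enorm v ^+ 2 by rewrite mulr_gt0// exprn_gt0// enorm_gt0.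
have vd : enorm v < delta by move: vr; rewrite le_min => /andP[_ vd]; lra.
have approx (s : R) : 0 <= s -> s <= 1 ->
    `|dot (grad f (x + s *: v)) v - s * dot (v *m H) v| <= c / 4 * enorm v ^+ 2.
  move=> s0 s1; have svd : enorm (s *: v) < delta.
    by apply: le_lt_trans vd; rewrite enormZ ger0_norm// ler_piMl// enorm_ge0.
  have := Hd _ svd; rewrite -scalemxAl -dotZl -dotBl => h.
  apply: le_trans (normr_dot_le _ _) _; rewrite expr2 mulrA ler_wpM2r ?enorm_ge0//.
  apply: le_trans h _; apply: ler_pM => //; rewrite ?enorm_ge0 ?(ltW e0)//.
  by rewrite enormZ ger0_norm// ler_piMl// enorm_ge0.
(* At the mean value point [s] the gap becomes an upper bound for [s * Q], hence for [Q] since [s]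
   lies in [0, 1]; the expansion at the end point 1 then transfers it to the gradient. *)
have [s [s0 s1]] := MVT_segment_grad x (x + v) Cf.
have -> : x + v - x = v by rewrite addrC addKr.
rewrite fx => E.
have := approx s s0 s1; have := approx 1 ler01 (lexx 1).
rewrite -E scale1r mul1r !ler_norml => /andP[_ a1] /andP[a2 _].
set Q := dot (v *m H) v in a1 a2.
have : Q <= - (c / 2 * enorm v ^+ 2).
  have : s * Q <= - (3 / 4 * (c * enorm v ^+ 2)) by lra.
  have [Q0|/ltW Q0] := leP 0 Q; first by have : 0 <= s * Q by [rewrite mulr_ge0]; lra.
  have : 0 <= (1 - s) * - Q by rewrite mulr_ge0 ?subr_ge0 ?oppr_ge0.
  by lra.
by lra.
Qed.

End Smooth.
End Derivatives.

(** * Null sets and absolutely continuous paths *)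

Import HBNNSimple.

Section NullSets.
Context {R : realType}.
Notation mu := (@lebesgue_measure R).
Local Notation MR := (measurableTypeR R).

Lemma ae_and (P Q : R -> Prop) : {ae mu, forall x, P x} -> {ae mu, forall x, Q x} ->
  {ae mu, forall x, P x /\ Q x}.
Proof. by move=> HP HQ; exact: (@filterI _ _ (ae_filter_ringOfSetsType mu)). Qed.

Lemma ae_imply (P Q : R -> Prop) : (forall x, P x -> Q x) ->
  {ae mu, forall x, P x} -> {ae mu, forall x, Q x}.
Proof. by move=> PQ; exact: (@filterS _ _ (ae_filter_ringOfSetsType mu)). Qed.

Lemma ae_neq (a : R) : {ae mu, forall x : R, x != a}.
Proof.
exists [set a]; split; [exact: measurable_set1|exact: lebesgue_measure_set1|].
by move=> x /= /negP; rewrite negbK => /eqP.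
Qed.

Lemma ae_itv (a b : R) (P : R -> Prop) :
  {ae mu, forall x, a < x -> x < b -> P x} -> {ae mu, forall x, `[a, b]%classic x -> P x}.
Proof.
move=> H; apply: ae_imply (ae_and H (ae_and (ae_neq a) (ae_neq b))) => x [Px [xa xb]].
rewrite /= in_itv/= => /andP[ax bx]; apply: Px.
  by rewrite lt_neqAle eq_sym xa.
by rewrite lt_neqAle xb.
Qed.

(* The Lebesgue integral of the library is a supremum over simple functions, so it ignores null
   sets even for non-measurable integrands. *)
Lemma integral_ae (D : set R) (f g : R -> \bar R) :
  {ae mu, forall x, D x -> f x = g x} ->
  (\int[mu]_(x in D) f x = \int[mu]_(x in D) g x)%E.
Proof.
move=> [N [mN N0 HN]]; have fg x : ~ N x -> D x -> f x = g x.
  by move=> nN Dx; apply: contrapT => h; apply: nN; apply: HN => /= /(_ Dx).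
have key (u v : R -> \bar R) : (forall x, (0 <= u x)%E) -> (forall x, (0 <= v x)%E) ->
    (forall x, ~ N x -> u x = v x) -> (\int[mu]_x u x <= \int[mu]_x v x)%E.
  move=> u0 v0 uv; rewrite ge0_integralTE//; apply: ge_ereal_sup => _ [h hu <-].
  rewrite ge0_integralTE//; apply: ereal_sup_ubound.
  (* Cutting off [N] puts a simple function below [u] under [v] everywhere, and does not change its
     integral. *)
  pose w := mul_nnsfun h (indic_nnsfun R (measurableC mN)).
  have wE x : w x = h x * \1_(~` N) x by [].
  exists w.
    move=> x; apply: (@le_trans _ _ (h x * \1_(~` N) x)%:E); first by rewrite -wE.
    rewrite indicE.
    have [xN|xN] := boolP (x \in ~` N); last by rewrite mulr0.
    by rewrite mulr1 -uv; [exact: hu|exact/set_mem].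
  rewrite -!integralT_nnsfun.
  have mh (z : {nnsfun MR >-> R}) : measurable_fun setT (EFin \o z).
    exact/measurable_EFinP.
  have w0 (z : {nnsfun MR >-> R}) x : (0 <= (EFin \o z) x)%E by rewrite lee_fin fun_ge0.
  rewrite (ge0_negligible_integral mN measurableT (mh _) (fun x _ => w0 _ x) N0).
  rewrite [RHS](ge0_negligible_integral mN measurableT (mh _) (fun x _ => w0 _ x) N0).
  apply: eq_integral => x; rewrite inE/= => -[_ xN].
  transitivity (EFin (h x * \1_(~` N) x)); first by rewrite -wE.
  by rewrite indicE (mem_set (xN : (~` N) x)) mulr1.
rewrite integralE [RHS]integralE; congr (_ - _)%E; rewrite integral_mkcond [RHS]integral_mkcond;
  apply/eqP; rewrite eq_le; apply/andP; split;
  apply: key => x; rewrite ?patchE; try by case: ifP => // _; rewrite ?funepos_ge0 ?funeneg_ge0.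
- by move=> xN; case: ifPn => // /set_mem Dx; rewrite !funeposE fg.
- by move=> xN; case: ifPn => // /set_mem Dx; rewrite !funeposE fg.
- by move=> xN; case: ifPn => // /set_mem Dx; rewrite !funenegE fg.
- by move=> xN; case: ifPn => // /set_mem Dx; rewrite !funenegE fg.
Qed.

Lemma Rintegral_ae (D : set R) (f g : R -> R) :
  {ae mu, forall x, D x -> f x = g x} ->
  \int[mu]_(x in D) f x = \int[mu]_(x in D) g x.
Proof.
move=> H; rewrite /Rintegral; congr fine; apply: integral_ae.
by apply: ae_imply H => x H /H ->.
Qed.

Definition itg (a b : R) (f : R -> R) := mu.-integrable `[a, b] (EFin \o f).

Lemma mitv (a b : R) : measurable (`[a, b]%classic : set MR).
Proof. exact: measurable_itv. Qed.

Lemma itgD (a b : R) f g : itg a b f -> itg a b g -> itg a b (fun t => f t + g t).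
Proof. by move=> hf hg; exact: (integrableD (mitv a b) hf hg). Qed.

Lemma itgZ (a b k : R) f : itg a b f -> itg a b (fun t => k * f t).
Proof. by move=> hf; exact: (integrableZl (mitv a b) k hf). Qed.

Lemma itgB (a b : R) f g : itg a b f -> itg a b g -> itg a b (fun t => f t - g t).
Proof. by move=> hf hg; exact: (integrableB (mitv a b) hf hg). Qed.

Lemma itg_cont (a b : R) (f : R -> R) : continuous f -> itg a b f.
Proof.
move=> cf; apply: continuous_compact_integrable; first exact: segment_compact.
exact: continuous_subspaceT.
Qed.

Lemma itg_sub (a b c : R) f : c <= b -> itg a b f -> itg a c f.
Proof.
move=> cb; apply: integrableS; [exact: mitv|exact: mitv|].
by apply: subset_itvl; rewrite bnd_simp.
Qed.

Lemma itg_fine (a b : R) (f : R -> R) : itg a b f ->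
  (\int[mu]_(t in `[a, b]) (f t)%:E)%E = (\int[mu]_(t in `[a, b]) f t)%:E.
Proof. by move=> hf; rewrite /Rintegral fineK//; exact: integrable_fin_num hf. Qed.

Lemma itg_dominated (a b : R) (f g : R -> R) : measurable_fun setT f ->
  (forall t, `|f t| <= g t) -> itg a b g -> itg a b f.
Proof.
move=> mf fg; apply: le_integrable; first exact: mitv.
  by apply/measurable_EFinP; apply: measurable_funS mf.
move=> t _ /=; rewrite lee_fin; apply: le_trans (fg t) _; exact: ler_norm.
Qed.

Lemma Rintegral_const (a b k : R) : a <= b -> \int[mu]_(t in `[a, b]) k = k * (b - a).
Proof.
move=> ab; rewrite Rintegral_cst; last exact: mitv.
congr (_ * _); rewrite -[RHS]/(fine (b - a)%:E); congr fine.
rewrite [LHS]lebesgue_measure_itv/= lte_fin; case: ltP => // ba.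
by rewrite (_ : b = a) ?subrr//; apply/eqP; rewrite eq_le ba ab.
Qed.

Lemma le_Rint (a b : R) f g : itg a b f -> itg a b g ->
  (forall t, a <= t -> t <= b -> f t <= g t) ->
  \int[mu]_(t in `[a, b]) f t <= \int[mu]_(t in `[a, b]) g t.
Proof.
move=> hf hg fg; apply: le_Rintegral => //.
by move=> t /=; rewrite in_itv/= => /andP[]; exact: fg.
Qed.

Lemma is_derive_unique (W : normedModType R) (f : R -> W) (t : R) (u v : W) :
  is_derive t 1 f u -> is_derive t 1 f v -> u = v.
Proof. by move=> [_ <-] [_ <-]. Qed.

(** By uniqueness of derivatives [k] equals the density of [scalar_ac_integral] almost everywhere,
    and [Rintegral_ae] accepts any such [k], measurable or not. *)
Lemma scalar_ac_FTC (a b : R) (F k : R -> R) : a <= b -> scalar_ac a b F ->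
  {ae mu, forall x, a < x -> x < b -> is_derive x 1 F (k x)} ->
  \int[mu]_(t in `[a, b]) k t = F b - F a.
Proof.
move=> ab acF H; have [f [mf intf FE]] := scalar_ac_integral ab acF.
rewrite FE//; apply: Rintegral_ae; apply: ae_itv.
apply: ae_imply (ae_and H (integral_derive_ae mf intf FE)) => x [h1 h2] ax xb.
exact: is_derive_unique (h1 ax xb) (h2 ax xb).
Qed.

Lemma clamp_continuous (a b : R) : a <= b -> continuous (clamp a b).
Proof.
move=> ab x; apply/cvgrPdist_lt => e e0; near=> y.
have : `|x - y| < e by near: y; exact: cvgr_dist_lt.
apply: le_lt_trans; have [xy|/ltW yx] := leP x y.
  rewrite distrC [leRHS]distrC !ger0_norm ?subr_ge0 ?clamp_le//; exact: clamp_dist.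
by rewrite !ger0_norm ?subr_ge0 ?clamp_le//; exact: clamp_dist.
Unshelve. all: by end_near. Qed.

Lemma antiderivative (g : R -> R) (b : R) : continuous g -> exists2 F : R -> R, F 0 = 0 &
  forall t, 0 <= t -> t <= b -> is_derive t 1 F (g t).
Proof.
(* Integration starts at -1, so that the derivative at 0 is two-sided. *)
move=> cg; pose F0 (t : R) := \int[mu]_(s in `[(-1)%R, t]) g s.
exists (fun t => F0 t - F0 0); first by rewrite subrr.
move=> t t0 tb; have [] := @continuous_FTC1_closed R g (-1) t (t + 1) _ (itg_cont (-1) (t + 1) cg) _ (cg t).
- lra.
- lra.
move=> dF FE; rewrite -[g t]subr0; apply: is_deriveB; rewrite -FE derive1E; exact/derivableP.
Qed.

End NullSets.

(** * Absolutely continuous paths in R^d *)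

Section AbsContPaths.
Context {R : realType} {d : nat}.
Notation mu := (@lebesgue_measure R).
Implicit Types (psi chi : R -> 'rV[R]_d) (a b : R).

(** The passage from [abs_cont] to [scalar_ac]. The bound with two terms covers coordinates
    ([K = 0]), Lipschitz functions ([B = 0]) and products of a Lipschitz factor with an absolutely
    continuous one. *)
Lemma abs_cont_scalar a b psi (F : R -> R) (B K : R) : 0 <= B -> 0 <= K ->
  abs_cont a b psi ->
  (forall s t, a <= s -> s <= t -> t <= b ->
    `|F t - F s| <= B * enorm (psi t - psi s) + K * (t - s)) ->
  scalar_ac a b F.
Proof.
move=> B0 K0 acp HF e e0.
have B1 : 0 < 2 * (B + 1) by rewrite mulr_gt0// ltr_wpDl.
have K1 : 0 < 2 * (K + 1) by rewrite mulr_gt0// ltr_wpDl.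
have [delta delta0 H] := acp _ (divr_gt0 e0 B1).
exists (Num.min delta (e / (2 * (K + 1)))); first by rewrite lt_min delta0 divr_gt0.
move=> l /andP[/allP lab lap]; rewrite lt_min => /andP[l1 l2].
have {H} := H (size l) (fun i => (nth (0, 0) l i).1) (fun i => (nth (0, 0) l i).2).
have E (G : R * R -> R) : \sum_(i < size l) G (nth (0, 0) l i) = \sum_(x <- l) G x.
  by rewrite [RHS](big_nth (0, 0)) big_mkord.
rewrite (E (fun x => x.2 - x.1)) (E (fun x => enorm (psi x.2 - psi x.1))) => H.
have {}H : \sum_(x <- l) enorm (psi x.2 - psi x.1) < e / (2 * (B + 1)).
  apply: H => //.
  - by move=> i; have /and3P[] := lab _ (mem_nth (0, 0) (ltn_ord i)).
  - apply/trivIsetP => i j _ _ ij; apply/seteqP; split=> // x [].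
    rewrite /= !in_itv/= => /andP[x1 x2] /andP[x3 x4].
    have /(pairwiseP (0, 0)) P := lap.
    have := ij; rewrite -val_eqE neq_ltn => /orP[] ij'.
      have := P i j (ltn_ord i) (ltn_ord j) ij'; rewrite /apart => /orP[] h.
        by have := lt_trans x3 (lt_le_trans x2 h); rewrite ltxx.
      by have := lt_trans x1 (lt_le_trans x4 h); rewrite ltxx.
    have := P j i (ltn_ord j) (ltn_ord i) ij'; rewrite /apart => /orP[] h.
      by have := lt_trans x1 (lt_le_trans x4 h); rewrite ltxx.
    by have := lt_trans x3 (lt_le_trans x2 h); rewrite ltxx.
apply: (@le_lt_trans _ _ (B * \sum_(x <- l) enorm (psi x.2 - psi x.1) + K * \sum_(x <- l) (x.2 - x.1))).
  rewrite !mulr_sumr -big_split/= big_seq [leRHS]big_seq; apply: ler_sum => x /lab/and3P[].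
  exact: HF.
have S0 : 0 <= \sum_(x <- l) enorm (psi x.2 - psi x.1) by rewrite sumr_ge0// => x _; exact: enorm_ge0.
have D0 : 0 <= \sum_(x <- l) (x.2 - x.1).
  by rewrite big_seq sumr_ge0// => x /lab/and3P[_ h _]; rewrite subr_ge0.
move: H l2; rewrite !ltr_pdivlMr//; lra.
Qed.

Lemma abs_cont_dominated a b psi chi (B K : R) : 0 <= B -> 0 <= K -> abs_cont a b psi ->
  (forall s t, a <= s -> s <= t -> t <= b ->
    enorm (chi t - chi s) <= B * enorm (psi t - psi s) + K * (t - s)) ->
  abs_cont a b chi.
Proof.
move=> B0 K0 acp Hc e e0.
have B1 : 0 < 2 * (B + 1) by rewrite mulr_gt0// ltr_wpDl.
have K1 : 0 < 2 * (K + 1) by rewrite mulr_gt0// ltr_wpDl.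
have [delta delta0 H] := acp _ (divr_gt0 e0 B1).
exists (Num.min delta (e / (2 * (K + 1)))); first by rewrite lt_min delta0 divr_gt0.
move=> n s t st ti; rewrite lt_min => /andP[l1 l2]; have {}H := H n s t st ti l1.
apply: (@le_lt_trans _ _ (B * \sum_i enorm (psi (t i) - psi (s i)) + K * \sum_i (t i - s i))).
  rewrite !mulr_sumr -big_split/=; apply: ler_sum => i _; have [h1 [h2 h3]] := st i.
  exact: Hc.
have S0 : 0 <= \sum_i enorm (psi (t i) - psi (s i)) by rewrite sumr_ge0// => x _; exact: enorm_ge0.
have D0 : 0 <= \sum_i (t i - s i).
  by rewrite sumr_ge0// => i _; rewrite subr_ge0; have [_ []] := st i.
move: H l2; rewrite !ltr_pdivlMr//; lra.
Qed.

Lemma abs_cont_cst a b (c : 'rV[R]_d) : abs_cont a b (fun=> c).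
Proof.
move=> e e0; exists 1 => // n s t _ _ _; rewrite big1// => i _.
by rewrite subrr enorm0.
Qed.

Lemma lipschitz_abs_cont a b chi (K : R) : 0 <= K ->
  (forall s t, a <= s -> s <= t -> t <= b -> enorm (chi t - chi s) <= K * (t - s)) ->
  abs_cont a b chi.
Proof.
move=> K0 H; apply: (abs_cont_dominated (lexx 0) K0 (abs_cont_cst a b 0)) => s t as_ st tb.
by rewrite mul0r add0r H.
Qed.

Lemma lipschitz_scalar_ac a b (F : R -> R) (K : R) : 0 <= K ->
  (forall s t, a <= s -> s <= t -> t <= b -> `|F t - F s| <= K * (t - s)) ->
  scalar_ac a b F.
Proof.
move=> K0 H; apply: (abs_cont_scalar (lexx 0) K0 (abs_cont_cst a b 0)) => s t as_ st tb.
by rewrite mul0r add0r H.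
Qed.

Lemma abs_cont_uniform a b psi : abs_cont a b psi -> forall e, 0 < e ->
  exists2 delta : R, 0 < delta & forall s t, a <= s -> s <= t -> t <= b -> t - s < delta ->
    enorm (psi t - psi s) < e.
Proof.
move=> acp e e0; have [delta delta0 H] := acp e e0; exists delta => // s t as_ st tb ts.
have := H 1%N (fun=> s) (fun=> t); rewrite !big_ord1; apply=> //.
by apply/trivIsetP => i j _ _; rewrite !ord1.
Qed.

Lemma abs_cont_clamp a b psi : a <= b -> abs_cont a b psi -> continuous (fun t => psi (clamp a b t)).
Proof.
move=> ab acp x; apply/cvg_enorm => e e0.
have [delta delta0 H] := abs_cont_uniform acp e0; near=> y.
have xy : `|x - y| < delta by near: y; exact: cvgr_dist_lt.
have [ax xb] := clamp_itv x ab; have [ay yb] := clamp_itv y ab.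
have [le_xy|/ltW le_yx] := leP x y.
  apply: H => //; first exact: clamp_le.
  apply: le_lt_trans (clamp_dist ab le_xy) _.
  by rewrite distrC ger0_norm ?subr_ge0 in xy.
rewrite enormB; apply: H => //; first exact: clamp_le.
apply: le_lt_trans (clamp_dist ab le_yx) _.
by rewrite ger0_norm ?subr_ge0 in xy.
Unshelve. all: by end_near. Qed.

Lemma continuous_bounded_on (a b : R) (f : R -> R) : a <= b -> continuous f ->
  exists2 B : R, 0 < B & forall t, a <= t -> t <= b -> `|f t| <= B.
Proof.
move=> ab cf; have cg : {within `[a, b], continuous (fun t => `|f t|)}.
  apply: continuous_subspaceT => x; apply: continuous_comp; [exact: cf|exact: norm_continuous].
have [c _ Hc] := EVT_max ab cg; exists (`|f c| + 1); first by rewrite ltr_wpDl.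
by move=> t at_ tb; apply: le_trans (Hc t _) _; rewrite ?in_itv/= ?at_ ?tb// lerDl.
Qed.

Lemma abs_cont_derivative a b psi : a <= b -> abs_cont a b psi -> exists f : R -> 'rV[R]_d,
  [/\ forall i, measurable_fun setT (fun t => f t ord0 i),
      forall i, itg a b (fun t => f t ord0 i) &
      {ae mu, forall t, a < t -> t < b -> is_derive t 1 psi (f t)}].
Proof.
move=> ab acp.
have /choice[f Hf] : forall i, exists f : R -> R, [/\ measurable_fun setT f, itg a b f &
    {ae mu, forall t, a < t -> t < b -> is_derive t 1 (fun s => psi s ord0 i) (f t)}].
  move=> i; have aci : scalar_ac a b (fun s => psi s ord0 i).
    apply: (abs_cont_scalar (ler01 : 0 <= 1) (lexx 0) acp) => s t _ _ _.
    rewrite mul1r mul0r addr0.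
    by have := coord_le_enorm (psi t - psi s) i; rewrite !mxE.
  have [f [mf intf FE]] := scalar_ac_integral ab aci; exists f; split=> //.
  exact: integral_derive_ae mf intf FE.
exists (fun t => \row_i f i t); split=> [i|i|].
- by rewrite (_ : (fun t => _) = f i); [have [] := Hf i|apply/funext => t; rewrite mxE].
- by rewrite (_ : (fun t => _) = f i); [have [] := Hf i|apply/funext => t; rewrite mxE].
have : {ae mu, forall t i, a < t -> t < b -> is_derive t 1 (fun s => psi s ord0 i) (f i t)}.
  apply: (@filter_forall _ _ _ _ (ae_filter_ringOfSetsType mu)) => i.
  by have [] := Hf i.
apply: ae_imply => t H at_ tb; apply/is_derive_rV => i; rewrite mxE; exact: H.
Qed.

Lemma ae_derive1 a b psi (f : R -> 'rV[R]_d) :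
  {ae mu, forall t, a < t -> t < b -> is_derive t 1 psi (f t)} ->
  {ae mu, forall t, `[a, b]%classic t -> derive1 psi t = f t}.
Proof.
move=> H; apply: ae_itv; apply: ae_imply H => t H at_ tb.
by rewrite derive1E; have [] := H at_ tb.
Qed.

End AbsContPaths.

(** * First variation of the action *)

Section ContinuousOnR.
Context {R : realType} {d : nat}.
Implicit Types (f g : R -> 'rV[R]_d).

Lemma dot_continuous f g : continuous f -> continuous g -> continuous (fun t => dot (f t) (g t)).
Proof. by move=> cf cg t; apply: cvg_dot; [exact: cf|exact: cg]. Qed.

Lemma enormc f : continuous f -> continuous (fun t => enorm (f t)).
Proof. by move=> cf t; apply: cvg_norm_enorm; exact: cf. Qed.

Lemma coordc f i : continuous f -> continuous (fun t => f t ord0 i).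
Proof.
by move=> cf t; apply: (@continuous_comp _ _ _ f (fun v => v ord0 i)); [exact: cf|exact: coord_continuous].
Qed.
Arguments coordc {f} i _.

Lemma is_derive_cvg f (t : R) v : is_derive t 1 f v -> f @ t --> f t.
Proof. by move=> [df _]; apply: differentiable_continuous; exact/derivable1_diffP. Qed.

Lemma clamp_comp_continuous f (T : R) (g : R -> 'rV[R]_d) : 0 <= T ->
  (forall t, 0 <= t -> t <= T -> is_derive t 1 f (g t)) -> continuous (fun t => f (clamp 0 T t)).
Proof.
move=> T0 H t; apply: (@continuous_comp _ _ _ (clamp 0 T) f); first exact: clamp_continuous.
by have [h1 h2] := clamp_itv t T0; exact: is_derive_cvg (H _ h1 h2).
Qed.

Lemma antiderivative_rV (g : R -> 'rV[R]_d) (T : R) : continuous g ->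
  exists2 F : R -> 'rV[R]_d, F 0 = 0 & forall t, 0 <= t -> t <= T -> is_derive t 1 F (g t).
Proof.
move=> cg; have /choice[F HF] : forall i, exists F : R -> R, F 0 = 0 /\
    forall t, 0 <= t -> t <= T -> is_derive t 1 F (g t ord0 i).
  by move=> i; have [F F0 HF] := antiderivative T (coordc i cg); exists F.
exists (fun t => \row_i F i t); first by apply/rowP => i; rewrite !mxE (HF i).1.
move=> t t0 tT; apply/is_derive_rV => i.
by rewrite (_ : (fun s => _) = F i); [exact: (HF i).2|apply/funext => s; rewrite mxE].
Qed.

Lemma dot_sqr_add (x y : 'rV[R]_d) : dot (x + y) (x + y) = dot x x + (2 * dot x y + dot y y).
Proof. by rewrite !(dotDl, dotDr) (dotC y x); ring. Qed.

Lemma dot_sqr_var (x y : 'rV[R]_d) (h : R) :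
  dot (x + h *: (x + y)) (x + h *: (x + y)) =
  (1 + h) ^+ 2 * dot x x + (2 * h * (1 + h) * dot x y + h ^+ 2 * dot y y).
Proof. by rewrite !(dotDl, dotDr, dotZl, dotZr) (dotC y x); ring. Qed.

Lemma quadratic_ge0_zero (S K : R) :
  (forall h, `|h| <= 1 -> 0 <= h * S + h ^+ 2 * K) -> S = 0.
Proof.
move=> H; apply/eqP; case: (eqVneq S 0) => // S0; exfalso.
have nS : 0 < `|S| by rewrite normr_gt0.
(* The test value is [h = - S / D]: [D] is at least |S|, so that h is allowed, and exceeds [K], so
   that the linear term wins. *)
pose D := (`|K| + 1) * (`|S| + 1).
have D0 : 0 < D by rewrite mulr_gt0// ltr_wpDl.
have D1 : `|S| <= D.
  by rewrite /D mulrDl mul1r; have : 0 <= `|K| * (`|S| + 1); [rewrite mulr_ge0// addr_ge0|lra].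
have := H (- S / D); rewrite normrM normrN normfV (gtr0_norm D0) ler_pdivrMr// mul1r => /(_ D1).
have -> : - S / D * S + (- S / D) ^+ 2 * K = - (S ^+ 2 / D ^+ 2 * (D - K)).
  by field; rewrite gt_eqF.
have S2 : 0 < S ^+ 2 by rewrite lt_neqAle eq_sym sqrf_eq0 S0 sqr_ge0.
rewrite oppr_ge0 pmulr_rle0; last by rewrite (divr_gt0 S2 (exprn_gt0 _ D0)).
have : `|K| + 1 <= D by rewrite /D ler_peMr ?addr_ge0// lerDr.
by have := ler_norm K; lra.
Qed.

End ContinuousOnR.

Section FirstVariation.
Context {R : realType} {d : nat}.
Notation mu := (@lebesgue_measure R).
Variables (U : 'rV[R]_d -> R) (k : nat) (T : R).
Hypotheses (CU : is_Ck k.+2 U) (T0 : 0 < T).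

Let T0' : 0 <= T. Proof. exact: ltW. Qed.

Lemma OM_action_ae psi (f : R -> 'rV[R]_d) :
  {ae mu, forall t, 0 < t -> t < T -> is_derive t 1 psi (f t)} ->
  OM_action U T psi =
    (\int[mu]_(t in `[0%R, T]) (2^-1 * dot (f t) (f t) - U (psi (clamp 0 T t)))%:E)%E.
Proof.
move=> H; apply: integral_ae; apply: ae_imply (ae_derive1 H) => t Ht; rewrite /= in_itv/= => /andP[t0 tT].
by rewrite Ht/= ?in_itv/= ?t0// enorm_sqr clamp_id.
Qed.

Lemma U_clamp_continuous psi : abs_cont 0 T psi -> continuous (fun t => U (psi (clamp 0 T t))).
Proof.
move=> acp t; apply: (@continuous_comp _ _ _ (fun t => psi (clamp 0 T t)) U).
  exact: (abs_cont_clamp T0' acp).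
exact: (is_Ck_cont CU).
Qed.

Lemma OM_action_C1 (X W : R -> 'rV[R]_d) : continuous W ->
  (forall t, 0 <= t -> t <= T -> is_derive t 1 X (W t)) ->
  OM_action U T X = (\int[mu]_(t in `[0, T]) (2^-1 * dot (W t) (W t) - U (X (clamp 0 T t))))%:E.
Proof.
move=> cW dX; rewrite (OM_action_ae (f := W)).
  rewrite itg_fine//; apply: itgB; first by apply/itgZ/itg_cont/dot_continuous.
  apply: itg_cont => t; apply: (@continuous_comp _ _ _ (fun t => X (clamp 0 T t)) U).
    exact: (clamp_comp_continuous T0' dX).
  exact: (is_Ck_cont CU).
by apply: aeW => t t0 tT; apply: dX; exact: ltW.
Qed.

Lemma C1_abs_cont (X W : R -> 'rV[R]_d) : continuous W ->
  (forall t, 0 <= t -> t <= T -> is_derive t 1 X (W t)) -> abs_cont 0 T X.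
Proof.
move=> cW dX; have [B B0 HB] := continuous_bounded_on T0' (enormc cW).
apply: (lipschitz_abs_cont (ltW B0)) => s t s0 st tT; apply: MVT_enorm st _ _ => r sr rt.
  by apply: dX; lra.
by apply: le_trans (ler_norm _) _; apply: HB; lra.
Qed.

(** [U] is bounded along the path, which makes the negative part of the integrand integrable; a
    finite action then forces the positive part to be integrable too. *)
Lemma finite_action_itg psi (f : R -> 'rV[R]_d) : abs_cont 0 T psi ->
  (forall i, measurable_fun setT (fun t => f t ord0 i)) ->
  {ae mu, forall t, 0 < t -> t < T -> is_derive t 1 psi (f t)} ->
  (OM_action U T psi < +oo)%E -> itg 0 T (fun t => dot (f t) (f t)).
Proof.
move=> acp mf df; rewrite (OM_action_ae df).
have cu := U_clamp_continuous acp.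
have [B B0 HB] := continuous_bounded_on T0' cu.
set u := fun t => U (psi (clamp 0 T t)) in cu HB *.
have ma : measurable_fun setT (fun t => dot (f t) (f t)).
  by apply: measurable_sum => i; exact: measurable_funM.
set h := fun t => (2^-1 * dot (f t) (f t) - u t)%:E.
rewrite -/(integral mu `[0, T]%classic h) => hoo.
have mh : measurable_fun `[0, T]%classic h.
  apply/measurable_EFinP; apply: measurable_funTS; apply: measurable_funB.
    exact: measurable_funM.
  exact: continuous_measurable_fun.
have hneg : (\int[mu]_(t in `[0%R, T]) h^\-%E t < +oo)%E.
  apply: (@le_lt_trans _ _ (\int[mu]_(t in `[0%R, T]) B%:E)%E).
    apply: ge0_le_integral => //.
    - exact: measurable_funeneg.
    - move=> t /=; rewrite in_itv/= => /andP[t0 tT].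
      rewrite funenegE /h -EFinN -EFin_max lee_fin ge_max (ltW B0) andbT.
      have := HB t t0 tT; rewrite ler_norml => /andP[_].
      by have := dot_ge0 (f t); rewrite /u; lra.
  rewrite integral_cst//=.
  by rewrite [X in (_ * X)%E]lebesgue_measure_itv/=; case: ifP => _; rewrite ?mule0 ?ltry// -EFinB -EFinM ltry.
have hpos : (\int[mu]_(t in `[0%R, T]) h^\+%E t < +oo)%E.
  have aux (x y : \bar R) : (x - y < +oo)%E -> (y < +oo)%E -> (x < +oo)%E.
    by move: x y => [x||] [y||] //=; rewrite ?ltry ?ltxx.
  by move: hoo; rewrite integralE => /aux/(_ hneg).
have hint : itg 0 T (fun t => 2^-1 * dot (f t) (f t) - u t).
  apply/integrableP; split=> //.
  rewrite (_ : (fun x => _) = (fun x => h^\+%E x + h^\-%E x)%E); last first.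
    by rewrite -fune_abse.
  rewrite ge0_integralD//; first exact: lte_add_pinfty.
  - exact: measurable_funepos.
  - exact: measurable_funeneg.
have -> : (fun t => dot (f t) (f t)) = (fun t => 2 * ((2^-1 * dot (f t) (f t) - u t) + u t)).
  by apply/funext => t; field.
by apply/itgZ/itgD => //; exact: itg_cont.
Qed.

Lemma RintD (f g : R -> R) (a b : R) : itg a b f -> itg a b g ->
  \int[mu]_(t in `[a, b]) (f t + g t) = \int[mu]_(t in `[a, b]) f t + \int[mu]_(t in `[a, b]) g t.
Proof. by move=> hf hg; apply: RintegralD => //; exact: mitv. Qed.

Lemma RintB (f g : R -> R) (a b : R) : itg a b f -> itg a b g ->
  \int[mu]_(t in `[a, b]) (f t - g t) = \int[mu]_(t in `[a, b]) f t - \int[mu]_(t in `[a, b]) g t.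
Proof. by move=> hf hg; apply: RintegralB => //; exact: mitv. Qed.

Lemma RintZ (f : R -> R) (r a b : R) : itg a b f ->
  \int[mu]_(t in `[a, b]) (r * f t) = r * \int[mu]_(t in `[a, b]) f t.
Proof. by move=> hf; apply: RintegralZl => //; exact: mitv. Qed.

(** Comparison with the straight segment shows that a minimizer has finite action. *)
Lemma admissible_segment xs xf : exists2 chi, admissible T xs xf chi & (OM_action U T chi < +oo)%E.
Proof.
pose c := T^-1 *: (xf - xs); pose chi (t : R) := xs + t *: c.
have cc : continuous (fun _ : R => c) by exact: cst_continuous.
have dchi (t : R) : 0 <= t -> t <= T -> is_derive t 1 chi c by move=> _ _; exact: is_derive_segment.
exists chi; last by rewrite (OM_action_C1 cc dchi) ltry.
split; first exact: (C1_abs_cont cc dchi).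
  by rewrite /chi scale0r addr0.
by rewrite /chi /c scalerA divff ?gt_eqF// scale1r addrC subrK.
Qed.

(* Du Bois-Reymond: the variation Phi = psi - X below, X being the solution of X'' = - grad U(psi)
   with the same end points, turns the first variation into the integral of |psi' - X'|^2. *)
Lemma minimizer_C2 xs xf psi : is_minimizer U T xs xf psi ->
  exists X W : R -> 'rV[R]_d, [/\ forall t, 0 <= t -> t <= T -> psi t = X t,
    forall t, 0 <= t -> t <= T -> is_derive t 1 X (W t) &
    forall t, 0 <= t -> t <= T -> is_derive t 1 W (- grad U (X t))].
Proof.
move=> [[acp psi0 psiT] minp].
have [f [mf intf df]] := abs_cont_derivative T0' acp.
have itga : itg 0 T (fun t => dot (f t) (f t)).
  apply: (finite_action_itg acp mf df); have [chi adm choo] := admissible_segment xs xf.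
  exact: le_lt_trans (minp _ adm) choo.
pose p t := psi (clamp 0 T t); have cp : continuous p by exact: (abs_cont_clamp T0' acp).
pose q t := grad U (p t).
have cq : continuous q.
  move=> t; apply: (@continuous_comp _ _ _ p (grad U)); first exact: cp.
  exact: (grad_continuous CU).
have [G G0 dG] := antiderivative_rV T cq.
have cG : continuous (fun t => G (clamp 0 T t)) by exact: (clamp_comp_continuous T0' dG).
have [H H0 dH] := antiderivative_rV T cG.
(* With this [c], the path [- N] below has second derivative - grad U(psi) and goes from [xs] to
   [xf], so that [Phi] vanishes at both ends. *)
pose c := T^-1 *: (xf - xs + H T).
pose g0 t := G (clamp 0 T t) - c.
have cg0 : continuous g0 by move=> t; apply: cvgB; [exact: cG|exact: cvg_cst].
pose N t := H t - xs - t *: c.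
have dN t : 0 <= t -> t <= T -> is_derive t 1 N (g0 t).
  move=> t0 tT; rewrite /g0 -[G _]subr0.
  apply: is_deriveB; first by apply: is_deriveB; exact: dH.
  have := is_derive_segment 0 c t.
  by rewrite (_ : (fun s => _) = fun s : R => s *: c)//; apply/funext => s; rewrite add0r.
pose Phi t := psi t + N t.
have Phi0 : Phi 0 = 0 by rewrite /Phi /N psi0 H0 scale0r subr0 sub0r subrr.
have PhiT : Phi T = 0.
  rewrite /Phi /N psiT /c scalerA divff ?gt_eqF// scale1r.
  by apply/rowP => i; rewrite !mxE; ring.
have [K K0 HK] := continuous_bounded_on T0' (enormc cg0).
have {}HK t : 0 <= t -> t <= T -> enorm (g0 t) <= K.
  by move=> t0 tT; apply: le_trans (ler_norm _) (HK t t0 tT).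
have lipN s t : 0 <= s -> s <= t -> t <= T -> enorm (N t - N s) <= K * (t - s).
  move=> s0 st tT; apply: (MVT_enorm (df := g0)) => // r sr rt; first by apply: dN; lra.
  by apply: HK; lra.
have acPhi : abs_cont 0 T Phi.
  apply: (abs_cont_dominated ler01 (ltW K0) acp) => s t s0 st tT; rewrite mul1r.
  have -> : Phi t - Phi s = (psi t - psi s) + (N t - N s) by rewrite /Phi opprD addrACA.
  by apply: le_trans (enormD _ _) _; rewrite lerD2l lipN.
have cPhi : continuous (fun t => Phi (clamp 0 T t)) by exact: (abs_cont_clamp T0' acPhi).
have [B B0 HB] := continuous_bounded_on T0' (enormc cPhi).
have [Bp Bp0 HBp] := continuous_bounded_on T0' (enormc cp).
have [C C0 HC] := taylor2 (Bp + B) CU.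
pose A := \int[mu]_(t in `[0, T]) dot (f t) (f t).
pose b t := dot (f t) (g0 t).
pose u t := U (p t); have cu : continuous u by exact: (U_clamp_continuous acp).
pose e t := dot (q t) (Phi (clamp 0 T t)).
have ce : continuous e by exact: dot_continuous.
pose ga t := dot (g0 t) (g0 t); have cga : continuous ga by exact: dot_continuous.
have iga : itg 0 T ga by exact: itg_cont.
have iu : itg 0 T u by exact: itg_cont.
have ie : itg 0 T e by exact: itg_cont.
have ione : itg 0 T (fun=> 1) by apply: itg_cont; exact: cst_continuous.
have mb : measurable_fun setT b.
  apply: measurable_sum => i; apply: measurable_funM; first exact: mf.
  by apply: continuous_measurable_fun; exact: coordc.
have ib : itg 0 T b.
  apply: (itg_dominated mb (g := fun t => 2^-1 * (dot (f t) (f t) + ga t))).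
    move=> t; rewrite /ga -!enorm_sqr; apply: le_trans (normr_dot_le _ _) _.
    by have := sqr_ge0 (enorm (f t) - enorm (g0 t)); lra.
  by apply/itgZ/itgD.
set Bb := \int[mu]_(t in `[0, T]) b t; set Ga := \int[mu]_(t in `[0, T]) ga t.
set Q := \int[mu]_(t in `[0, T]) e t; set Uu := \int[mu]_(t in `[0, T]) u t.
(* the action along psi + h Phi *)
have var (h : R) : `|h| <= 1 -> 0 <= h * (A + Bb - Q) + h ^+ 2 * (2^-1 * A + Bb + 2^-1 * Ga + C * B ^+ 2 * T).
  move=> h1; pose chi t := psi t + h *: Phi t.
  have acc : abs_cont 0 T chi.
    apply: (abs_cont_dominated (_ : 0 <= 1 + `|h|) (_ : 0 <= `|h| * K) acp).
    - by rewrite addr_ge0.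
    - by rewrite mulr_ge0// ltW.
    move=> s t s0 st tT.
    have -> : chi t - chi s = (psi t - psi s) + h *: ((psi t - psi s) + (N t - N s)).
      by apply/rowP => i; rewrite /chi /Phi !mxE; ring.
    apply: le_trans (enormD _ _) _; rewrite enormZ.
    have := ler_wpM2l (normr_ge0 h) (le_trans (enormD (psi t - psi s) (N t - N s))
      (lerD (lexx _) (lipN s t s0 st tT))).
    by lra.
  have adm : admissible T xs xf chi by split=> //; rewrite /chi ?Phi0 ?PhiT scaler0 addr0.
  have dchi : {ae mu, forall t, 0 < t -> t < T -> is_derive t 1 chi (f t + h *: (f t + g0 t))}.
    apply: ae_imply df => t df t0 tT; apply: (is_deriveD (df t0 tT)).
    apply: is_deriveZ; apply: (is_deriveD (df t0 tT)).
    by apply: dN; exact: ltW.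
  have := minp _ adm; rewrite (OM_action_ae df) (OM_action_ae dchi).
  rewrite [X in (X <= _)%E]itg_fine; last by apply: itgB => //; exact: itgZ.
  pose v t := U (chi (clamp 0 T t)); have cv : continuous v by exact: (U_clamp_continuous acc).
  have iv : itg 0 T v by exact: itg_cont.
  have E t : dot (f t + h *: (f t + g0 t)) (f t + h *: (f t + g0 t)) =
      (1 + h) ^+ 2 * dot (f t) (f t) + (2 * h * (1 + h) * b t + h ^+ 2 * ga t).
    exact: dot_sqr_var.
  under [X in (_ <= X)%E]eq_integral => t _ do rewrite E.
  have iE : itg 0 T (fun t => (1 + h) ^+ 2 * dot (f t) (f t) + (2 * h * (1 + h) * b t + h ^+ 2 * ga t)).
    by apply: itgD; [|apply: itgD]; exact: itgZ.
  rewrite [X in (_ <= X)%E]itg_fine; last by apply: itgB => //; exact: itgZ.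
  rewrite lee_fin.
  (* The potential enters the action with a minus sign, so the Taylor estimate is used from below;
     its remainder is of order [h ^+ 2]. *)
  have vlow : Uu + (h * Q + - (C * h ^+ 2 * B ^+ 2) * T) <= \int[mu]_(t in `[0, T]) v t.
    have -> : Uu + (h * Q + - (C * h ^+ 2 * B ^+ 2) * T) =
        \int[mu]_(t in `[0, T]) (u t + (h * e t + - (C * h ^+ 2 * B ^+ 2) * 1)).
      rewrite RintD//; last by apply: itgD; exact: itgZ.
      rewrite RintD; [|exact: itgZ|exact: itgZ].
      by rewrite !RintZ// Rintegral_const// mul1r subr0.
    apply: le_Rint => //; first by apply: itgD => //; apply: itgD; exact: itgZ.
    move=> t t0 tT; rewrite mulr1 /u /e /v /chi -/(p t) /q.
    have PB : enorm (Phi (clamp 0 T t)) <= B by apply: le_trans (ler_norm _) (HB t t0 tT).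
    have pB : enorm (p t) <= Bp by apply: le_trans (ler_norm _) (HBp t t0 tT).
    set P := Phi _ in PB *.
    have hP : enorm (h *: P) <= B.
      by rewrite enormZ; apply: le_trans PB; rewrite ler_piMl// enorm_ge0.
    have := HC (p t) (p t + h *: P) _ _.
    have -> : p t + h *: P - p t = h *: P by rewrite addrC addKr.
    rewrite dotZr enormZ exprMn real_normK ?num_real// => /(_ _ _)/[dup] HCt _.
    have {}HCt : `|U (p t + h *: P) - U (p t) - h * dot (grad U (p t)) P| <= C * (h ^+ 2 * enorm P ^+ 2).
      apply: HCt; first by rewrite (le_trans pB)// lerDl ltW.
      by apply: le_trans (enormD _ _) _; rewrite lerD.
    have : C * (h ^+ 2 * enorm P ^+ 2) <= C * h ^+ 2 * B ^+ 2.
      rewrite mulrA; apply: ler_wpM2l; first by rewrite (mulr_ge0 (ltW C0) (sqr_ge0 h)).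
      by rewrite ler_pXn2r ?nnegrE ?enorm_ge0 ?(ltW B0).
    by move: HCt; rewrite ler_norml => /andP[]; lra.
  rewrite RintB; [|exact: itgZ|exact: iu].
  rewrite [X in _ <= X]RintB; [|exact: itgZ|exact: iv].
  rewrite !RintZ// RintD; [|exact: itgZ|by apply: itgD; exact: itgZ].
  rewrite RintD; [|exact: itgZ|exact: itgZ].
  rewrite !RintZ// -/A -/Bb -/Ga -/Uu -/(v _) => ineq.
  by move: ineq vlow; rewrite -/v; lra.
have S1 : A + Bb - Q = 0 by exact: quadratic_ge0_zero var.
(* integration by parts *)
have S2 : Q + (Bb + Ga) = 0.
  pose P t := dot (g0 t) (Phi t).
  have [Kq Kq0 HKq] := continuous_bounded_on T0' (enormc cq).
  have lipg s t : 0 <= s -> s <= t -> t <= T -> enorm (g0 t - g0 s) <= Kq * (t - s).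
    move=> s0 st tT; rewrite /g0 (clamp_id s0 (le_trans st tT)) (clamp_id (le_trans s0 st) tT).
    rewrite opprB addrA subrK; apply: (MVT_enorm (df := q)) => // r sr rt; first exact: dG (le_trans s0 sr) (le_trans rt tT).
    exact: le_trans (ler_norm _) (HKq _ (le_trans s0 sr) (le_trans rt tT)).
  have acP : scalar_ac 0 T P.
    apply: (abs_cont_scalar (ltW K0) (_ : 0 <= Kq * B) acPhi); first by rewrite mulr_ge0 ?ltW.
    move=> s t s0 st tT; rewrite /P.
    have -> : dot (g0 t) (Phi t) - dot (g0 s) (Phi s) =
        dot (g0 t) (Phi t - Phi s) + dot (g0 t - g0 s) (Phi s) by rewrite dotBr dotBl; ring.
    apply: le_trans (ler_normD _ _) _; apply: lerD; apply: le_trans (normr_dot_le _ _) _.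
      by rewrite ler_wpM2r ?enorm_ge0// HK//; lra.
    rewrite mulrAC; apply: ler_pM; rewrite ?enorm_ge0//; first exact: lipg.
    have := HB s; rewrite (clamp_id s0 (le_trans st tT)) => hB.
    exact: le_trans (ler_norm _) (hB s0 (le_trans st tT)).
  have dP : {ae mu, forall t, 0 < t -> t < T -> is_derive t 1 P (e t + (b t + ga t))}.
    apply: ae_imply df => t df t0 tT.
    have dg : is_derive t 1 g0 (q t).
      rewrite -[q t]subr0; apply: is_deriveB.
      have near_eq : \forall s \near t, G s = G (clamp 0 T s).
        by near=> s; rewrite clamp_id//; apply: ltW; near: s; [exact: lt_nbhsr|exact: lt_nbhsl].
      by apply: near_eq_is_derive near_eq _; apply: dG; exact: ltW.
    have dPhi : is_derive t 1 Phi (f t + g0 t).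
      by apply: is_deriveD; [exact: df|apply: dN; exact: ltW].
    apply: is_derive_eq; first exact: is_derive_dot dg dPhi.
    rewrite /e /b /ga clamp_id; [|exact: ltW|exact: ltW].
    by rewrite dotDr (dotC (g0 t) (f t)); ring.
  have := scalar_ac_FTC T0' acP dP; rewrite /P Phi0 PhiT !dot0r subrr.
  by rewrite RintD//; [rewrite RintD|apply: itgD].
have iw : itg 0 T (fun t => dot (f t) (f t) + (2 * b t + ga t)).
  by apply: itgD => //; apply: itgD => //; exact: itgZ.
(* The sum of [S1] and [S2] is the integral of |f + g0|^2, that is of the squared derivative of
   [Phi]. *)
have S3 : \int[mu]_(t in `[0, T]) (dot (f t) (f t) + (2 * b t + ga t)) = 0.
  rewrite RintD//; last by apply: itgD => //; exact: itgZ.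
  rewrite RintD//; last exact: itgZ.
  by rewrite RintZ// -/A -/Bb -/Ga; lra.
have wE t : dot (f t) (f t) + (2 * b t + ga t) = dot (f t + g0 t) (f t + g0 t).
  exact/esym/dot_sqr_add.
have Phiz t : 0 <= t -> t <= T -> Phi t = 0.
  move=> t0 tT; apply/rowP => i; rewrite [RHS]mxE; apply/eqP; rewrite -normr_le0.
  apply/ler_addgt0Pr => eta eta0; rewrite add0r.
  have aci : scalar_ac 0 t (fun s => Phi s ord0 i).
    have acPt : abs_cont 0 t Phi.
      apply: (abs_cont_dominated (ler01 : 0 <= 1) (lexx 0)) => [|s r _ _ _]; last by rewrite mul1r mul0r addr0.
      move=> e' e'0; have [dd dd0 Hd] := acPhi e' e'0; exists dd => // n s r sr.
      by apply: Hd => j; have [? [? ?]] := sr j; split=> //; split=> //; lra.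
    apply: (abs_cont_scalar (ler01 : 0 <= 1) (lexx 0) acPt) => s r _ _ _.
    rewrite mul1r mul0r addr0.
    by have := coord_le_enorm (Phi r - Phi s) i; rewrite !mxE.
  have dPi : {ae mu, forall s, 0 < s -> s < t -> is_derive s 1 (fun s => Phi s ord0 i) ((f s + g0 s) ord0 i)}.
    apply: ae_imply df => s df s0 st; apply: ((is_derive_rV _ _ _).1 _ i).
    exact: (is_deriveD (df s0 (lt_le_trans st tT)) (dN s (ltW s0) (ltW (lt_le_trans st tT)))).
  have := scalar_ac_FTC t0 aci dPi; rewrite /= Phi0 [X in _ - X]mxE subr0 => <-.
  have iwi : itg 0 t (fun s => (f s + g0 s) ord0 i).
    apply: (itg_sub tT); rewrite (_ : (fun s => _) = fun s => f s ord0 i + g0 s ord0 i).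
      by apply: itgD => //; apply/itg_cont/coordc.
    by apply/funext => s; rewrite mxE.
  apply: le_trans (le_normr_Rintegral (mitv 0 t) iwi) _.
  (* Young's inequality z <= al + z^2 / (4 al): the integral of the square is zero, and
     [al * t <= eta] is all that remains. *)
  pose al := eta / T; have al0 : 0 < al by rewrite divr_gt0.
  apply: (@le_trans _ _ (\int[mu]_(s in `[0, t]) (al * 1 + (4 * al)^-1 * (dot (f s) (f s) + (2 * b s + ga s))))).
    apply: le_Rint.
    - exact: (integrable_norm iwi).
    - by apply: (itg_sub tT); apply: itgD; exact: itgZ.
    move=> s _ _; apply: le_trans (coord_le_enorm _ i) _.
    rewrite wE -enorm_sqr mulr1; set z := enorm _.
    have : 0 <= (z - 2 * al) ^+ 2 / (4 * al) by rewrite divr_ge0 ?sqr_ge0// mulr_ge0// ltW.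
    have -> : (z - 2 * al) ^+ 2 / (4 * al) = (4 * al)^-1 * z ^+ 2 - z + al by field; rewrite gt_eqF.
    by lra.
  rewrite RintD; [|by apply: (itg_sub tT); exact: itgZ|by apply: (itg_sub tT); exact: itgZ].
  rewrite RintZ; last by apply: (itg_sub tT).
  rewrite RintZ; last by apply: (itg_sub tT).
  rewrite Rintegral_const// mul1r subr0.
  have -> : \int[mu]_(s in `[0, t]) (dot (f s) (f s) + (2 * b s + ga s)) = 0.
    apply/eqP; rewrite eq_le; apply/andP; split; last first.
      by apply: Rintegral_ge0 => s _; rewrite wE dot_ge0.
    have := @Rintegral_itvB R _ (BLeft 0) (BRight T) t iw.
    rewrite !bnd_simp => /(_ t0 tT); rewrite S3 sub0r => E; rewrite -oppr_ge0 E.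
    by apply: Rintegral_ge0 => s _; rewrite wE dot_ge0.
  rewrite mulr0 addr0 /al mulrAC ler_pdivrMr//.
  by rewrite ler_pM2l.
exists (fun t => - N t), (fun t => - (G t - c)).
have psiX t : 0 <= t -> t <= T -> psi t = - N t.
  by move=> t0 tT; have /eqP := Phiz t t0 tT; rewrite /Phi addr_eq0 => /eqP.
split=> // t t0 tT.
  by apply: is_deriveN; have := dN t t0 tT; rewrite /g0 clamp_id.
have -> : grad U (- N t) = q t - 0 by rewrite -psiX// subr0 /q /p clamp_id.
by apply: is_deriveN; apply: is_deriveB; exact: dG.
Unshelve. all: by end_near.
Qed.

End FirstVariation.

(** * Trajectories of X'' = - grad U(X) *)

Section Newton.
Context {R : realType} {d : nat}.
Notation mu := (@lebesgue_measure R).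
Implicit Types (X W psi : R -> 'rV[R]_d).

Lemma nondecreasing_derive (f df : R -> R) (a b : R) : a <= b ->
  (forall t, a <= t -> t <= b -> is_derive t 1 f (df t)) ->
  (forall t, a <= t -> t <= b -> 0 <= df t) -> f a <= f b.
Proof.
move=> ab H H0; have [c [ac cb] E] := MVT_closed ab H.
by rewrite -subr_ge0 E mulr_ge0 ?subr_ge0 ?H0.
Qed.

Lemma le_derive (f df g dg : R -> R) (a b : R) : a <= b ->
  (forall t, a <= t -> t <= b -> is_derive t 1 f (df t)) ->
  (forall t, a <= t -> t <= b -> is_derive t 1 g (dg t)) ->
  (forall t, a <= t -> t <= b -> df t <= dg t) -> f b - f a <= g b - g a.
Proof.
move=> ab Hf Hg le.
have := @nondecreasing_derive (fun t => g t - f t) (fun t => dg t - df t) a b ab _ _.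
have h1 (t : R) : a <= t -> t <= b -> is_derive t 1 (fun t => g t - f t) (dg t - df t).
  by move=> at_ tb; apply: is_deriveB; [exact: Hg|exact: Hf].
by move=> /(_ h1 (fun t at_ tb => etrans (subr_ge0 _ _) (le t at_ tb))); lra.
Qed.

(** Pointwise estimate for [length_near_maximum] when the energy is at most [m], with h = |y|, w =
    |W| and r = sqrt(|y|^2 + e^2). The speed is at most (1 + 2C) r, and the quotient by r controls c
    (r - e); the loss is proportional to [e], which will be small. *)
Lemma radial_bound_low (c lam C h w e r : R) : 0 < c -> c <= lam -> c <= 1 -> 0 < C ->
  0 <= h -> 0 <= w -> 0 < e -> 0 < r -> r ^+ 2 = h ^+ 2 + e ^+ 2 -> w ^+ 2 <= 2 * C * h ^+ 2 ->
  c / 2 * w <= (1 + 2 * C) * ((lam * h ^+ 2 + w ^+ 2 * e ^+ 2 / r ^+ 2) / r) + (1 + 2 * C) * e.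
Proof.
move=> c0 clam c1 C0 h0 w0 e_gt0 r0 r2 wh; set C1 := 1 + 2 * C.
have C10 : 0 < C1 by rewrite /C1; lra.
have er : e <= r.
  by rewrite -(ler_pXn2r (ltn0Sn 1)) ?nnegrE ?(ltW r0) ?(ltW e_gt0)// r2 lerDr sqr_ge0.
have Wr : w <= C1 * r.
  rewrite -(ler_pXn2r (ltn0Sn 1)) ?nnegrE ?mulr_ge0 ?(ltW C10) ?(ltW r0)//.
  apply: le_trans wh _; rewrite exprMn r2.
  have h1 : 2 * C <= C1 ^+ 2 by rewrite /C1; have := sqr_ge0 C; lra.
  have h2 : 2 * C * h ^+ 2 <= C1 ^+ 2 * h ^+ 2 by rewrite ler_wpM2r ?sqr_ge0.
  have h3 : 0 <= C1 ^+ 2 * e ^+ 2 by rewrite mulr_ge0 ?sqr_ge0.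
  by lra.
have h1 : c * (r - e) <= (lam * h ^+ 2 + w ^+ 2 * e ^+ 2 / r ^+ 2) / r.
  rewrite ler_pdivlMr//.
  have : c * (r - e) * r <= lam * h ^+ 2.
    have -> : h ^+ 2 = (r - e) * r + (r - e) * e by move: r2; lra.
    have h2 : 0 <= (r - e) * r by rewrite mulr_ge0 ?subr_ge0// ltW.
    have h3 : 0 <= lam * ((r - e) * e).
      by apply: mulr_ge0; [exact: le_trans (ltW c0) clam|apply: mulr_ge0; [rewrite subr_ge0|exact: ltW]].
    have : c * ((r - e) * r) <= lam * ((r - e) * r) by rewrite ler_wpM2r.
    by lra.
  have : 0 <= w ^+ 2 * e ^+ 2 / r ^+ 2.
    by apply: divr_ge0; [apply: mulr_ge0|]; exact: sqr_ge0.
  by lra.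
have {}h1 := ler_wpM2l (ltW C10) h1.
have h2 : c / 2 * w <= c * (C1 * r).
  apply: (@le_trans _ _ (c * w)); last by rewrite ler_wpM2l ?(ltW c0).
  by have : 0 <= c * w by [rewrite mulr_ge0 ?(ltW c0)]; lra.
have h3 : c * (C1 * e) <= C1 * e by apply: ler_piMl => //; apply: mulr_ge0; exact: ltW.
by lra.
Qed.

(** The counterpart for energy above [m], where e^2 = 2 (E - m) is prescribed and cannot be made
    small. The speed is then at least [e], and close to the maximum point w^2 e^2 / r^2 takes over
    from lam h^2, so that no loss occurs. *)
Lemma radial_bound_high (c lam C h w e r : R) : 0 < c -> c <= lam -> c <= 1 -> 0 < C ->
  0 <= h -> 0 <= w -> 0 < e -> 0 < r -> r ^+ 2 = h ^+ 2 + e ^+ 2 ->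
  w ^+ 2 <= e ^+ 2 + 2 * C * h ^+ 2 -> e ^+ 2 <= w ^+ 2 ->
  c / 2 * w <= (1 + 2 * C) * ((lam * h ^+ 2 + w ^+ 2 * e ^+ 2 / r ^+ 2) / r).
Proof.
move=> c0 clam c1 C0 h0 w0 e_gt0 r0 r2 wh we; set C1 := 1 + 2 * C.
have C11 : 1 <= C1 by rewrite /C1; lra.
have C10 : 0 < C1 by lra.
have Wr : w <= C1 * r.
  rewrite -(ler_pXn2r (ltn0Sn 1)) ?nnegrE ?mulr_ge0 ?(ltW C10) ?(ltW r0)//.
  apply: le_trans wh _; rewrite exprMn r2.
  have h1 : 2 * C <= C1 ^+ 2 by rewrite /C1; have := sqr_ge0 C; lra.
  have h2 : 2 * C * h ^+ 2 <= C1 ^+ 2 * h ^+ 2 by rewrite ler_wpM2r ?sqr_ge0.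
  have h3 : 1 * e ^+ 2 <= C1 ^+ 2 * e ^+ 2 by rewrite ler_wpM2r ?sqr_ge0// exprn_ege1.
  by lra.
have h1 : c / 2 * r <= (lam * h ^+ 2 + w ^+ 2 * e ^+ 2 / r ^+ 2) / r.
  rewrite ler_pdivlMr//; have -> : c / 2 * r * r = c / 2 * r ^+ 2 by ring.
  have h2 : e ^+ 2 * e ^+ 2 / r ^+ 2 <= w ^+ 2 * e ^+ 2 / r ^+ 2.
    by rewrite !ler_wpM2r ?invr_ge0 ?sqr_ge0.
  have h3 : c / 2 * r ^+ 2 <= lam * h ^+ 2 + e ^+ 2 * e ^+ 2 / r ^+ 2.
    rewrite -(ler_pM2r (exprn_gt0 2 r0)) mulrDl divfK ?gt_eqF ?exprn_gt0//.
    rewrite r2; set g := h ^+ 2; set f := e ^+ 2.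
    have g0 : 0 <= g by rewrite sqr_ge0.
    have f0 : 0 <= f by rewrite sqr_ge0.
    have k1 : c * (g * g) <= lam * (g * g) by rewrite ler_wpM2r// mulr_ge0.
    have k2 : c * (g * f) <= lam * (g * f) by rewrite ler_wpM2r// mulr_ge0.
    have k3 : c * (f * f) <= f * f by rewrite ler_piMl// mulr_ge0.
    have k4 : 0 <= c * (g * g) by apply: mulr_ge0; [exact: ltW|exact: mulr_ge0].
    have k5 : 0 <= c * (f * f) by apply: mulr_ge0; [exact: ltW|exact: mulr_ge0].
    by lra.
  by lra.
have {}h1 := ler_wpM2l (ltW C10) h1.
apply: le_trans h1; rewrite mulrCA; apply: ler_wpM2l => //.
by apply: divr_ge0 => //; exact: ltW.
Qed.

Section Trajectory.
Variables (U : 'rV[R]_d -> R) (k : nat) (T : R) (X W : R -> 'rV[R]_d).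
Hypotheses (CU : is_Ck k.+2 U) (T0 : 0 < T)
  (dX : forall t, 0 <= t -> t <= T -> is_derive t 1 X (W t))
  (dW : forall t, 0 <= t -> t <= T -> is_derive t 1 W (- grad U (X t))).

Let T0' : 0 <= T. Proof. exact: ltW. Qed.

Definition energy := 2^-1 * dot (W 0) (W 0) + U (X 0).

Lemma energy_conserved t : 0 <= t -> t <= T -> enorm (W t) ^+ 2 = 2 * (energy - U (X t)).
Proof.
move=> t0 tT.
pose e (s : R) := 2^-1 * dot (W s) (W s) + U (X s).
have de s : 0 <= s -> s <= t -> is_derive s 1 e 0.
  move=> s0 st; have sT : s <= T by lra.
  have h1 := is_derive_dot (dW s0 sT) (dW s0 sT).
  have h2 := is_derive_comp_C1 CU (dX s0 sT).
  apply: is_derive_eq.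
  by rewrite /GRing.scale/= dotNr dotNl (dotC (W s)); field.
have [c _] := MVT_closed t0 de; rewrite mul0r /e => /eqP; rewrite subr_eq0 => /eqP E.
by rewrite enorm_sqr /energy -E; field.
Qed.

Lemma speed_continuous : continuous (fun t => enorm (W (clamp 0 T t))).
Proof. exact: (enormc (clamp_comp_continuous T0' dW)). Qed.

(** [psi] agrees with [X] on [[0, T]] only: their derivatives are compared at interior points, and
    the integral does not see the end points. *)
Lemma arclength_antiderivative psi : (forall t, 0 <= t -> t <= T -> psi t = X t) ->
  exists l : R -> R, [/\ l 0 = 0,
    forall t, 0 <= t -> t <= T -> is_derive t 1 l (enorm (W t)) &
    forall t, 0 <= t -> t <= T -> arclength t psi = l t].
Proof.
move=> psiX; have [l l0 dl] := antiderivative T speed_continuous.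
have dl' t : 0 <= t -> t <= T -> is_derive t 1 l (enorm (W t)).
  by move=> t0 tT; have := dl t t0 tT; rewrite clamp_id.
exists l; split=> // t t0 tT.
have dpsi : {ae mu, forall s, 0 < s -> s < t -> is_derive s 1 psi (W s)}.
  apply: aeW => s s0 st; have near_eq : \forall r \near s, X r = psi r.
    near=> r; rewrite psiX//; first by apply: ltW; near: r; exact: lt_nbhsr.
    by apply: (@le_trans _ _ t) => //; apply: ltW; near: r; exact: lt_nbhsl.
  by apply: near_eq_is_derive near_eq _; apply: dX; lra.
have [B B0 HB] := continuous_bounded_on T0' speed_continuous.
have acl : scalar_ac 0 t l.
  apply: (lipschitz_scalar_ac (d := d) (ltW B0)) => s r s0 sr rt.
  have [|c [sc cr] ->] := MVT_closed (f := l) (df := fun t => enorm (W t)) sr.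
    by move=> c sc cr; apply: dl'; lra.
  rewrite normrM [`|r - s|]ger0_norm ?subr_ge0// ler_wpM2r ?subr_ge0//.
  by have := HB c; rewrite clamp_id; [apply; lra|lra|lra].
rewrite -[RHS]subr0 -l0 -(scalar_ac_FTC t0 acl (k := fun t => enorm (W t))).
  by apply: Rintegral_ae; apply: ae_imply (ae_derive1 dpsi) => s H /H ->.
by apply: aeW => s s0 st; apply: dl'; lra.
Unshelve. all: by end_near. Qed.

Lemma OM_action_antiderivative psi : (forall t, 0 <= t -> t <= T -> psi t = X t) ->
  exists A : R -> R, [/\ A 0 = 0,
    forall t, 0 <= t -> t <= T -> is_derive t 1 A (2^-1 * enorm (W t) ^+ 2 - U (X t)) &
    OM_action U T psi = (A T)%:E].
Proof.
move=> psiX.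
have cX : continuous (fun t => X (clamp 0 T t)) by exact: (clamp_comp_continuous T0' dX).
have cW : continuous (fun t => W (clamp 0 T t)) by exact: (clamp_comp_continuous T0' dW).
pose a t := 2^-1 * enorm (W (clamp 0 T t)) ^+ 2 - U (X (clamp 0 T t)).
have ca : continuous a.
  move=> t; apply: cvgB.
    by apply: cvgM; [exact: cvg_cst|under eq_fun do rewrite expr2; apply: cvgM; exact: (enormc cW)].
  by apply: (@continuous_comp _ _ _ (fun t => X (clamp 0 T t)) U); [exact: cX|exact: (is_Ck_cont CU)].
have [A A0 dA] := antiderivative T ca.
exists A; split=> //.
  by move=> t t0 tT; have := dA t t0 tT; rewrite /a clamp_id.
have dpsi : {ae mu, forall s, 0 < s -> s < T -> is_derive s 1 psi (W s)}.
  apply: aeW => s s0 st; have near_eq : \forall r \near s, X r = psi r.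
    near=> r; rewrite psiX//; first by apply: ltW; near: r; exact: lt_nbhsr.
    by apply: ltW; near: r; exact: lt_nbhsl.
  by apply: near_eq_is_derive near_eq _; apply: dX; lra.
rewrite (OM_action_ae U dpsi).
have -> : (\int[mu]_(t in `[0%R, T]) (2^-1 * dot (W t) (W t) - U (psi (clamp 0 T t)))%:E)%E =
   (\int[mu]_(t in `[0%R, T]) (a t)%:E)%E.
  apply: eq_integral => t; rewrite inE/= in_itv/= => /andP[t0 tT].
  by rewrite /a clamp_id// psiX// enorm_sqr.
have [B B0 HB] := continuous_bounded_on T0' ca.
have acA : scalar_ac 0 T A.
  apply: (lipschitz_scalar_ac (d := d) (ltW B0)) => s r s0 sr rt.
  have [|c [sc cr] ->] := MVT_closed (f := A) (df := a) sr.
    by move=> c sc cr; apply: dA; lra.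
  by rewrite normrM [`|r - s|]ger0_norm ?subr_ge0// ler_wpM2r ?subr_ge0// HB//; lra.
rewrite itg_fine; last exact: itg_cont.
rewrite (scalar_ac_FTC T0' acA) ?A0 ?subr0//.
by apply: aeW => s s0 st; apply: dA; lra.
Unshelve. all: by end_near. Qed.

Variable l : R -> R.
Hypothesis dl : forall t, 0 <= t -> t <= T -> is_derive t 1 l (enorm (W t)).

Lemma length_nd s t : 0 <= s -> s <= t -> t <= T -> l s <= l t.
Proof.
move=> s0 st tT; apply: (nondecreasing_derive (df := fun t => enorm (W t))) => // r sr rt.
  by apply: dl; lra.
exact: enorm_ge0.
Qed.

Lemma chord_le_length s t : 0 <= s -> s <= t -> t <= T -> enorm (X t - X s) <= l t - l s.
Proof.
move=> s0 st tT; set u := X t - X s.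
have [->|u0] := eqVneq u 0; first by rewrite enorm0 subr_ge0 length_nd.
have eu : 0 < enorm u by rewrite enorm_gt0.
have := @le_derive (fun r => dot u (X r)) (fun r => dot u (W r)) (fun r => enorm u * l r)
  (fun r => enorm u * enorm (W r)) s t st _ _ _.
have h1 r : s <= r -> r <= t -> is_derive r 1 (fun r => dot u (X r)) (dot u (W r)).
  move=> sr rt; apply: is_derive_eq.
    by apply: is_derive_dot (is_derive_const u r) (dX _ _); lra.
  by rewrite dot0l addr0.
have h2 r : s <= r -> r <= t -> is_derive r 1 (fun r => enorm u * l r) (enorm u * enorm (W r)).
  by move=> sr rt; apply: is_deriveZ; apply: dl; lra.
move=> /(_ h1 h2 (fun r _ _ => dot_le u (W r))).
by rewrite -dotBr -/u -enorm_sqr -mulrBr expr2 ler_pM2l.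
Qed.

(* Along a trajectory near a nondegenerate maximum [xc], put y = X - xc and
   r = sqrt (|y|^2 + e^2); then (y . W / r)' >= c |W|, so the length is bounded by the
   boundary values of |W|. *)
Lemma length_near_maximum (m rho lam C : R) (xc : 'rV[R]_d) : 0 < lam -> 0 < C ->
  (forall v, enorm v <= rho -> [/\ U (xc + v) <= m, m - U (xc + v) <= C * enorm v ^+ 2 &
     dot (grad U (xc + v)) v <= - (lam * enorm v ^+ 2)]) ->
  forall (delta e0 s1 s2 : R), 0 <= s1 -> s1 <= s2 -> s2 <= T -> 0 <= delta -> 0 <= e0 ->
  2 * (energy - m) <= e0 ^+ 2 ->
  (forall t, s1 <= t -> t <= s2 -> enorm (X t - xc) <= rho) ->
  enorm (X s1 - xc) <= delta -> enorm (X s2 - xc) <= delta ->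
  l s2 - l s1 <= 4 * (1 + 2 * C) ^+ 2 / Num.min lam 1 * (delta + e0).
Proof.
move=> lam0 C0 HU delta e0 s1 s2 s10 s12 s2T delta0 e00 Ee inball b1 b2.
pose y t := X t - xc; pose C1 := 1 + 2 * C.
have C11 : 1 <= C1 by rewrite /C1; lra.
have C10 : 0 < C1 by lra.
pose c := Num.min lam 1; have c0 : 0 < c by rewrite lt_min lam0 ltr01.
have clam : c <= lam by rewrite ge_min lexx.
have c1 : c <= 1 by rewrite ge_min lexx orbT.
have yE (t : R) : X t = xc + y t by rewrite /y addrC subrK.
have W2 (t : R) : s1 <= t -> t <= s2 -> enorm (W t) ^+ 2 <= 2 * (energy - m) + 2 * C * enorm (y t) ^+ 2.
  move=> t1 t2; have [_ h _] := HU (y t) (inball t t1 t2).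
  rewrite energy_conserved; [|exact: le_trans t1|exact: le_trans s2T]; rewrite yE.
  by lra.
have Wbd (t : R) : s1 <= t -> t <= s2 -> enorm (y t) <= delta -> enorm (W t) <= C1 * (delta + e0).
  move=> t1 t2 yd.
  have P0 : 0 <= C1 * (delta + e0) by apply: mulr_ge0; [exact: ltW|exact: addr_ge0].
  rewrite -(ler_pXn2r (ltn0Sn 1)) ?nnegrE ?enorm_ge0//.
  apply: le_trans (W2 t t1 t2) _.
  have h1 : enorm (y t) ^+ 2 <= delta ^+ 2 by rewrite ler_pXn2r ?nnegrE ?enorm_ge0.
  have h2 : 2 * C * enorm (y t) ^+ 2 <= 2 * C * delta ^+ 2 by rewrite ler_wpM2l// mulr_ge0// ltW.
  have h3 : C1 * (delta ^+ 2 + e0 ^+ 2) <= C1 ^+ 2 * (delta + e0) ^+ 2.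
    rewrite expr2 -mulrA ler_wpM2l ?(ltW C10)//.
    apply: (@le_trans _ _ ((delta + e0) ^+ 2)).
      by have : 0 <= delta * e0 by [rewrite mulr_ge0]; lra.
    by rewrite ler_peMl ?sqr_ge0.
  have h4 : 0 <= 2 * C * e0 ^+ 2 by rewrite mulr_ge0 ?sqr_ge0// mulr_ge0// ltW.
  have h5 : 0 <= delta ^+ 2 by rewrite sqr_ge0.
  by move: h2 h3; rewrite /C1; lra.
(* [eta] is the error per unit of time. It is a multiple of [e] for energy at most [m] and zero
   above. *)
have main (e eta : R) : 0 < e -> 0 <= eta ->
    (forall t, s1 <= t -> t <= s2 -> let r := Num.sqrt (enorm (y t) ^+ 2 + e ^+ 2) in
      c / 2 * enorm (W t) <= C1 * ((lam * enorm (y t) ^+ 2 + enorm (W t) ^+ 2 * e ^+ 2 / r ^+ 2) / r) + eta) ->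
    l s2 - l s1 <= 4 * C1 ^+ 2 / c * (delta + e0) + 2 / c * eta * T.
  move=> e_gt0 eta0 Hr; pose r t := Num.sqrt (enorm (y t) ^+ 2 + e ^+ 2).
  have q0 (s : R) : 0 < enorm (y s) ^+ 2 + e ^+ 2 by rewrite ltr_wpDl ?sqr_ge0 ?exprn_gt0.
  have r0 (s : R) : 0 < r s by rewrite sqrtr_gt0.
  have r2 (s : R) : r s ^+ 2 = enorm (y s) ^+ 2 + e ^+ 2 by rewrite sqr_sqrtr// ltW.
  have dy (s : R) : s1 <= s -> s <= s2 -> is_derive s 1 y (W s).
    move=> t1 t2; rewrite -[W s]subr0; apply: is_deriveB; apply: dX; [exact: le_trans t1|exact: le_trans s2T].
  pose N s := dot (y s) (W s).
  have dN (s : R) : s1 <= s -> s <= s2 -> is_derive s 1 N (enorm (W s) ^+ 2 - dot (grad U (X s)) (y s)).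
    move=> t1 t2; have h1 := dy s t1 t2; have h2 : is_derive s 1 W (- grad U (X s)) by apply: dW; [exact: le_trans t1|exact: le_trans s2T].
    apply: is_derive_eq; first exact: is_derive_dot h1 h2.
    by rewrite enorm_sqr dotNr (dotC (y s)) addrC.
  have dr (s : R) : s1 <= s -> s <= s2 -> is_derive s 1 r (N s / r s).
    move=> t1 t2; have h1 := dy s t1 t2.
    have h2 : is_derive s 1 (fun s => enorm (y s) ^+ 2 + e ^+ 2) (2 * N s).
      have h3 : is_derive s 1 (fun s => dot (y s) (y s) + e ^+ 2) (2 * N s).
        apply: is_derive_eq; first exact: (is_deriveD (is_derive_dot h1 h1) (is_derive_const (e ^+ 2) s)).
        by rewrite addr0 (dotC (W s)) /N; ring.
      by rewrite (_ : (fun s => _) = (fun s => dot (y s) (y s) + e ^+ 2))//; apply/funext => z; rewrite enorm_sqr.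
    have h4 := @is_derive1_comp R Num.sqrt (fun s => enorm (y s) ^+ 2 + e ^+ 2) s _ _ (is_derive1_sqrt (q0 s)) h2.
    apply: (is_derive_eq h4).
    by rewrite -/(r s); field; rewrite gt_eqF.
  pose Z s := N s * (r s)^-1.
  have dZ (s : R) : s1 <= s -> s <= s2 -> is_derive s 1 Z
      ((enorm (W s) ^+ 2 - dot (grad U (X s)) (y s)) / r s - N s ^+ 2 / r s ^+ 3).
    move=> t1 t2; have hr := dr s t1 t2; have hN := dN s t1 t2.
    have rn : r s != 0 by rewrite gt_eqF.
    have hV := is_deriveV rn hr.
    apply: (is_derive_eq (is_deriveM hN hV)).
    by rewrite /GRing.scale/= /Z; field; rewrite gt_eqF.
  have Zle (s : R) : `|Z s| <= enorm (W s).
    rewrite /Z normrM normfV (gtr0_norm (r0 s)) ler_pdivrMr//.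
    apply: le_trans (normr_dot_le _ _) _; rewrite mulrC ler_wpM2l ?enorm_ge0//.
    by rewrite -(ler_pXn2r (ltn0Sn 1)) ?nnegrE ?enorm_ge0 ?(ltW (r0 s))// r2 lerDl sqr_ge0.
  have dZge (s : R) : s1 <= s -> s <= s2 -> c / 2 * enorm (W s) <=
      C1 * ((enorm (W s) ^+ 2 - dot (grad U (X s)) (y s)) / r s - N s ^+ 2 / r s ^+ 3) + eta.
    move=> t1 t2; apply: le_trans (Hr s t1 t2) _; rewrite -/(r s) lerD2r ler_wpM2l ?(ltW C10)//.
    have [_ _ g1] := HU (y s) (inball s t1 t2); rewrite -yE in g1.
    have -> : (enorm (W s) ^+ 2 - dot (grad U (X s)) (y s)) / r s - N s ^+ 2 / r s ^+ 3 =
      (enorm (W s) ^+ 2 - dot (grad U (X s)) (y s) - N s ^+ 2 / r s ^+ 2) / r s.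
      by field; rewrite gt_eqF.
    rewrite ler_wpM2r ?invr_ge0 ?(ltW (r0 s))//.
    (* Cauchy-Schwarz with |y|^2 = r^2 - e^2 saves the share |W|^2 e^2 / r^2 of the kinetic term. *)
    have N2 : N s ^+ 2 <= (r s ^+ 2 - e ^+ 2) * enorm (W s) ^+ 2.
      rewrite r2 addrK -exprMn -[N s ^+ 2]real_normK ?num_real//.
      by rewrite ler_pXn2r ?nnegrE ?mulr_ge0 ?enorm_ge0// normr_dot_le.
    have : N s ^+ 2 / r s ^+ 2 <= enorm (W s) ^+ 2 - enorm (W s) ^+ 2 * e ^+ 2 / r s ^+ 2.
      rewrite ler_pdivrMr ?exprn_gt0//; apply: le_trans N2 _.
      by rewrite le_eqVlt; apply/orP; left; apply/eqP; field; rewrite gt_eqF.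
    by lra.
  have := @le_derive (fun t => c / 2 * l t) (fun t => c / 2 * enorm (W t))
    (fun t => C1 * Z t + eta * t)
    (fun t => C1 * ((enorm (W t) ^+ 2 - dot (grad U (X t)) (y t)) / r t - N t ^+ 2 / r t ^+ 3) + eta)
    s1 s2 s12 _ _ dZge.
  have h1 (s : R) : s1 <= s -> s <= s2 -> is_derive s 1 (fun s => c / 2 * l s) (c / 2 * enorm (W s)).
    by move=> t1 t2; apply: is_deriveZ; apply: dl; [exact: le_trans t1|exact: le_trans s2T].
  have h2 (s : R) : s1 <= s -> s <= s2 -> is_derive s 1 (fun s => C1 * Z s + eta * s)
      (C1 * ((enorm (W s) ^+ 2 - dot (grad U (X s)) (y s)) / r s - N s ^+ 2 / r s ^+ 3) + eta).
    move=> t1 t2; apply: is_deriveD; first by apply: is_deriveZ; exact: dZ.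
    by rewrite -[X in is_derive _ _ _ X]mulr1; apply: is_deriveZ; exact: is_derive_id.
  move=> /(_ h1 h2) len.
  have z1 := le_trans (Zle s1) (Wbd s1 (lexx _) s12 b1).
  have z2 := le_trans (Zle s2) (Wbd s2 s12 (lexx _) b2).
  have {z1 z2} zz : Z s2 - Z s1 <= 2 * (C1 * (delta + e0)).
    by move: z1 z2; rewrite !ler_norml => /andP[? ?] /andP[? ?]; lra.
  have zz' : C1 * (Z s2 - Z s1) <= C1 * (2 * (C1 * (delta + e0))) by rewrite ler_wpM2l// ltW.
  have eT : eta * (s2 - s1) <= eta * T by rewrite ler_wpM2l//; lra.
  have len' : c / 2 * (l s2 - l s1) <= 2 * C1 ^+ 2 * (delta + e0) + eta * T by lra.
  have -> : 4 * C1 ^+ 2 / c * (delta + e0) + 2 / c * eta * T =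
    (2 * C1 ^+ 2 * (delta + e0) + eta * T) / (c / 2) by field; rewrite gt_eqF.
  by rewrite ler_pdivlMr ?divr_gt0// mulrC.
have [Em|mE] := leP energy m.
  (* let e tend to 0 *)
  apply/ler_addgt0Pr => z z0.
  pose e := z * c / (2 * C1 * T + 1).
  have D0 : 0 < 2 * C1 * T + 1 by rewrite ltr_wpDl// !mulr_ge0// ltW.
  have e_gt0 : 0 < e by rewrite divr_gt0// mulr_gt0.
  apply: le_trans (main e (C1 * e) e_gt0 _ _) _.
  - by rewrite mulr_ge0 ?ltW.
  - move=> t t1 t2; cbv zeta; set r := Num.sqrt _.
    have q0 : 0 < enorm (y t) ^+ 2 + e ^+ 2 by rewrite ltr_wpDl ?sqr_ge0 ?exprn_gt0.
    have r0 : 0 < r by rewrite sqrtr_gt0.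
    have r2 : r ^+ 2 = enorm (y t) ^+ 2 + e ^+ 2 by rewrite sqr_sqrtr// ltW.
    apply: (radial_bound_low c0 clam c1 C0 (enorm_ge0 _) (enorm_ge0 _) e_gt0 r0 r2).
    by apply: le_trans (W2 t t1 t2) _; rewrite gerDr pmulr_rle0// subr_le0.
  rewrite lerD2l /e.
  have -> : 2 / c * (C1 * (z * c / (2 * C1 * T + 1))) * T = z * ((2 * C1 * T) / (2 * C1 * T + 1)).
    by field; rewrite !gt_eqF.
  by rewrite ler_piMr ?(ltW z0)// ler_pdivrMr// mul1r lerDl.
(* Above [m] the regularization is the least possible speed, by energy conservation and [U <= m]. *)
pose e := Num.sqrt (2 * (energy - m)).
have e2 : e ^+ 2 = 2 * (energy - m) by rewrite sqr_sqrtr// mulr_ge0// subr_ge0 ltW.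
have e_gt0 : 0 < e by rewrite sqrtr_gt0 mulr_gt0// subr_gt0.
have := main e 0 e_gt0 (lexx 0); rewrite mulr0 mul0r addr0; apply.
move=> t t1 t2; cbv zeta; set r := Num.sqrt _; rewrite addr0.
have q0 : 0 < enorm (y t) ^+ 2 + e ^+ 2 by rewrite ltr_wpDl ?sqr_ge0 ?exprn_gt0.
have r0 : 0 < r by rewrite sqrtr_gt0.
have r2 : r ^+ 2 = enorm (y t) ^+ 2 + e ^+ 2 by rewrite sqr_sqrtr// ltW.
apply: (radial_bound_high c0 clam c1 C0 (enorm_ge0 _) (enorm_ge0 _) e_gt0 r0 r2).
  by rewrite e2; exact: W2.
have [h _ _] := HU (y t) (inball t t1 t2).
rewrite energy_conserved; [|exact: le_trans t1|exact: le_trans s2T].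
by rewrite yE e2 ler_wpM2l// lerD2l lerN2.
Qed.

End Trajectory.
End Newton.

(** * Minimizers *)

Section Expansion.
Context {R : realType} {d : nat}.

(** Unordered interval: the expansions are wanted on both sides of the base point. *)
Definition between (s t r : R) := (s <= r /\ r <= t) \/ (t <= r /\ r <= s).

Lemma between_l (s t : R) : between s t s.
Proof. by case: (leP s t) => [h|/ltW h]; [left|right]; split. Qed.

Lemma taylor_rV (f g : R -> 'rV[R]_d) (s t K : R) : 0 <= K ->
  (forall r, between s t r -> is_derive r 1 f (g r)) ->
  (forall r, between s t r -> enorm (g r - g s) <= K * `|r - s|) ->
  enorm (f t - f s - (t - s) *: g s) <= K * (t - s) ^+ 2.
Proof.
move=> K0 df Hg; pose h (r : R) := f r - (0 + r *: g s).
have dh r : between s t r -> is_derive r 1 h (g r - g s).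
  by move=> sr; apply: is_deriveB; [exact: df|exact: is_derive_segment].
have hE : f t - f s - (t - s) *: g s = h t - h s.
  by apply/rowP => i; rewrite /h !mxE; ring.
rewrite hE; have [st|/ltW ts] := leP s t.
  rewrite expr2 mulrA; apply: (MVT_enorm (df := fun r => g r - g s)) => // r sr rt.
    by apply: dh; left.
  apply: le_trans (Hg r (or_introl (conj sr rt))) _.
  by rewrite ler_wpM2l// ger0_norm ?subr_ge0// lerD2r.
rewrite enormB (_ : (t - s) ^+ 2 = (s - t) * (s - t)); last by ring.
rewrite mulrA; apply: (MVT_enorm (df := fun r => g r - g s)) => // r sr rt.
  by apply: dh; right.
apply: le_trans (Hg r (or_intror (conj sr rt))) _.
by rewrite ler_wpM2l// distrC ger0_norm ?subr_ge0// lerD2l lerN2.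
Qed.

Lemma taylor_scalar (f g : R -> R) (s t K : R) : 0 <= K ->
  (forall r, between s t r -> is_derive r 1 f (g r)) ->
  (forall r, between s t r -> `|g r - g s| <= K * `|r - s|) ->
  `|f t - f s - (t - s) * g s| <= K * (t - s) ^+ 2.
Proof.
move=> K0 df Hg.
have [c cst ->] : exists2 c, between s t c & f t - f s = g c * (t - s).
  have [st|/ltW ts] := leP s t.
    have [c [sc ct] E] := MVT_closed (f := f) (df := g) st (fun r sr rt => df r (or_introl (conj sr rt))).
    by exists c => //; left.
  have [c [sc ct] E] := MVT_closed (f := f) (df := g) ts (fun r sr rt => df r (or_intror (conj sr rt))).
  exists c; first by right.
  by have -> : f t - f s = - (f s - f t) by [ring]; rewrite E; ring.
have -> : g c * (t - s) - (t - s) * g s = (g c - g s) * (t - s) by ring.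
rewrite normrM -[(t - s) ^+ 2]real_normK ?num_real// expr2 mulrA ler_wpM2r//.
apply: le_trans (Hg c cst) _; rewrite ler_wpM2l//.
by case: cst => -[h1 h2]; rewrite !ler_norml; apply/andP; split; case: (ler0P (t - s)) => ?; lra.
Qed.

(* Delta is the increment of the normalized arclength parameter l/L, and W the momentum. *)
Lemma arclength_expansion (X W Gr : R -> 'rV[R]_d) (l : R -> R) (s t L Delta c Wm G C : R) :
  0 < c -> 0 <= Wm -> 0 <= G -> 0 <= C -> 0 < L ->
  (forall r, between s t r -> [/\ is_derive r 1 X (W r), is_derive r 1 W (- Gr r),
     is_derive r 1 l (enorm (W r)) & c <= enorm (W r) /\ enorm (W r) <= Wm]) ->
  (forall r, between s t r -> enorm (Gr r) <= G) ->
  (forall r, between s t r -> enorm (Gr r - Gr s) <= C * enorm (X r - X s)) ->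
  l t - l s = L * Delta ->
  enorm (X t - X s - Delta *: (L / enorm (W s) *: W s)) <= 2 * G * (L / c) ^+ 2 * Delta ^+ 2 /\
  enorm (W t - W s + Delta *: (L / enorm (W s) *: Gr s)) <=
    (C * Wm + G ^+ 2 / c) * (L / c) ^+ 2 * Delta ^+ 2.
Proof.
move=> c0 Wm0 G0 C0 L0 H HG HC lst; set sg := t - s.
have sub r r' : between s t r -> between s r r' -> between s t r'.
  by move=> [[? ?]|[? ?]] [[? ?]|[? ?]]; [left|left|right|right]; split; lra.
have bound (f g : R -> 'rV[R]_d) K r : between s t r ->
    (forall r, between s t r -> is_derive r 1 f (g r)) ->
    (forall r, between s t r -> enorm (g r) <= K) -> enorm (f r - f s) <= K * `|r - s|.
  move=> sr df Hg; have [le|/ltW le] := leP s r.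
    rewrite ger0_norm ?subr_ge0//; apply: (MVT_enorm (df := g)) => // r' h1 h2.
      by apply: df; apply: sub sr _; left.
    by apply: Hg; apply: sub sr _; left.
  rewrite enormB distrC ger0_norm ?subr_ge0//; apply: (MVT_enorm (df := g)) => // r' h1 h2.
    by apply: df; apply: sub sr _; right.
  by apply: Hg; apply: sub sr _; right.
have ss := between_l s t.
have Wlip r : between s t r -> enorm (W r - W s) <= G * `|r - s|.
  move=> sr; apply: (bound W (fun r => - Gr r)) => // r' h; first by have [] := H r' h.
  by rewrite enormN; exact: HG.
have Xlip r : between s t r -> enorm (X r - X s) <= Wm * `|r - s|.
  move=> sr; apply: (bound X W) => // r' h; first by have [] := H r' h.
  by have [_ _ _ []] := H r' h.
have e1 : enorm (X t - X s - sg *: W s) <= G * sg ^+ 2.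
  by apply: taylor_rV => // r h; have [] := H r h.
have e2 : `|L * Delta - sg * enorm (W s)| <= G * sg ^+ 2.
  rewrite -lst; apply: (taylor_scalar (g := fun r => enorm (W r))) => // r h; first by have [] := H r h.
  by apply: le_trans (enorm_dist _ _) _; exact: Wlip.
have e3 : enorm (W t - W s - sg *: (- Gr s)) <= C * Wm * sg ^+ 2.
  apply: (taylor_rV (g := fun r => - Gr r)); first by rewrite mulr_ge0.
    by move=> r h; have [] := H r h.
  move=> r h; rewrite -opprD enormN -mulrA; apply: le_trans (HC r h) _.
  by rewrite ler_wpM2l// Xlip.
(* The lower speed bound [c] compares time with arclength, so that every error of order [sg ^+ 2] is
   one of order [Delta ^+ 2]. *)
have sgD : `|sg| <= L / c * `|Delta|.
  have : c * `|sg| <= `|L * Delta|.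
    rewrite -lst; have [q sq ->] : exists2 q, between s t q & l t - l s = enorm (W q) * (t - s).
      have [st|/ltW ts] := leP s t.
        have [|q [sq qt] E] := MVT_closed (f := l) (df := fun r => enorm (W r)) st.
          by move=> r h1 h2; have [] := H r (or_introl (conj h1 h2)).
        by exists q => //; left.
      have [|q [sq qt] E] := MVT_closed (f := l) (df := fun r => enorm (W r)) ts.
        by move=> r h1 h2; have [] := H r (or_intror (conj h1 h2)).
      exists q; first by right.
      by have -> : l t - l s = - (l s - l t) by [ring]; rewrite E; ring.
    by rewrite normrM ler_wpM2r// (le_trans _ (ler_norm _))//; have [_ _ _ []] := H q sq.
  by rewrite normrM (gtr0_norm L0) -ler_pdivlMl// => /le_trans; apply; rewrite mulrA [c^-1 * L]mulrC.
have sg2 : sg ^+ 2 <= (L / c) ^+ 2 * Delta ^+ 2.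
  rewrite -exprMn -[sg ^+ 2]real_normK ?num_real// -[leRHS]real_normK ?num_real//.
  by rewrite ler_pXn2r ?nnegrE// normrM [`|L / c|]gtr0_norm// divr_gt0.
have ws0 : 0 < enorm (W s) by apply: lt_le_trans c0 _; have [_ _ _ []] := H s ss.
have cws : c <= enorm (W s) by have [_ _ _ []] := H s ss.
set ep := L * Delta - sg * enorm (W s) in e2.
(* [ep] is the second order defect between the arclength increment and elapsed time multiplied by
   the initial speed. *)
have E : Delta * (L / enorm (W s)) = sg + ep / enorm (W s).
  by rewrite /ep; field; rewrite gt_eqF.
split.
  rewrite scalerA E.
  have -> : X t - X s - (sg + ep / enorm (W s)) *: W s =
      (X t - X s - sg *: W s) - (ep / enorm (W s)) *: W s by rewrite scalerDl opprD addrA.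
  apply: le_trans (enormD _ _) _; rewrite enormN enormZ normrM normfV (gtr0_norm ws0) divfK ?gt_eqF//.
  have : 2 * G * sg ^+ 2 <= 2 * G * ((L / c) ^+ 2 * Delta ^+ 2) by rewrite ler_wpM2l// mulr_ge0.
  by lra.
rewrite scalerA E.
have -> : W t - W s + (sg + ep / enorm (W s)) *: Gr s =
    (W t - W s - sg *: (- Gr s)) + (ep / enorm (W s)) *: Gr s.
  by rewrite scalerN opprK scalerDl addrA.
apply: le_trans (enormD _ _) _; rewrite enormZ normrM normfV (gtr0_norm ws0).
have h1 : `|ep| / enorm (W s) * enorm (Gr s) <= (G * sg ^+ 2) / c * G.
  apply: ler_pM; rewrite ?enorm_ge0 ?divr_ge0 ?enorm_ge0//; last exact: HG.
  apply: ler_pM; rewrite ?invr_ge0 ?enorm_ge0//.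
  by rewrite lef_pV2.
have h2 : (C * Wm + G ^+ 2 / c) * sg ^+ 2 <= (C * Wm + G ^+ 2 / c) * ((L / c) ^+ 2 * Delta ^+ 2).
  by rewrite ler_wpM2l//; apply: addr_ge0; [exact: mulr_ge0|apply: divr_ge0; [exact: sqr_ge0|exact: ltW]].
have -> : (C * Wm + G ^+ 2 / c) * (L / c) ^+ 2 * Delta ^+ 2 =
   (C * Wm + G ^+ 2 / c) * ((L / c) ^+ 2 * Delta ^+ 2) by rewrite mulrA.
apply: le_trans h2; rewrite mulrDl; apply: lerD => //.
by apply: le_trans h1 _; rewrite le_eqVlt; apply/orP; left; apply/eqP; ring.
Qed.

End Expansion.

(** * A competitor that waits at a maximum point *)

Section Competitor.
Context {R : realType} {d : nat}.
Notation mu := (@lebesgue_measure R).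
Variables (U : 'rV[R]_d -> R) (k : nat) (m : R).
Hypotheses (CU : is_Ck k.+2 U) (Um : forall x, U x <= m).

Lemma grad_at_maximum x : U x = m -> grad U x = 0.
Proof.
move=> Ux; have [C C0 /(_ x (lexx _))] := grad_le_gap (enorm x) CU Um.
rewrite Ux subrr mulr0 => g0; apply/eqP; rewrite -enorm_eq0 -sqrf_eq0.
by rewrite eq_le g0 sqr_ge0.
Qed.

Lemma gap_le_sqr x rho : U x = m -> 0 <= rho -> exists2 C : R, 0 < C &
  forall v, enorm v <= rho -> m - U (x + v) <= C * enorm v ^+ 2.
Proof.
move=> Ux rho0; have [C C0 HC] := taylor2 (enorm x + rho) CU; exists C => // v vr.
have h1 : enorm x <= enorm x + rho by rewrite lerDl.
have h2 : enorm (x + v) <= enorm x + rho by rewrite (le_trans (enormD _ _))// lerD2l.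
have := HC x (x + v) h1 h2; rewrite grad_at_maximum// dot0l subr0 Ux.
have -> : x + v - x = v by rewrite addrC addKr.
by rewrite distrC; apply: le_trans; exact: ler_norm.
Qed.

(** Its square is continuously differentiable, which makes the competitor a C^1 path despite its
    piecewise description. *)
Definition pos_part (t : R) := Num.max 0 t.

Lemma pos_part_ge0 t : 0 <= pos_part t.
Proof. by rewrite /pos_part le_max lexx. Qed.

Lemma is_derive_pos_part_sqr (t : R) : is_derive t 1 (fun s => pos_part s ^+ 2) (2 * pos_part t).
Proof.
apply/is_derive_eps => e e0; exists e => // h he.
apply: (@le_trans _ _ (h ^+ 2)); last first.
  by rewrite -real_normK ?num_real// expr2 ler_wpM2r// ltW.
rewrite /pos_part /GRing.scale/=; case: (leP 0 (t + h)) => h1; case: (leP 0 t) => h2; rewrite ler_norml.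
- by have := sqr_ge0 h => ?; apply/andP; split; lra.
- have : 0 <= (t + h) * - t by rewrite mulr_ge0 ?oppr_ge0// ltW.
  have : 0 <= h * - t by rewrite mulr_ge0//; lra.
  by have := sqr_ge0 h; have := sqr_ge0 (t + h) => ? ? ? ?; apply/andP; split; lra.
- have : 0 <= t * - (t + h) by rewrite mulr_ge0// oppr_ge0 ltW.
  by have := sqr_ge0 (t + h); have := sqr_ge0 h; have := sqr_ge0 t => ? ? ? ?; apply/andP; split; lra.
- by have := sqr_ge0 h => ?; apply/andP; split; lra.
Qed.

Lemma pos_part_continuous : continuous pos_part.
Proof.
move=> t; apply/cvgrPdist_lt => e e0; near=> s.
have : `|t - s| < e by near: s; exact: cvgr_dist_lt.
by rewrite /pos_part !ltr_norml => /andP[? ?]; case: (leP 0 t) => ?; case: (leP 0 s) => ?;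
  apply/andP; split; lra.
Unshelve. all: by end_near. Qed.

Lemma FTC_C1 (F g : R -> R) (T : R) : 0 <= T -> continuous g ->
  (forall t, 0 <= t -> t <= T -> is_derive t 1 F (g t)) ->
  \int[mu]_(t in `[0, T]) g t = F T - F 0.
Proof.
move=> T0 cg dF; have [B B0 HB] := continuous_bounded_on T0 cg.
apply: scalar_ac_FTC => //; last by apply: aeW => t t0 tT; apply: dF; exact: ltW.
apply: (lipschitz_scalar_ac (d := d) (ltW B0)) => s r s0 sr rt.
have [|c [sc cr] ->] := MVT_closed (f := F) (df := g) sr.
  by move=> c sc cr; apply: dF; lra.
by rewrite normrM [`|r - s|]ger0_norm ?subr_ge0// ler_wpM2r ?subr_ge0// HB//; lra.
Qed.

(** The point is that [K] does not depend on [T]: the two unit-time moves exceed the action of pure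
    waiting, [- m * T], by a fixed amount. *)
Lemma competitor xc xs xf : U xc = m -> exists K : R, forall T, 2 <= T ->
  exists2 chi, admissible T xs xf chi & (OM_action U T chi <= (K - m * T)%:E)%E.
Proof.
move=> Uc; set u := xs - xc; set v := xf - xc; pose D := enorm u + enorm v.
have D0 : 0 <= D by rewrite addr_ge0 ?enorm_ge0.
have [C C0 HC] := gap_le_sqr Uc D0.
(* With q = al + be, of integral 1, the kinetic term is at most 2 q D^2 and the gap of [U] at most C
   q D^2. *)
pose K := (2 + C) * D ^+ 2; have K0 : 0 <= K by rewrite mulr_ge0 ?sqr_ge0// addr_ge0// ltW.
exists K => T T2; have T0 : 0 < T by lra.
pose al t := pos_part (1 - t); pose be t := pos_part (t - (T - 1)).
have cal : continuous al.
  have h : continuous (fun t : R => 1 - t) by move=> t; apply: cvgB; [exact: cvg_cst|exact: cvg_id].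
  by move=> t; exact: (continuous_comp (h t) (@pos_part_continuous (1 - t))).
have cbe : continuous be.
  have h : continuous (fun t : R => t - (T - 1)) by move=> t; apply: cvgB; [exact: cvg_id|exact: cvg_cst].
  by move=> t; exact: (continuous_comp (h t) (@pos_part_continuous (t - (T - 1)))).
have dal (t : R) : is_derive t 1 (fun s => al s ^+ 2) (- (2 * al t)).
  have h : is_derive t 1 (fun s : R => 1 - s) (- 1).
    by rewrite -[X in is_derive _ _ _ X]add0r; apply: is_deriveB.
  have := @is_derive1_comp R (fun s => pos_part s ^+ 2) (fun s => 1 - s) t _ _ (is_derive_pos_part_sqr (1 - t)) h.
  by rewrite mulrN1.
have dbe (t : R) : is_derive t 1 (fun s => be s ^+ 2) (2 * be t).
  have h : is_derive t 1 (fun s : R => s - (T - 1)) 1.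
    by rewrite -[X in is_derive _ _ _ X]subr0; apply: is_deriveB.
  have := @is_derive1_comp R (fun s => pos_part s ^+ 2) (fun s => s - (T - 1)) t _ _ (is_derive_pos_part_sqr _) h.
  by rewrite mulr1.
(* chi runs from xs to xc during [0, 1], waits at xc, and runs to xf during [T - 1, T] *)
pose chi t := xc + (al t ^+ 2 *: u + be t ^+ 2 *: v).
pose W t := - (2 * al t) *: u + (2 * be t) *: v.
have dchi (t : R) : 0 <= t -> t <= T -> is_derive t 1 chi (W t).
  move=> _ _; apply/is_derive_rV => i.
  have E : (fun s => chi s ord0 i) = (fun s => xc ord0 i + (u ord0 i * al s ^+ 2 + v ord0 i * be s ^+ 2)).
    by apply/funext => s; rewrite /chi !mxE; ring.
  rewrite E; have -> : W t ord0 i = 0 + (u ord0 i * - (2 * al t) + v ord0 i * (2 * be t)).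
    by rewrite /W !mxE; ring.
  by apply: is_deriveD.
have cW : continuous W.
  move=> t; apply: cvgD; apply: cvgZ; try exact: cvg_cst.
    by apply: cvgN; apply: cvgM; [exact: cvg_cst|exact: cal].
  by apply: cvgM; [exact: cvg_cst|exact: cbe].
have bnd t : 0 <= t -> t <= T -> [/\ 0 <= al t, 0 <= be t, al t + be t <= 1 & al t ^+ 2 <= al t /\ be t ^+ 2 <= be t].
  move=> t0 tT; have a0 : 0 <= al t by exact: pos_part_ge0.
  have b0 : 0 <= be t by exact: pos_part_ge0.
  have ab1 : al t + be t <= 1.
    by rewrite /al /be /pos_part; case: (leP 0 (1 - t)) => ?; case: (leP 0 (t - (T - 1))) => ?; lra.
  split=> //; split.
    by rewrite expr2 ler_piMr//; lra.
  by rewrite expr2 ler_piMr//; lra.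
have val1 : al 0 = 1 by rewrite /al /pos_part subr0 (max_idPr _).
have val2 : be 0 = 0 by rewrite /be /pos_part (max_idPl _)//; lra.
have val3 : al T = 0 by rewrite /al /pos_part (max_idPl _)//; lra.
have val4 : be T = 1.
  by rewrite /be /pos_part (_ : T - (T - 1) = 1); [rewrite (max_idPr _)|ring].
exists chi.
  split; first exact: (C1_abs_cont T0 cW dchi).
    by rewrite /chi val1 val2 expr1n expr0n/= scale1r scale0r addr0 /u addrC subrK.
  by rewrite /chi val3 val4 expr1n expr0n/= scale1r scale0r add0r /v addrC subrK.
rewrite (OM_action_C1 CU T0 cW dchi) lee_fin.
pose F t := - m * t + K * (2^-1 * (be t ^+ 2 - al t ^+ 2)).
have dF t : 0 <= t -> t <= T -> is_derive t 1 F (- m * 1 + K * (2^-1 * (2 * be t - - (2 * al t)))).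
  by move=> _ _; apply: is_deriveD.
pose g t := - m * 1 + K * (2^-1 * (2 * be t - - (2 * al t))).
have cg : continuous g.
  move=> t; apply: cvgD; first exact: cvg_cst.
  apply: cvgM; first exact: cvg_cst.
  apply: cvgM; first exact: cvg_cst.
  apply: cvgB; first by apply: cvgM; [exact: cvg_cst|exact: cbe].
  by apply: cvgN; apply: cvgM; [exact: cvg_cst|exact: cal].
have -> : K - m * T = F T - F 0 by rewrite /F val1 val2 val3 val4; field.
rewrite -(FTC_C1 (ltW T0) cg dF); apply: le_Rint.
- apply: itgB; first by apply/itgZ/itg_cont/dot_continuous.
  apply: itg_cont => t; apply: (@continuous_comp _ _ _ (fun t => chi (clamp 0 T t)) U).
    exact: (clamp_comp_continuous (ltW T0) dchi).
  exact: (is_Ck_cont CU).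
- exact: itg_cont.
move=> t t0 tT; rewrite clamp_id// /g; have [a0 b0 ab1 [a2 b2]] := bnd t t0 tT.
pose q := al t + be t; have q0 : 0 <= q by rewrite addr_ge0.
have eu := enorm_ge0 u; have ev := enorm_ge0 v.
have q2 : q ^+ 2 <= q by rewrite expr2 ler_piMr.
have dd (x y : R) : 0 <= x -> x <= al t -> 0 <= y -> y <= be t -> x * enorm u + y * enorm v <= q * D.
  move=> x0 xa y0 yb; have h1 : x * enorm u <= al t * enorm u by rewrite ler_wpM2r.
  have h2 : y * enorm v <= be t * enorm v by rewrite ler_wpM2r.
  have h3 : 0 <= al t * enorm v by rewrite mulr_ge0.
  have h4 : 0 <= be t * enorm u by rewrite mulr_ge0.
  by rewrite /q /D; lra.
have W1 : enorm (W t) <= 2 * (q * D).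
  apply: le_trans (enormD _ _) _; rewrite !enormZ normrN !ger0_norm ?mulr_ge0//.
  by have := dd _ _ a0 (lexx _) b0 (lexx _); lra.
have W2 : dot (W t) (W t) <= 4 * (q * D ^+ 2).
  rewrite -enorm_sqr; apply: (@le_trans _ _ ((2 * (q * D)) ^+ 2)).
    by rewrite ler_pXn2r ?nnegrE ?enorm_ge0 ?mulr_ge0.
  have : q ^+ 2 * D ^+ 2 <= q * D ^+ 2 by rewrite ler_wpM2r ?sqr_ge0.
  by lra.
set w := al t ^+ 2 *: u + be t ^+ 2 *: v.
have w1 : enorm w <= q * D.
  apply: le_trans (enormD _ _) _; rewrite !enormZ !ger0_norm ?sqr_ge0//.
  by apply: dd; rewrite ?sqr_ge0.
have w2 : enorm w ^+ 2 <= q * D ^+ 2.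
  apply: (@le_trans _ _ ((q * D) ^+ 2)).
    by rewrite ler_pXn2r ?nnegrE ?enorm_ge0 ?mulr_ge0.
  by rewrite exprMn ler_wpM2r ?sqr_ge0.
have wD : enorm w <= D by apply: le_trans w1 _; rewrite ler_piMl.
have := HC w wD; rewrite -/(chi t) => gap.
have : C * enorm w ^+ 2 <= C * (q * D ^+ 2) by rewrite ler_wpM2l// ltW.
rewrite /K -/q; have -> : 2^-1 * (2 * be t - - (2 * al t)) = q by rewrite /q; field.
by lra.
Qed.

End Competitor.

(** * What a single minimizer provides *)

Section MinimizerData.
Context {R : realType} {d : nat}.
Variables (U : 'rV[R]_d -> R) (k : nat).
Hypothesis CU : is_Ck k.+2 U.

(** The infimum in the reparametrization is attained with equality: an intermediate value shows that
    [l tau] is not too large, and points of the set close to [tau], together with the derivative of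
    [l] there, show that it is not too small. *)
Lemma reparam_time (T : R) (psi X W : R -> 'rV[R]_d) (l : R -> R) : 0 < T ->
  (forall t, 0 <= t -> t <= T -> psi t = X t) ->
  l 0 = 0 -> (forall t, 0 <= t -> t <= T -> is_derive t 1 l (enorm (W t))) ->
  (forall t, 0 <= t -> t <= T -> arclength t psi = l t) -> 0 < l T ->
  forall al, 0 <= al -> al <= 1 -> exists tau,
    [/\ 0 <= tau, tau <= T, l tau = al * l T & arclength_reparam T psi al = X tau].
Proof.
move=> T0 psiX l0 dl arcl lT0 al al0 al1.
have T0' := ltW T0; have ndl s t : 0 <= s -> s <= t -> t <= T -> l s <= l t.
  by move=> s0 st tT; exact: (length_nd dl).
pose S := [set t | t \in `[0, T] /\ al <= rel_arclength T psi t].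
have SE t : S t <-> [/\ 0 <= t, t <= T & al * l T <= l t].
  rewrite /S /= /rel_arclength in_itv/=; split.
    move=> [/andP[t0 tT]]; rewrite !arcl// => h; split=> //.
    by move: h; rewrite mulrC ler_pdivlMr.
  move=> [t0 tT h]; rewrite t0 tT !arcl//; split=> //.
  by rewrite mulrC ler_pdivlMr.
have lcont : {within `[0, T], continuous l}.
  apply: derivable_within_continuous => t; rewrite in_itv/= => /andP[t0 tT].
  by have [] := dl t t0 tT.
have lal : l 0 <= al * l T /\ al * l T <= l T.
  by rewrite l0 mulr_ge0 ?(ltW lT0)// ler_piMl// ltW.
have [t1 t1i lt1] : exists2 t1, t1 \in `[0, T] & l t1 = al * l T.
  apply: IVT => //; rewrite (min_idPl _) ?(max_idPr _) ?ndl//.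
  by case: lal => -> ->.
move: t1i; rewrite in_itv/= => /andP[t10 t1T].
have St1 : S t1 by apply/SE; split=> //; rewrite lt1.
have lbS : lbound S 0 by move=> t /SE[].
have infS : has_inf S by split; [exists t1|exists 0].
pose tau := inf S; exists tau.
have tau0 : 0 <= tau by apply: lb_le_inf => //; exists t1.
have taut1 : tau <= t1 by apply: ge_inf => //; exists 0.
have tauT : tau <= T by exact: le_trans t1T.
split=> //; last by rewrite /arclength_reparam -/S psiX.
apply/eqP; rewrite eq_le; apply/andP; split; first by rewrite -lt1 ndl.
rewrite leNgt; apply/negP => lt; set gap := al * l T - l tau.
have gap0 : 0 < gap by rewrite subr_gt0.
have [delta delta0 Hd] := (is_derive_eps l tau _).1 (dl tau tau0 tauT) 1 ltr01.
pose B := enorm (W tau) + 1; have B0 : 0 < B by rewrite ltr_wpDl ?enorm_ge0.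
have e0 : 0 < Num.min delta (gap / B) by rewrite lt_min delta0 divr_gt0.
have [s Ss sd] := inf_adherent e0 infS.
have /SE[s0 sT ls] := Ss.
have taus : tau <= s by apply: ge_inf => //; exists 0.
have h1 : 0 <= s - tau by rewrite subr_ge0.
have h2 : s - tau < delta /\ s - tau < gap / B.
  by move: sd; rewrite -/tau -ltrBlDl lt_min => /andP[].
have := Hd (s - tau); rewrite ger0_norm// => /(_ h2.1).
have -> : tau + (s - tau) = s by rewrite addrC subrK.
rewrite mul1r /GRing.scale/= => /(le_trans (ler_norm _)) h3.
have : (s - tau) * B < gap by rewrite -ltr_pdivlMr//; exact: h2.2.
by rewrite /B /gap; lra.
Qed.

(** One package, so that the choice axiom can produce all sequences of the limit argument. The
    strict lower bound on the action, due to positive length, excludes that [xs = xf] is a maximum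
    point; the bound by the energy is to be compared with [competitor]. *)
Lemma minimizer_data T xs xf psi (L := arclength T psi) : 0 < T -> is_minimizer U T xs xf psi ->
  0 < L -> exists (X W : R -> 'rV[R]_d) (l : R -> R) (E : R) (tau : R -> R),
  [/\ forall t, 0 <= t -> t <= T -> [/\ is_derive t 1 X (W t), is_derive t 1 W (- grad U (X t)),
        is_derive t 1 l (enorm (W t)) & enorm (W t) ^+ 2 = 2 * (E - U (X t))],
      l 0 = 0 /\ l T = L,
      X 0 = xs /\ X T = xf,
      forall al, 0 <= al -> al <= 1 -> [/\ 0 <= tau al, tau al <= T, l (tau al) = al * L &
        arclength_reparam T psi al = X (tau al)] &
      forall m, (forall x, U x <= m) ->
        [/\ (exists2 t, 0 <= t <= T & enorm (W t) * T = L),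
            ((- E * T)%:E <= OM_action U T psi)%E,
            ((- m * T)%:E < OM_action U T psi)%E &
            forall rho lam C xc, 0 < lam -> 0 < C ->
              (forall v, enorm v <= rho -> [/\ U (xc + v) <= m, m - U (xc + v) <= C * enorm v ^+ 2 &
                dot (grad U (xc + v)) v <= - (lam * enorm v ^+ 2)]) ->
              forall delta e0 s1 s2, 0 <= s1 -> s1 <= s2 -> s2 <= T -> 0 <= delta -> 0 <= e0 ->
              2 * (E - m) <= e0 ^+ 2 ->
              (forall t, s1 <= t -> t <= s2 -> enorm (X t - xc) <= rho) ->
              enorm (X s1 - xc) <= delta -> enorm (X s2 - xc) <= delta ->
              l s2 - l s1 <= 4 * (1 + 2 * C) ^+ 2 / Num.min lam 1 * (delta + e0)]].
Proof.
move=> T0 minp L0; have T0' := ltW T0.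
have [X [W [psiX dX dW]]] := minimizer_C2 CU T0 minp.
have [l [l0 dl arcl]] := arclength_antiderivative T0 dX dW psiX.
have lT : l T = L by rewrite /L arcl.
have [A [A0 dA AE]] := OM_action_antiderivative CU T0 dX dW psiX.
have en := energy_conserved CU dX dW.
have [[_ psi0 psiT] _] := minp.
have /choice[tau Htau] : forall al, exists tau, 0 <= al -> al <= 1 ->
    [/\ 0 <= tau, tau <= T, l tau = al * L & arclength_reparam T psi al = X tau].
  move=> al; have [a0|a0] := leP 0 al; last by exists 0.
  have [a1|a1] := leP al 1; last by exists 0.
  have lT0 : 0 < l T by rewrite lT.
  have [tau] := reparam_time T0 psiX l0 dl arcl lT0 a0 a1.
  by rewrite lT => H; exists tau.
exists X, W, l, (energy U X W), tau; split=> //.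
- by move=> t t0 tT; split; [exact: dX|exact: dW|exact: dl|exact: en].
- by rewrite -!psiX// ltW.
move=> m Um; split.
- have [c [c0 cT] E] := MVT_closed T0' dl; exists c; first by rewrite c0.
  by move: E; rewrite lT l0 !subr0 => ->.
- rewrite AE lee_fin.
  pose E := energy U X W.
  have h1 (t : R) : 0 <= t -> t <= T -> is_derive t 1 (fun t => - E * t) (- E * 1).
    by move=> _ _; apply: is_deriveZ.
  have h2 t : 0 <= t -> t <= T -> - E * 1 <= 2^-1 * enorm (W t) ^+ 2 - U (X t).
    by move=> t0 tT; have := en t t0 tT; have := sqr_ge0 (enorm (W t)); rewrite -/E; lra.
  by have := le_derive T0' h1 dA h2; rewrite A0 mulr0 !subr0.
- rewrite AE lte_fin ltNge; apply/negP => AT.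
  (* Young's inequality bounds the length by eta T plus a multiple of A T + m T; if the latter is
     nonpositive, letting eta tend to 0 kills the length. *)
  have : L <= 0.
    apply/ler_addgt0Pr => z z0; rewrite add0r.
    pose eta := z / T; have eta0 : 0 < eta by rewrite divr_gt0.
    have dB t : 0 <= t -> t <= T -> is_derive t 1 (fun t => eta * t + (2 * eta)^-1 * (A t + m * t))
        (eta * 1 + (2 * eta)^-1 * (2^-1 * enorm (W t) ^+ 2 - U (X t) + m * 1)).
      move=> t0 tT; have h := dA t t0 tT.
      by apply: is_deriveD.
    have H : L <= eta * T + (2 * eta)^-1 * (A T + m * T).
      suff h t : 0 <= t -> t <= T ->
          enorm (W t) <= eta * 1 + (2 * eta)^-1 * (2^-1 * enorm (W t) ^+ 2 - U (X t) + m * 1).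
        have := le_derive T0' dl dB h.
        by rewrite l0 lT A0 !mulr0 !addr0 mulr0 ?addr0 !subr0.
      move=> t0 tT.
      have h1 : 0 <= (2 * eta)^-1 * (m - U (X t)) by rewrite mulr_ge0 ?invr_ge0 ?subr_ge0// mulr_ge0// ltW.
      have h2 : 0 <= (enorm (W t) - 2 * eta) ^+ 2 / (4 * eta).
        by rewrite divr_ge0 ?sqr_ge0// mulr_ge0// ltW.
      have E2 : (enorm (W t) - 2 * eta) ^+ 2 / (4 * eta) =
          (2 * eta)^-1 * (2^-1 * enorm (W t) ^+ 2) - enorm (W t) + eta by field; rewrite gt_eqF.
      by lra.
    apply: le_trans H _; have -> : eta * T = z by rewrite /eta divfK// gt_eqF.
    have h1 : 0 <= (2 * eta)^-1 by rewrite invr_ge0 mulr_ge0// ltW.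
    have h2 : 0 <= - (A T + m * T) by lra.
    by have := mulr_ge0 h1 h2; lra.
  by rewrite leNgt L0.
- move=> rho lam C xc lam0 C0 HU; exact: (length_near_maximum CU T0 dX dW dl lam0 C0 HU).
Qed.

End MinimizerData.

(** * Passage to the limit *)

Section LimitBounds.
Context {R : realType} {d : nat}.

Lemma lim_enorm_le (F : nat -> 'rV[R]_d) x b : F @ \oo --> x ->
  (\forall j \near \oo, enorm (F j) <= b) -> enorm x <= b.
Proof.
move=> /cvg_norm_enorm h H; have <- := cvg_lim (@Rhausdorff R) h.
by apply: limr_le => //; exact: cvgP h.
Qed.

Lemma is_derive_quadratic (f : R -> 'rV[R]_d) (t r K : R) v : 0 < r -> 0 <= K ->
  (forall s, `|s - t| <= r -> enorm (f s - f t - (s - t) *: v) <= K * (s - t) ^+ 2) ->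
  is_derive t 1 f v.
Proof.
move=> r0 K0 H; apply/is_derive_eps => e e0; have K1 : 0 < K + 1 by lra.
exists (Num.min r (e / (K + 1))); first by rewrite lt_min r0 divr_gt0.
move=> h; rewrite lt_min => /andP[hr he]; apply: le_trans (mx_norm_le_enorm _) _.
have E : t + h - t = h by rewrite addrC addKr.
have := H (t + h); rewrite E => /(_ (ltW hr)) /le_trans; apply.
rewrite -real_normK ?num_real// expr2 mulrA ler_wpM2r//.
move: he; rewrite ltr_pdivlMr// => he; have := normr_ge0 h; lra.
Qed.

Lemma between_norm_le (a b x r : R) : between a b x -> `|b - a| <= r -> `|x - a| <= r.
Proof. by rewrite !ler_norml => -[[? ?]|[? ?]] /andP[? ?]; apply/andP; split; lra. Qed.

Lemma itv_norm_le (a b x c r : R) : a <= x -> x <= b -> `|a - c| <= r -> `|b - c| <= r ->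
  `|x - c| <= r.
Proof. by rewrite !ler_norml => ? ? /andP[? ?] /andP[? ?]; apply/andP; split; lra. Qed.

End LimitBounds.

Section Limit.
Context {R : realType} {d : nat}.
Variables (U : 'rV[R]_d -> R) (k : nat) (m : R).
Hypotheses (CU : is_Ck k.+2 U) (Um : forall x, U x <= m).
Variables (xs xf : 'rV[R]_d) (M : R) (T L E : nat -> R) (X W : nat -> R -> 'rV[R]_d).
(* [X j] is a minimizer with velocity [W j], energy [E j] and arclength function [l j]; [tau j] is
   the time change of its reparametrization, so that [X j (tau j al)] is phi_j(al). *)
Variables (l tau : nat -> R -> R) (phi : R -> 'rV[R]_d).
Hypothesis nonconstant : ~ (xs = xf /\ U xs = m).
Hypotheses (T0 : forall j, 0 < T j) (Too : forall B, \forall j \near \oo, B <= T j).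
Hypotheses (L0 : forall j, 0 < L j) (LM : forall j, L j <= M).
Hypothesis ode : forall j t, 0 <= t -> t <= T j ->
  [/\ is_derive t 1 (X j) (W j t), is_derive t 1 (W j) (- grad U (X j t)),
      is_derive t 1 (l j) (enorm (W j t)) & enorm (W j t) ^+ 2 = 2 * (E j - U (X j t))].
Hypotheses (l0 : forall j, l j 0 = 0) (lT : forall j, l j (T j) = L j).
Hypotheses (X0 : forall j, X j 0 = xs) (XT : forall j, X j (T j) = xf).
Hypothesis tauP : forall j al, 0 <= al -> al <= 1 ->
  [/\ 0 <= tau j al, tau j al <= T j & l j (tau j al) = al * L j].
Hypothesis mean_speed : forall j, exists2 t, 0 <= t <= T j & enorm (W j t) * T j = L j.
Variable K0 : R.
Hypothesis E_ge : \forall j \near \oo, m - K0 / T j <= E j.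
Hypothesis length_near : forall j rho lam C xc, 0 < lam -> 0 < C ->
  (forall v, enorm v <= rho -> [/\ U (xc + v) <= m, m - U (xc + v) <= C * enorm v ^+ 2 &
    dot (grad U (xc + v)) v <= - (lam * enorm v ^+ 2)]) ->
  forall delta e0 s1 s2, 0 <= s1 -> s1 <= s2 -> s2 <= T j -> 0 <= delta -> 0 <= e0 ->
  2 * (E j - m) <= e0 ^+ 2 ->
  (forall t, s1 <= t -> t <= s2 -> enorm (X j t - xc) <= rho) ->
  enorm (X j s1 - xc) <= delta -> enorm (X j s2 - xc) <= delta ->
  l j s2 - l j s1 <= 4 * (1 + 2 * C) ^+ 2 / Num.min lam 1 * (delta + e0).
Hypothesis phi_lim : forall e, 0 < e -> \forall j \near \oo, forall al, 0 <= al -> al <= 1 ->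
  enorm (X j (tau j al) - phi al) < e.

Local Notation f j al := (X j (tau j al)).

Let M0 : 0 < M. Proof. by apply: lt_le_trans (L0 0%N) _; exact: LM. Qed.

Lemma l_nd j s t : 0 <= s -> s <= t -> t <= T j -> l j s <= l j t.
Proof.
by move=> s0 st tT; apply: (@length_nd _ _ (T j) (W j)) => // r r0 rT; have [] := ode r0 rT.
Qed.

Lemma chord_le j s t : 0 <= s -> s <= T j -> 0 <= t -> t <= T j ->
  enorm (X j t - X j s) <= `|l j t - l j s|.
Proof.
move=> s0 sT t0 tT.
have H a b : 0 <= a -> a <= b -> b <= T j -> enorm (X j b - X j a) <= l j b - l j a.
  by move=> a0 ab bT; apply: (@chord_le_length _ _ (T j) (X j) (W j)) => // r r0 rT; have [] := ode r0 rT.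
have [st|/ltW ts] := leP s t; first by apply: le_trans (H _ _ s0 st tT) (ler_norm _).
by rewrite enormB distrC; apply: le_trans (H _ _ t0 ts sT) (ler_norm _).
Qed.

Lemma reparam_lipschitz j al be : 0 <= al -> al <= 1 -> 0 <= be -> be <= 1 ->
  enorm (f j be - f j al) <= L j * `|be - al|.
Proof.
move=> a0 a1 b0 b1; have [s0 sT ls] := tauP j a0 a1; have [t0 tT lt] := tauP j b0 b1.
apply: le_trans (chord_le s0 sT t0 tT) _.
by rewrite ls lt -mulrBl normrM (gtr0_norm (L0 j)) mulrC.
Qed.

(** [tau j] inverts the arclength only up to plateaus, on which the curve stands still by
    [chord_le]. *)
Lemma reparam_param j t : 0 <= t -> t <= T j ->
  [/\ 0 <= l j t / L j, l j t / L j <= 1 & X j t = f j (l j t / L j)].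
Proof.
move=> t0 tT.
have h0 : 0 <= l j t / L j by rewrite divr_ge0 ?(ltW (L0 j))// -(l0 j) l_nd.
have h1 : l j t / L j <= 1 by rewrite ler_pdivrMr// mul1r -(lT j) l_nd.
split=> //; have [s0 sT ls] := tauP j h0 h1.
apply/eqP; rewrite -subr_eq0 -enorm_eq0 eq_le enorm_ge0 andbT.
apply: le_trans (chord_le s0 sT t0 tT) _.
by rewrite ls divfK ?gt_eqF// subrr normr0.
Qed.

Let rho := enorm xs + M + 1.

Lemma X_bounded j t : 0 <= t -> t <= T j -> enorm (X j t) <= enorm xs + M.
Proof.
move=> t0 tT; have -> : X j t = xs + (X j t - xs) by rewrite addrC subrK.
apply: le_trans (enormD _ _) _; rewrite lerD2l -(X0 j).
apply: le_trans (chord_le (lexx 0) (ltW (T0 j)) t0 tT) _.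
rewrite l0 subr0 ger0_norm; first by apply: le_trans (LM j); rewrite -(lT j) l_nd.
by rewrite -(l0 j) l_nd.
Qed.

Lemma X_rho j t : 0 <= t -> t <= T j -> enorm (X j t) <= rho.
Proof. by move=> t0 tT; rewrite (le_trans (X_bounded t0 tT))// lerDl. Qed.

Lemma f_rho j al : 0 <= al -> al <= 1 -> enorm (f j al) <= rho.
Proof. by move=> a0 a1; have [t0 tT _] := tauP j a0 a1; exact: X_rho. Qed.

Lemma phi_rho al : 0 <= al -> al <= 1 -> enorm (phi al) <= rho.
Proof.
move=> a0 a1; have [j Hj] := filter_ex (phi_lim ltr01).
have -> : phi al = f j al + (phi al - f j al) by rewrite addrC subrK.
apply: le_trans (enormD _ _) _; apply: lerD; last by rewrite enormB ltW// Hj.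
by have [t0 tT _] := tauP j a0 a1; exact: X_bounded.
Qed.

Lemma phi_lipschitz al be : 0 <= al -> al <= 1 -> 0 <= be -> be <= 1 ->
  enorm (phi be - phi al) <= M * `|be - al|.
Proof.
move=> a0 a1 b0 b1; apply/ler_addgt0Pr => e e0.
have e20 : 0 < e / 2 by rewrite divr_gt0.
have [j Hj] := filter_ex (phi_lim e20).
have -> : phi be - phi al = (phi be - f j be) + ((f j be - f j al) + (f j al - phi al)).
  by rewrite addrA !subrKA.
have h1 := ltW (Hj be b0 b1); have h2 := ltW (Hj al a0 a1).
have h3 := reparam_lipschitz j a0 a1 b0 b1.
have h4 : L j * `|be - al| <= M * `|be - al| by rewrite ler_wpM2r.
apply: le_trans (enormD _ _) _; rewrite enormB.
by have := enormD (f j be - f j al) (f j al - phi al); lra.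
Qed.

Lemma slow_near e : 0 < e -> \forall j \near \oo, `|E j - m| < e /\
  exists2 t, 0 <= t <= T j & enorm (W j t) ^+ 2 < e.
Proof.
move=> e0; near=> j; have T1 : 1 + `|K0| / e + M ^+ 2 / e <= T j by near: j; exact: Too.
have Ej : m - K0 / T j <= E j by near: j.
have h0 : 0 <= `|K0| / e by rewrite divr_ge0// ltW.
have h0' : 0 <= M ^+ 2 / e by rewrite divr_ge0 ?sqr_ge0// ltW.
have T1' : 1 <= T j by lra.
have hT : e + `|K0| + M ^+ 2 <= T j * e.
  have : (1 + `|K0| / e + M ^+ 2 / e) * e <= T j * e by rewrite ler_wpM2r// ltW.
  by rewrite !mulrDl mul1r !divfK ?gt_eqF.
have [t /andP[t0 tT] Wt] := mean_speed j; have [_ _ _ en] := ode t0 tT.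
have W2 : enorm (W j t) ^+ 2 < e.
  rewrite -(ltr_pM2r (T0 j)) mulrC; apply: (@le_lt_trans _ _ (M ^+ 2)); last first.
    by have := normr_ge0 K0; lra.
  apply: (@le_trans _ _ (L j ^+ 2)); last first.
    by rewrite ler_pXn2r ?nnegrE// ltW.
  rewrite -Wt exprMn mulrC ler_wpM2l ?sqr_ge0// expr2 ler_peMr// ltW//.
split; last by exists t; rewrite ?t0.
have KT : K0 / T j < e.
  rewrite ltr_pdivrMr//; have := ler_norm K0; have := sqr_ge0 M; lra.
have := Um (X j t); have := sqr_ge0 (enorm (W j t)).
by rewrite ltr_norml => ? ?; apply/andP; split; lra.
Unshelve. all: by end_near. Qed.

Lemma energy_near e : 0 < e -> \forall j \near \oo, `|E j - m| < e.
Proof. by move=> /slow_near; apply: filterS => j []. Qed.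

Lemma U_near e : 0 < e -> \forall j \near \oo, forall al, 0 <= al -> al <= 1 ->
  `|U (f j al) - U (phi al)| < e.
Proof.
have [C C0 HC] := C1_lipschitz rho CU; move=> e0.
have eC : 0 < e / C by rewrite divr_gt0.
near=> j; have Hj : forall al, 0 <= al -> al <= 1 -> enorm (f j al - phi al) < e / C.
  by near: j; exact: phi_lim.
move=> al a0 a1; apply: le_lt_trans (HC _ _ (phi_rho a0 a1) (f_rho j a0 a1)) _.
by rewrite mulrC -ltr_pdivlMr// Hj.
Unshelve. all: by end_near. Qed.

Lemma U_phi_lipschitz : exists2 C : R, 0 < C & forall al be,
  0 <= al -> al <= 1 -> 0 <= be -> be <= 1 -> `|U (phi be) - U (phi al)| <= C * `|be - al|.
Proof.
have [C C0 HC] := C1_lipschitz rho CU; exists (C * M); first by rewrite mulr_gt0.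
move=> al be a0 a1 b0 b1; apply: le_trans (HC _ _ (phi_rho a0 a1) (phi_rho b0 b1)) _.
by rewrite -mulrA ler_wpM2l ?(ltW C0)// phi_lipschitz.
Qed.

(** At the slow times of [slow_near] the potential is almost the energy, hence almost [m], and
    uniform convergence transfers this to [phi]. *)
Lemma limit_meets_maximum : exists2 al, 0 <= al /\ al <= 1 & U (phi al) = m.
Proof.
have [C C0 HC] := U_phi_lipschitz.
have cu : continuous (fun al => U (phi (clamp 0 1 al))).
  move=> al; have /cvgrPdist_lt cc := @clamp_continuous R 0 1 ler01 al.
  apply/cvgrPdist_lt => e e0; near=> be.
  have [[a0 a1] [b0 b1]] := (clamp_itv al (@ler01 R), clamp_itv be (@ler01 R)).
  apply: le_lt_trans (HC _ _ b0 b1 a0 a1) _; rewrite mulrC -ltr_pdivlMr//.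
  by near: be; apply: cc; exact: divr_gt0.
have [al] := EVT_max (@ler01 R) (continuous_subspaceT cu).
rewrite in_itv/= => /andP[a0 a1] Hal; exists al => //.
apply/eqP; rewrite eq_le Um/= leNgt; apply/negP => lt.
(* Energy error, kinetic energy and convergence error use less than three of the four quarters. *)
pose gap := (m - U (phi al)) / 4; have gap0 : 0 < gap by rewrite divr_gt0// subr_gt0.
have [j [[H1 [t /andP[t0 tT] Wt]] H2]] := filter_ex (filterI (slow_near gap0) (U_near gap0)).
have [b0 b1 XE] := reparam_param t0 tT; have [_ _ _ en] := ode t0 tT.
have := H2 _ b0 b1; rewrite -XE.
have := Hal (l j t / L j); rewrite in_itv/= b0 b1 !clamp_id// => /(_ isT).
by move: H1; rewrite /gap !ltr_norml => /andP[? ?] ? /andP[? ?]; rewrite /gap in Wt; lra.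
Unshelve. all: by end_near. Qed.

Lemma phi_endpoints : phi 0 = xs /\ phi 1 = xf.
Proof.
have H al x : 0 <= al -> al <= 1 -> (forall j, f j al = x) -> phi al = x.
  move=> a0 a1 fx; apply/eqP; rewrite -subr_eq0 -enorm_eq0 eq_le enorm_ge0 andbT.
  apply/ler_addgt0Pr => e e0; rewrite add0r.
  by have [j Hj] := filter_ex (phi_lim e0); rewrite -(fx j) enormB ltW// Hj.
have h01 := @ler01 R; have h00 := lexx (0 : R); have h11 := lexx (1 : R).
split; apply: H => // j; apply/eqP; rewrite -subr_eq0 -enorm_eq0 eq_le enorm_ge0 andbT.
  rewrite -(X0 j); have [t0 tT lt] := tauP j h00 h01.
  apply: le_trans (chord_le (lexx 0) (ltW (T0 j)) t0 tT) _.
  by rewrite lt l0 mul0r subrr normr0.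
rewrite -(XT j); have [t0 tT lt] := tauP j h01 h11.
apply: le_trans (chord_le (ltW (T0 j)) (lexx _) t0 tT) _.
by rewrite lt lT mul1r subrr normr0.
Qed.

(** [phi] takes two different values: otherwise [xs], [xf] and the maximum point that it meets would
    coincide, against [nonconstant]. Curves passing close to two distinct points cannot become
    short. *)
Lemma length_bounded_below : exists2 c : R, 0 < c & \forall j \near \oo, c <= L j.
Proof.
have [al0 [a00 a01] Ual] := limit_meets_maximum.
have [al [be [[a0 a1] [b0 b1] ne]]] : exists al be, [/\ 0 <= al /\ al <= 1, 0 <= be /\ be <= 1 & phi al != phi be].
  have [p0 p1] := phi_endpoints.
  have [e|ne] := eqVneq (phi al0) xs; last by exists al0, 0; rewrite p0 ne.
  exists 0, 1; rewrite p0 p1; split=> //; apply/eqP => exf; apply: nonconstant.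
  by rewrite -e in exf *.
pose D := enorm (phi be - phi al).
have D0 : 0 < D by rewrite enorm_gt0 subr_eq0 eq_sym.
exists (D / 2); first by rewrite divr_gt0.
have D4 : 0 < D / 4 by rewrite divr_gt0.
near=> j; have Hj : forall al, 0 <= al -> al <= 1 -> enorm (f j al - phi al) < D / 4.
  by near: j; exact: phi_lim.
have := reparam_lipschitz j a0 a1 b0 b1.
have : L j * `|be - al| <= L j.
  by rewrite ler_piMr ?(ltW (L0 j))// ler_norml; apply/andP; split; lra.
have := enormD (phi be - f j be) ((f j be - f j al) + (f j al - phi al)).
have := enormD (f j be - f j al) (f j al - phi al).
have -> : phi be - f j be + (f j be - f j al + (f j al - phi al)) = phi be - phi al.
  by rewrite addrA !subrKA.
rewrite (enormB (phi be) (f j be)) -/D; have := Hj _ a0 a1; have := Hj _ b0 b1; lra.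
Unshelve. all: by end_near. Qed.

(** By the quadratic gap, a contact close to [al0] has the same position [xc]. Between two
    parameters s <= t with this position the length is (t - s) L_j, at least c (t - s), while
    [length_near] makes it arbitrarily small. *)
Lemma maximum_isolated al0 : 0 <= al0 -> al0 <= 1 -> U (phi al0) = m ->
  ~~ eigenvalue (hess U (phi al0)) 0 ->
  exists2 r : R, 0 < r & forall al, 0 <= al -> al <= 1 -> `|al - al0| <= r ->
    U (phi al) = m -> al = al0.
Proof.
move=> a00 a01 Ual nd; set xc := phi al0.
have [r [lam [r0 lam0 Hr]]] := nondegenerate_maximum CU Um Ual nd.
have [C C0 HC] := gap_le_sqr CU Um Ual (ltW r0).
have [c c0 Lc] := length_bounded_below.
(* [phi] stays within [r / 2] of [xc]; the other half is left for the distance from the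
   approximating path to [phi]. *)
pose r1 := r / (2 * M); have r10 : 0 < r1 by rewrite divr_gt0// mulr_gt0.
exists r1 => // al a0 a1 alr Ua.
have ball be : 0 <= be -> be <= 1 -> `|be - al0| <= r1 -> enorm (phi be - xc) <= r / 2.
  move=> b0 b1 ber; apply: le_trans (phi_lipschitz a00 a01 b0 b1) _.
  have -> : r / 2 = M * r1 by rewrite /r1; field; rewrite gt_eqF.
  by rewrite ler_wpM2l// ltW.
have pal : phi al = xc.
  have h : enorm (phi al - xc) <= r by apply: le_trans (ball _ a0 a1 alr) _; lra.
  have [+ _] := Hr _ h; rewrite [xc + _]addrC subrK Ua subrr pmulr_rle0// => h2.
  by apply/eqP; rewrite -subr_eq0 -enorm_eq0 -sqrf_eq0 eq_le h2 sqr_ge0.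
have key s t : 0 <= s -> s <= t -> t <= 1 -> `|s - al0| <= r1 -> `|t - al0| <= r1 ->
    phi s = xc -> phi t = xc -> t <= s.
  move=> s0 st t1 sr tr ps pt; rewrite -subr_le0.
  have [s1 t0] : s <= 1 /\ 0 <= t by split; [exact: le_trans t1|exact: le_trans st].
  set Kc := 4 * (1 + 2 * C) ^+ 2 / Num.min lam 1.
  have Kc0 : 0 < Kc.
    have h : 0 < 1 + 2 * C by lra.
    by apply: divr_gt0; [apply: mulr_gt0; [lra|exact: exprn_gt0]|rewrite lt_min lam0 ltr01].
  rewrite -(pmulr_rle0 _ c0); apply/ler_addgt0Pr => z z0; rewrite add0r.
  (* Distances at both ends are below [e] and the energy excess below e^2 / 2, so [length_near]
     applies with both of its parameters equal to [e] and yields at most [z]. *)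
  pose e := Num.min (z / (2 * Kc)) (r / 2).
  have e0 : 0 < e by rewrite lt_min !divr_gt0// mulr_gt0.
  have e20 : 0 < e ^+ 2 / 2 by rewrite divr_gt0// exprn_gt0.
  have [j [[Hj [Ej _]] Lj]] := filter_ex (filterI (filterI (phi_lim e0) (slow_near e20)) Lc).
  have [ts0 tsT lts] := tauP j s0 s1; have [tt0 ttT ltt] := tauP j t0 t1.
  have [e1 e2] : e <= z / (2 * Kc) /\ e <= r / 2 by split; rewrite ge_min lexx ?orbT.
  have [tst|/ltW tts] := leP (tau j s) (tau j t); last first.
    have := l_nd tt0 tts tsT; rewrite lts ltt ler_pM2r// => ts.
    have -> : t = s by apply/eqP; rewrite eq_le st ts.
    by rewrite subrr mulr0 ltW.
  have := @length_near j r lam C xc lam0 C0 _ e e (tau j s) (tau j t) ts0 tst ttT (ltW e0) (ltW e0).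
  rewrite ltt lts -mulrBl -/Kc => H.
  have {}H : (t - s) * L j <= Kc * (e + e).
    apply: H.
    - by move=> v vr; have [h1 h2] := Hr v vr; split; [exact: Um|exact: HC|].
    - by move: Ej; rewrite ltr_norml => /andP[]; lra.
    - move=> q h1 h2; have q0 := le_trans ts0 h1; have qT := le_trans h2 ttT.
      have [b0 b1 ->] := reparam_param q0 qT; set be := l j q / L j.
      have sb : s <= be by rewrite ler_pdivlMr// -lts l_nd.
      have bt : be <= t by rewrite ler_pdivrMr// -ltt l_nd.
      have := itv_norm_le sb bt sr tr => /(ball _ b0 b1) h; have := Hj _ b0 b1.
      have := enormD (f j be - phi be) (phi be - xc); rewrite subrKA; lra.
    - by rewrite -ps ltW// Hj.
    - by rewrite -pt ltW// Hj.
  have : c * (t - s) <= (t - s) * L j by rewrite mulrC ler_wpM2l// subr_ge0.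
  have : Kc * (e + e) <= z.
    have -> : Kc * (e + e) = e * (2 * Kc) by ring.
    by rewrite -ler_pdivlMr// mulr_gt0.
  lra.
have a0r : `|al0 - al0| <= r1 by rewrite subrr normr0 ltW.
have h1 : al0 <= al -> al <= al0.
  by move=> le; apply: (key al0 al a00 le a1 a0r alr).
have h2 : al <= al0 -> al0 <= al.
  by move=> le; apply: (key al al0 a0 le a01 alr a0r).
have [h|h] : al <= al0 \/ al0 <= al by apply/orP; exact: le_total.
  by apply/eqP; rewrite eq_le h (h2 h).
by apply/eqP; rewrite eq_le h (h1 h).
Qed.

(** Energy conservation turns the gap [g] into a lower speed bound. The oscillation of U(phi), the
    convergence of U along the paths and that of the energies cost a quarter of [g] each; the last
    quarter, doubled, is the [g / 2] under the root. *)
Lemma speed_bounds al0 : 0 < al0 -> al0 < 1 -> U (phi al0) < m -> exists r c Wm,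
  [/\ 0 < r, 0 < c, 0 <= Wm & forall be, `|be - al0| <= r ->
      [/\ 0 < be, be < 1 & U (phi be) < m]] /\
  \forall j \near \oo, forall be, `|be - al0| <= r ->
      c <= enorm (W j (tau j be)) /\ enorm (W j (tau j be)) <= Wm.
Proof.
move=> a0 a1 Ua; have [C C0 HC] := U_phi_lipschitz.
have [B B0 HB] := enorm_ball_bounded rho (is_Ck_cont CU).
pose g := m - U (phi al0); have g0 : 0 < g by rewrite subr_gt0.
pose r := Num.min (Num.min (al0 / 2) ((1 - al0) / 2)) (g / (4 * C)).
have r0 : 0 < r by rewrite !lt_min !divr_gt0 ?subr_gt0// mulr_gt0.
have [[r1 r2] r3] : (r <= al0 / 2 /\ r <= (1 - al0) / 2) /\ r <= g / (4 * C).
  have : r <= Num.min (al0 / 2) ((1 - al0) / 2) by rewrite ge_min lexx.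
  by rewrite le_min => /andP[-> ->]; rewrite ge_min lexx orbT.
have r4 : C * r <= g / 4.
  have : r * (4 * C) <= g by rewrite -ler_pdivlMr// mulr_gt0.
  by lra.
have itv be : `|be - al0| <= r -> [/\ 0 < be, be < 1 & U (phi be) <= m - 3 / 4 * g].
  move=> ber; have h := ber; move: h; rewrite ler_norml => /andP[h1 h2].
  have [b0 b1] : 0 < be /\ be < 1 by split; lra.
  split=> //; have := HC _ _ (ltW a0) (ltW a1) (ltW b0) (ltW b1).
  have : C * `|be - al0| <= C * r by rewrite ler_wpM2l// ltW.
  by rewrite ler_norml => ? /andP[? ?]; rewrite /g in r4 *; lra.
pose Y := 2 * (`|m| + 1 + B).
have s1 : 0 < Num.sqrt (g / 2) by rewrite sqrtr_gt0 divr_gt0.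
exists r, (Num.sqrt (g / 2)), (Num.sqrt Y); split.
  split; [exact: r0|exact: s1|exact: sqrtr_ge0|].
  by move=> be /itv[b0 b1 h]; split=> //; lra.
have g4 : 0 < g / 4 by rewrite divr_gt0.
near=> j => be ber; have [b0 b1 Ub] := itv be ber.
have {b0 b1}[b0 b1] := (ltW b0, ltW b1).
have [t0 tT _] := tauP j b0 b1; have [_ _ _ en] := ode t0 tT.
have E1 : `|E j - m| < g / 4 by near: j; exact: energy_near.
have E2 : `|E j - m| < 1 by near: j; exact: energy_near.
have Un : `|U (f j be) - U (phi be)| < g / 4.
  have Hn : forall al, 0 <= al -> al <= 1 -> `|U (f j al) - U (phi al)| < g / 4.
    by near: j; exact: U_near.
  exact: Hn.
have ub := HB _ (f_rho j b0 b1); have mm := ler_norm m.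
move: E1 E2 Un ub; rewrite ler_norml !ltr_norml => /andP[? ?] /andP[? ?] /andP[? ?] /andP[? ?].
have W0 := enorm_ge0 (W j (tau j be)).
by rewrite -[enorm _]ger0_norm// -sqrtr_sqr en; split; apply: ler_wsqrtr; rewrite /Y; lra.
Unshelve. all: by end_near. Qed.

Local Notation w j al := ((L j / enorm (W j (tau j al))) *: W j (tau j al)).

(** [arclength_expansion] with constants independent of [j]: the speeds are controlled by
    [speed_bounds], the gradients on the ball of radius [rho], the lengths by [M]. *)
Lemma uniform_expansion al0 : 0 < al0 -> al0 < 1 -> U (phi al0) < m -> exists r K,
  [/\ 0 < r, 0 <= K & forall be, `|be - al0| <= r ->
      [/\ 0 < be, be < 1 & U (phi be) < m]] /\
  \forall j \near \oo, 0 < enorm (W j (tau j al0)) /\ forall be, `|be - al0| <= r ->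
      enorm (f j be - f j al0 - (be - al0) *: w j al0) <= K * (be - al0) ^+ 2 /\
      enorm (W j (tau j be) - W j (tau j al0) +
        (be - al0) *: ((L j / enorm (W j (tau j al0))) *: grad U (f j al0))) <= K * (be - al0) ^+ 2.
Proof.
move=> a0 a1 Ua; have [r [c [Wm [[r0 c0 Wm0 itv] Hj]]]] := speed_bounds a0 a1 Ua.
have [C C0 HC] := grad_lipschitz rho CU.
pose G := enorm (grad U 0) + C * rho.
have rho0 : 0 <= rho by apply: le_trans (phi_rho (ltW a0) (ltW a1)); exact: enorm_ge0.
have e00 : enorm (0 : 'rV[R]_d) <= rho by rewrite enorm0.
have HG x : enorm x <= rho -> enorm (grad U x) <= G.
  move=> xr; have -> : grad U x = grad U 0 + (grad U x - grad U 0) by rewrite addrC subrK.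
  apply: le_trans (enormD _ _) _; rewrite lerD2l; apply: le_trans (HC _ _ e00 xr) _.
  by rewrite subr0 ler_wpM2l// ltW.
have G0 : 0 <= G by apply: le_trans (HG _ e00); exact: enorm_ge0.
pose K1 := 2 * G * (M / c) ^+ 2; pose K2 := (C * Wm + G ^+ 2 / c) * (M / c) ^+ 2.
have K10 : 0 <= K1 by rewrite mulr_ge0 ?sqr_ge0// mulr_ge0.
have K2' : 0 <= C * Wm + G ^+ 2 / c.
  by apply: addr_ge0; [rewrite mulr_ge0// ltW|rewrite divr_ge0 ?sqr_ge0// ltW].
have K20 : 0 <= K2 by rewrite mulr_ge0 ?sqr_ge0.
exists r, (K1 + K2); split; first by split=> //; exact: addr_ge0.
near=> j; have Hjj : forall be, `|be - al0| <= r ->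
    c <= enorm (W j (tau j be)) /\ enorm (W j (tau j be)) <= Wm by near: j.
have a0r : `|al0 - al0| <= r by rewrite subrr normr0 ltW.
split; first by apply: lt_le_trans c0 _; have [] := Hjj _ a0r.
move=> be ber; have [b0 b1 _] := itv be ber.
have [s0 sT ls] := tauP j (ltW a0) (ltW a1); have [t0 tT lt] := tauP j (ltW b0) (ltW b1).
have sub q : between (tau j al0) (tau j be) q ->
    [/\ 0 <= q, q <= T j & c <= enorm (W j q) /\ enorm (W j q) <= Wm].
  move=> stq; have [q0 qT] : 0 <= q /\ q <= T j
    by case: stq => -[h1 h2]; [split; [exact: le_trans s0 h1|exact: le_trans h2 tT]|
      split; [exact: le_trans t0 h1|exact: le_trans h2 sT]].
  split=> //; have [g0 g1 XE] := reparam_param q0 qT; set ga := l j q / L j in g0 g1 XE.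
  have gar : `|ga - al0| <= r.
    have lq : l j q = ga * L j by rewrite divfK ?gt_eqF.
    apply: between_norm_le ber; case: stq => -[h1 h2].
      by left; split; rewrite -(ler_pM2r (L0 j)) -lq -?ls -?lt; exact: l_nd.
    by right; split; rewrite -(ler_pM2r (L0 j)) -lq -?ls -?lt; exact: l_nd.
  have [gT0 gTT _] := tauP j g0 g1.
  have [_ _ _ en1] := ode q0 qT; have [_ _ _ en2] := ode gT0 gTT.
  (* [q] need not be [tau j ga], but the positions agree, and the energy makes the speed a function
     of the position. *)
  have -> : enorm (W j q) = enorm (W j (tau j ga)).
    by rewrite -[LHS]ger0_norm ?enorm_ge0// -sqrtr_sqr en1 XE -en2 sqrtr_sqr ger0_norm ?enorm_ge0.
  exact: Hjj.
have lE : l j (tau j be) - l j (tau j al0) = L j * (be - al0) by rewrite lt ls; ring.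
have Mc : (L j / c) ^+ 2 <= (M / c) ^+ 2.
  rewrite ler_pXn2r ?nnegrE ?divr_ge0 ?(ltW (L0 j)) ?(ltW M0) ?(ltW c0)//.
  by rewrite ler_wpM2r ?invr_ge0 ?(ltW c0).
have [|||e1 e2] := @arclength_expansion _ _ (X j) (W j) (fun t => grad U (X j t)) (l j)
   (tau j al0) (tau j be) (L j) (be - al0) c Wm G C c0 Wm0 G0 (ltW C0) (L0 j) _ _ _ lE.
- by move=> q /sub[q0 qT H]; have [? ? ? _] := ode q0 qT.
- by move=> q /sub[q0 qT _]; apply: HG; exact: X_rho.
- by move=> q /sub[q0 qT _]; apply: HC; exact: X_rho.
have D0 := sqr_ge0 (be - al0).
split.
  apply: le_trans e1 _; rewrite ler_wpM2r//; apply: (@le_trans _ _ K1); last by rewrite lerDl.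
  by rewrite ler_wpM2l// mulr_ge0.
apply: le_trans e2 _; rewrite ler_wpM2r//; apply: (@le_trans _ _ K2); last by rewrite lerDr.
by rewrite ler_wpM2l.
Unshelve. all: by end_near. Qed.

(** Cauchy criterion: for a fixed step [h] the expansion recovers [h *: w j al0] from two positions
    up to [K * h ^+ 2], and the positions converge. *)
Lemma direction_converges al0 : 0 < al0 -> al0 < 1 -> U (phi al0) < m ->
  exists v : 'rV[R]_d, w j al0 @[j --> \oo] --> v.
Proof.
move=> a0 a1 Ua; have [r [K [[r0 K0' itv] Hexp]]] := uniform_expansion a0 a1 Ua.
suff : cvg (w j al0 @[j --> \oo]) by move=> /cvg_ex.
(* Two expansions cost K h^2 each and four positions h^2 each; the fifth unit makes the inequality
   strict. *)
apply/cauchy_cvgP/cauchy_exP => e e0; pose K5 := 2 * K + 5; have K50 : 0 < K5 by rewrite /K5; lra.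
pose h := Num.min r (e / K5).
have h0 : 0 < h by rewrite lt_min r0 divr_gt0.
have [hr he] : h <= r /\ h <= e / K5 by split; rewrite ge_min lexx ?orbT.
have h20 : 0 < h ^+ 2 by exact: exprn_gt0.
have ber : `|al0 + h - al0| <= r by rewrite addrC addKr gtr0_norm.
have [b0 b1 _] := itv _ ber.
pose P j := enorm (f j (al0 + h) - f j al0 - h *: w j al0) <= K * h ^+ 2 /\
  (enorm (f j (al0 + h) - phi (al0 + h)) < h ^+ 2 /\ enorm (f j al0 - phi al0) < h ^+ 2).
have HP : \forall j \near \oo, P j.
  apply: filterS2 Hexp (phi_lim h20) => j [_ /(_ _ ber)[h1 _]] h2.
  by split; [move: h1; rewrite [al0 + h - al0]addrC addKr|split; apply: h2; exact: ltW].
have [i Pi] := filter_ex HP; exists (w i al0).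
suff : \forall j \near \oo, ball (w i al0) e (w j al0) by [].
near=> j.
have Pj : P j by near: j.
rewrite -ball_normE /=; apply: le_lt_trans (mx_norm_le_enorm _) _.
rewrite -(ltr_pM2l h0) -{1}(gtr0_norm h0) -enormZ scalerBr.
case: Pi => i1 [i2 i3]; case: Pj => j1 [j2 j3].
set a := h *: w i al0 in i1 *; set b := h *: w j al0 in j1 *.
pose x1 := f j (al0 + h) - f j al0 - b; pose x2 := f i (al0 + h) - f i al0 - a.
pose y1 := f j (al0 + h) - phi (al0 + h); pose y2 := f i (al0 + h) - phi (al0 + h).
pose z1 := f j al0 - phi al0; pose z2 := f i al0 - phi al0.
have -> : a - b = (x1 - x2) + ((y2 - y1) + (z1 - z2)).
  by apply/rowP => q; rewrite /x1 /x2 /y1 /y2 /z1 /z2 !mxE; ring.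
have n1 := enormD (x1 - x2) ((y2 - y1) + (z1 - z2)).
have n2 := enormD (y2 - y1) (z1 - z2).
have n3 := enormD x1 (- x2); have n4 := enormD y2 (- y1); have n5 := enormD z1 (- z2).
rewrite !enormN in n3 n4 n5; rewrite -/x1 in j1; rewrite -/x2 in i1.
rewrite -/y2 in i2; rewrite -/z2 in i3; rewrite -/y1 in j2; rewrite -/z1 in j3.
have he' : h * (h * K5) <= h * e by rewrite ler_wpM2l ?(ltW h0)// -ler_pdivlMr.
have hK : h * (h * K5) = K5 * h ^+ 2 by ring.
move: he'; rewrite hK /K5; lra.
Unshelve. all: by end_near. Qed.

Hypothesis nondegenerate : forall x, U x = m -> ~~ eigenvalue (hess U x) 0.

Lemma interior_noncritical : exists al, [/\ 0 < al, al < 1 & U (phi al) < m].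
Proof.
have [al [a0 a1] Ual] := limit_meets_maximum.
have [r r0 Hr] := maximum_isolated a0 a1 Ual (nondegenerate Ual).
have H be : 0 < be -> be < 1 -> `|be - al| <= r -> be != al -> exists al, [/\ 0 < al, al < 1 & U (phi al) < m].
  move=> b0 b1 ber ne; exists be; split=> //; rewrite lt_neqAle Um andbT.
  by apply: contraNN ne => /eqP /(Hr _ (ltW b0) (ltW b1) ber) ->.
have [lt|ge] := boolP (al < 1).
  pose s := Num.min r ((1 - al) / 2); have s0 : 0 < s by rewrite lt_min r0 divr_gt0// subr_gt0.
  have [sr s1] : s <= r /\ s <= (1 - al) / 2 by split; rewrite ge_min lexx ?orbT.
  apply: (H (al + s)); [lra|lra| |lra].
  by rewrite addrC addKr gtr0_norm.
have {a1 ge}al1 : al = 1 by apply/eqP; rewrite eq_le a1 leNgt.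
pose s := Num.min r (1 / 2); have s0 : 0 < s by rewrite lt_min r0 divr_gt0.
have [sr s1] : s <= r /\ s <= 1 / 2 by split; rewrite ge_min lexx ?orbT.
apply: (H (1 - s)); rewrite ?al1; [lra|lra| |lra].
by rewrite [1 - s]addrC addrK normrN gtr0_norm.
Qed.

Lemma direction_length al0 : 0 < al0 -> al0 < 1 -> U (phi al0) < m ->
  \forall j \near \oo, enorm (w j al0) = L j.
Proof.
move=> a0 a1 Ua; have [r [K [[r0 _ _] H]]] := uniform_expansion a0 a1 Ua.
near=> j; have W0 : 0 < enorm (W j (tau j al0)) by near: j; apply: filterS H => j [].
by rewrite enormZ gtr0_norm ?divr_gt0// divfK ?gt_eqF.
Unshelve. all: by end_near. Qed.

(** At one parameter off the contact set the vectors [w j al] converge, and their norm is [L j]. The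
    resulting limit is common to all parameters, which gives [phi] a constant speed. *)
Lemma length_converges : exists2 Ls : R, 0 < Ls & L j @[j --> \oo] --> Ls.
Proof.
have [al [a0 a1 Ua]] := interior_noncritical.
have [v hv] := direction_converges a0 a1 Ua.
have LL : L j @[j --> \oo] --> enorm v.
  apply: cvg_trans (cvg_norm_enorm hv); apply: near_eq_cvg.
  exact: (direction_length a0 a1 Ua).
exists (enorm v) => //; have [c c0 Hc] := length_bounded_below.
apply: lt_le_trans c0 _; rewrite -(cvg_lim (@Rhausdorff R) LL).
by apply: limr_ge => //; exact: cvgP LL.
Qed.

Lemma reparam_cvg al : 0 <= al -> al <= 1 -> f j al @[j --> \oo] --> phi al.
Proof.
by move=> a0 a1; apply/cvg_enorm => e /phi_lim H; apply: filterS H => j; exact.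
Qed.

Lemma speed_cvg al : 0 <= al -> al <= 1 ->
  enorm (W j (tau j al)) @[j --> \oo] --> Num.sqrt (2 * m - 2 * U (phi al)).
Proof.
move=> a0 a1.
have E1 : E j @[j --> \oo] --> m.
  by apply/cvgrPdist_lt => e e0; near=> j; rewrite distrC; near: j; exact: energy_near.
have U1 : U (f j al) @[j --> \oo] --> U (phi al).
  apply/cvgrPdist_lt => e e0; near=> j; rewrite distrC.
  have H : forall al, 0 <= al -> al <= 1 -> `|U (f j al) - U (phi al)| < e.
    by near: j; exact: U_near.
  exact: H.
have -> : (fun j => enorm (W j (tau j al))) = (fun j => Num.sqrt (2 * E j - 2 * U (f j al))).
  apply/funext => j; have [t0 tT _] := tauP j a0 a1; have [_ _ _ en] := ode t0 tT.
  by rewrite -mulrBr -en sqrtr_sqr ger0_norm ?enorm_ge0.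
apply: continuous_cvg; first exact: sqrt_continuous.
by apply: cvgB; apply: cvgM => //; exact: cvg_cst.
Unshelve. all: by end_near. Qed.

Lemma limit_direction (Ls al0 : R) : 0 < Ls -> L j @[j --> \oo] --> Ls ->
  0 < al0 -> al0 < 1 -> U (phi al0) < m -> exists v,
  [/\ enorm v = Ls, is_derive al0 1 phi v &
    W j (tau j al0) @[j --> \oo] --> (Num.sqrt (2 * m - 2 * U (phi al0)) / Ls) *: v].
Proof.
move=> Ls0 LsL a0 a1 Ua; have [v hv] := direction_converges a0 a1 Ua; exists v.
have [r [K [[r0 K0' itv] H]]] := uniform_expansion a0 a1 Ua.
split.
- apply: (cvg_unique (@Rhausdorff R)) LsL.
  apply: cvg_trans (cvg_norm_enorm hv); apply: near_eq_cvg.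
  exact: (direction_length a0 a1 Ua).
- apply: (is_derive_quadratic r0 K0') => s sr; have [s0 s1 _] := itv s sr.
  apply: (@lim_enorm_le _ _ (fun j => f j s - f j al0 - (s - al0) *: w j al0)).
    apply: cvgB; first by apply: cvgB; apply: reparam_cvg; exact: ltW.
    by apply: cvgZ => //; exact: cvg_cst.
  by apply: filterS H => j [_ /(_ _ sr)[]].
- have hg := speed_cvg (ltW a0) (ltW a1).
  have : (enorm (W j (tau j al0)) / L j) *: w j al0 @[j --> \oo] -->
      (Num.sqrt (2 * m - 2 * U (phi al0)) / Ls) *: v.
    apply: cvgZ => //; apply: cvgM => //; apply: cvgV => //; exact: lt0r_neq0.
  apply: cvg_trans; apply: near_eq_cvg; apply: filterS H => j [W0 _] /=.
  rewrite scalerA mulrACA [_^-1 * _]mulrC -mulrACA divff ?gt_eqF// mul1r.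
  by rewrite divff ?scale1r// gt_eqF.
Qed.

(** The momenta [W j] converge to the scaled derivative of [phi] at every nearby parameter, so the
    second estimate of [uniform_expansion] becomes an expansion of that limit momentum and
    differentiates it directly. *)
Lemma limit_structure : exists2 Ls : R, 0 < Ls & forall al0, 0 < al0 -> al0 < 1 ->
  U (phi al0) < m -> [/\ enorm (derive1 phi al0) = Ls, is_derive al0 1 phi (derive1 phi al0) &
    is_derive al0 1 (fun al => (Num.sqrt (2 * m - 2 * U (phi al)) / Ls) *: derive1 phi al)
      (- ((Ls / Num.sqrt (2 * m - 2 * U (phi al0))) *: grad U (phi al0)))].
Proof.
have [Ls Ls0 LsL] := length_converges; exists Ls; first exact: Ls0.
move=> al0 a0 a1 Ua.
have dphi (al : R) v : is_derive al 1 phi v -> derive1 phi al = v.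
  by move=> h; rewrite derive1E derive_val.
have [v [vL dv Wv]] := limit_direction Ls0 LsL a0 a1 Ua.
have vE := dphi _ _ dv; rewrite vE; split=> //.
have [r [K [[r0 K0' itv] H]]] := uniform_expansion a0 a1 Ua.
set g := Num.sqrt _ in Wv *; have g0 : 0 < g by rewrite sqrtr_gt0; lra.
apply: (is_derive_quadratic r0 K0') => s sr; have [s0 s1 Us] := itv s sr.
have [v' [_ dv' Wv']] := limit_direction Ls0 LsL s0 s1 Us.
rewrite (dphi _ _ dv') vE -/g scalerN opprK.
apply: (@lim_enorm_le _ _ (fun j => W j (tau j s) - W j (tau j al0) +
    (s - al0) *: ((L j / enorm (W j (tau j al0))) *: grad U (f j al0)))).
  apply: cvgD; first exact: (cvgB Wv' Wv).
  apply: cvgZ; first exact: cvg_cst.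
  apply: cvgZ.
    by apply: cvgM => //; apply: cvgV; [exact: lt0r_neq0|exact: (speed_cvg (ltW a0) (ltW a1))].
  exact: (cvg_comp _ _ (reparam_cvg (ltW a0) (ltW a1)) (@grad_continuous _ _ _ _ CU (phi al0))).
by apply: filterS H => j [_ /(_ _ sr)[]].
Qed.

End Limit.

(** * Weak Euler-Lagrange equation *)

Section WeakEulerLagrange.
Context {R : realType} {d : nat}.
Notation mu := (@lebesgue_measure R).

(** The integrands contain [derive1 phi] and inverses, about which nothing is known at contacts and
    end points. Measurability is glued from continuity on the open set [O] and countability of the
    rest. *)
Lemma itg_off_countable (B O : set R) (h h' : R -> R) (a b K : R) : countable B -> open O ->
  (forall x, a <= x -> x <= b -> x = a \/ x = b \/ B x \/ O x) ->
  (B `|` O `<=` `[a, b]%classic) -> a <= b ->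
  (forall x, O x -> h x = h' x) -> (forall x, O x -> {for x, continuous h'}) ->
  (forall x, a <= x -> x <= b -> `|h x| <= K) -> itg a b h.
Proof.
move=> cB oO cover sub ab hh ch hK.
have mB : measurable B by exact: countable_measurable.
have mO : measurable O by exact: open_measurable.
have E : `[a, b]%classic = (O `|` B) `|` ([set a] `|` [set b]).
  apply/seteqP; split => x /=; rewrite in_itv/=.
    by move=> /andP[xa xb]; have [->|[->|[]]] := cover x xa xb; tauto.
  move=> [[xO|xB]|[->|->]]; rewrite ?lexx ?ab//.
    by have := sub x (or_intror xO); rewrite /= in_itv/=.
  by have := sub x (or_introl xB); rewrite /= in_itv/=.
apply: measurable_bounded_integrable.
- exact: mitv.
- by rewrite [X in (X < _)%E]lebesgue_measure_itv/=; case: ifP => _; rewrite ?ltry// -EFinB ltry.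
- rewrite E; apply/measurable_funU; [exact: measurableU|exact: measurableU|split].
    apply/measurable_funU => //; split.
      apply: (@eq_measurable_fun _ _ _ _ _ h'); first by move=> x; rewrite inE => /hh.
      by apply: open_continuous_measurable_fun => // x; rewrite inE; exact: ch.
    move=> _ Y _; apply: countable_measurable => //.
    by apply: sub_countable cB; apply: subset_card_le; exact: subIsetl.
  by apply/measurable_funU => //; split; exact: measurable_fun_set1.
- exists K; split; first exact: num_real.
  move=> y Ky x /=; rewrite in_itv/= => /andP[xa xb].
  exact: le_trans (hK x xa xb) (ltW Ky).
Qed.

Variables (U : 'rV[R]_d -> R) (k : nat) (m : R) (phi : R -> 'rV[R]_d) (Ls M : R).
Hypotheses (CU : is_Ck k.+2 U) (Um : forall x, U x <= m) (Ls0 : 0 < Ls) (M0 : 0 < M).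
Hypothesis phi_lip : forall al be, 0 <= al -> al <= 1 -> 0 <= be -> be <= 1 ->
  enorm (phi be - phi al) <= M * `|be - al|.
Hypothesis isolated_maximum : forall al0, 0 <= al0 -> al0 <= 1 -> U (phi al0) = m ->
  exists2 r : R, 0 < r & forall al, 0 <= al -> al <= 1 -> `|al - al0| <= r ->
    U (phi al) = m -> al = al0.

Let g al := Num.sqrt (2 * m - 2 * U (phi al)).
Let p al := (g al / Ls) *: derive1 phi al.
Let q al := - ((Ls / g al) *: grad U (phi al)).

Hypothesis structure : forall al, 0 < al -> al < 1 -> U (phi al) < m ->
  [/\ enorm (derive1 phi al) = Ls, is_derive al 1 phi (derive1 phi al) & is_derive al 1 p (q al)].

Let rho := enorm (phi 0) + M.

Lemma phi_in_ball al : 0 <= al -> al <= 1 -> enorm (phi al) <= rho.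
Proof.
move=> a0 a1; have -> : phi al = phi 0 + (phi al - phi 0) by rewrite addrC subrK.
apply: le_trans (enormD _ _) _; rewrite lerD2l.
apply: le_trans (phi_lip (lexx 0) (@ler01 R) a0 a1) _.
by rewrite subr0 ger0_norm// ler_piMr// ltW.
Qed.

Lemma g_sqr al : g al ^+ 2 = 2 * (m - U (phi al)).
Proof. by rewrite sqr_sqrtr; have := Um (phi al); lra. Qed.

Lemma g_ge0 al : 0 <= g al. Proof. exact: sqrtr_ge0. Qed.

Lemma g_eq0 al : U (phi al) = m -> g al = 0.
Proof. by move=> Ua; apply/eqP; rewrite -sqrf_eq0 g_sqr Ua subrr mulr0. Qed.

Lemma g_gt0 al : U (phi al) < m -> 0 < g al.
Proof. by move=> Ua; rewrite sqrtr_gt0; lra. Qed.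

Lemma sub_maximum al : (U (phi al) = m) \/ (U (phi al) < m).
Proof. by have := Um (phi al); rewrite le_eqVlt => /orP[/eqP|]; tauto. Qed.

Lemma p_norm al : 0 < al -> al < 1 -> enorm (p al) = g al.
Proof.
move=> a0 a1; have [Ua|Ua] := sub_maximum al; first by rewrite /p g_eq0// mul0r scale0r enorm0.
have [vL _ _] := structure a0 a1 Ua.
by rewrite /p enormZ vL ger0_norm ?divr_ge0 ?g_ge0 ?(ltW Ls0)// divfK ?gt_eqF.
Qed.

Lemma g_bounded : exists2 P : R, 0 < P & forall al, 0 <= al -> al <= 1 -> g al <= P.
Proof.
have [B B0 HB] := enorm_ball_bounded rho (is_Ck_cont CU).
pose P := 2 * (`|m| + B) + 1; have m0 := normr_ge0 m.
have P1 : 1 <= P by rewrite /P; lra.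
exists P; first lra.
move=> al a0 a1; rewrite -(ler_pXn2r (n := 2)) ?nnegrE ?g_ge0//; last lra.
rewrite g_sqr; apply: (@le_trans _ _ P); last by rewrite expr2 ler_peMr//; lra.
have := HB _ (phi_in_ball a0 a1); have := ler_norm m; rewrite ler_norml => ? /andP[? ?].
by rewrite /P; lra.
Qed.

(** At a contact the gradient vanishes, so the gap is quadratic in the distance by Taylor's formula
    and its square root [g] is linear. *)
Lemma g_le_dist : exists2 K : R, 0 < K & forall al be, 0 <= al -> al <= 1 -> 0 <= be -> be <= 1 ->
  U (phi be) = m -> g al <= K * `|al - be|.
Proof.
have [C C0 HC] := taylor2 rho CU; pose D := 2 * C + 1; have D1 : 1 <= D by rewrite /D; lra.
exists (D * M); first by rewrite mulr_gt0//; lra.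
move=> al be a0 a1 b0 b1 Ub.
have Dx0 : 0 <= M * `|al - be| by rewrite mulr_ge0// ltW.
have D0 : 0 <= D by lra.
rewrite -mulrA -(ler_pXn2r (n := 2)) ?nnegrE ?g_ge0 ?mulr_ge0 ?(ltW M0)//.
have := HC _ _ (phi_in_ball b0 b1) (phi_in_ball a0 a1).
rewrite (grad_at_maximum CU Um Ub) dot0l subr0 Ub distrC ger0_norm ?subr_ge0 ?Um// => h.
rewrite g_sqr exprMn; set z := enorm _ in h.
have z2 : z ^+ 2 <= (M * `|al - be|) ^+ 2.
  by rewrite ler_pXn2r ?nnegrE ?enorm_ge0// phi_lip.
apply: (@le_trans _ _ (D * z ^+ 2)); first by have := sqr_ge0 z; rewrite /D; lra.
apply: ler_pM => //; first exact: sqr_ge0.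
by rewrite expr2 ler_peMr.
Qed.

(** [grad_le_gap] bounds |grad U| by a multiple of [g], so the quotient stays bounded up to the
    contact set. *)
Lemma q_bounded : exists2 Q : R, 0 < Q & forall al, 0 < al -> al < 1 -> U (phi al) < m -> enorm (q al) <= Q.
Proof.
have [C C0 HC] := grad_le_gap rho CU Um; pose D := C + 1; have D1 : 1 <= D by rewrite /D; lra.
exists (Ls * D); first by rewrite mulr_gt0//; lra.
move=> al a0 a1 Ua; have g0 := g_gt0 Ua; rewrite /q enormN enormZ.
rewrite gtr0_norm ?divr_gt0// -mulrA ler_wpM2l ?(ltW Ls0)// mulrC ler_pdivrMr//.
have D0 : 0 <= D by lra.
rewrite -(ler_pXn2r (n := 2)) ?nnegrE ?enorm_ge0 ?mulr_ge0 ?g_ge0//.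
apply: le_trans (HC _ (phi_in_ball (ltW a0) (ltW a1))) _.
rewrite exprMn g_sqr; have G0 : 0 <= m - U (phi al) by rewrite subr_ge0.
have : D * (m - U (phi al)) <= D ^+ 2 * (m - U (phi al)) by rewrite ler_wpM2r// expr2 ler_peMr.
have := sqr_ge0 D => ?; have : 0 <= D ^+ 2 * (m - U (phi al)) by rewrite mulr_ge0.
by rewrite /D; lra.
Qed.

(** If a contact [b] separates [s] from [t], then |p s| and |p t| are at most [K] times the
    distances to [b], which add up to t - s. Otherwise [p] has derivative [q] in between. *)
Lemma p_lipschitz : exists2 K : R, 0 < K & forall s t, 0 < s -> s <= t -> t < 1 ->
  enorm (p t - p s) <= K * (t - s).
Proof.
have [K K0 HK] := g_le_dist; have [Q Q0 HQ] := q_bounded.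
exists (K + Q); first exact: addr_gt0.
move=> s t s0 st t1; have [t0 s1] : 0 < t /\ s < 1 by split; lra.
have ts0 : 0 <= t - s by rewrite subr_ge0.
have [[b [sb bt] Ub]|nb] := pselect (exists2 b, s <= b /\ b <= t & U (phi b) = m).
  have [b0 b1] : 0 <= b /\ b <= 1 by split; lra.
  have h1 := HK s b (ltW s0) (ltW s1) b0 b1 Ub; have h2 := HK t b (ltW t0) (ltW t1) b0 b1 Ub.
  rewrite distrC ger0_norm ?subr_ge0// in h1; rewrite ger0_norm ?subr_ge0// in h2.
  apply: le_trans (enormD _ _) _; rewrite enormN !p_norm//.
  have Qt : 0 <= Q * (t - s) by rewrite mulr_ge0// ltW.
  by lra.
apply: (@le_trans _ _ (Q * (t - s))); last by rewrite ler_wpM2r// lerDr ltW.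
have H r : s <= r -> r <= t -> [/\ 0 < r, r < 1 & U (phi r) < m].
  move=> sr rt; split; [lra|lra|]; have [Ur|//] := sub_maximum r.
  by exfalso; apply: nb; exists r.
apply: (MVT_enorm (df := q)) => // r sr rt; have [r0 r1 Ur] := H r sr rt.
  by have [] := structure r0 r1 Ur.
exact: HQ.
Qed.

Let B := [set al : R | [/\ 0 < al, al < 1 & U (phi al) = m]].
Let O := [set al : R | [/\ 0 < al, al < 1 & U (phi al) < m]].

Lemma contact_countable : countable B.
Proof.
suff -> : B = isolated B by exact: countable_isolated.
apply/seteqP; split => [al Bal|al []]; last by rewrite inE.
split; first by rewrite inE.
have [a0 a1 Ua] := Bal; have [r r0 Hr] := isolated_maximum (ltW a0) (ltW a1) Ua.
exists (ball al r); first exact: nbhsx_ballx.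
apply/seteqP; split => [be [+ [b0 b1 Ub]]|be ->]; last by split=> //; exact: ballxx.
by rewrite /ball/= distrC => /ltW /Hr; apply=> //; exact: ltW.
Qed.

Lemma noncontact_open : open O.
Proof.
rewrite openE => al [a0 a1 Ua]; rewrite /interior.
have [_ dv _] := structure a0 a1 Ua.
have cU : {for al, continuous (fun s => U (phi s))}.
  by apply: continuous_comp; [exact: (is_derive_cvg dv)|exact: (is_Ck_cont CU)].
near=> s; split; [near: s; exact: lt_nbhsr|near: s; exact: lt_nbhsl|].
by near: s; exact: (cvgr_lt (U (phi al)) cU).
Unshelve. all: by end_near. Qed.

Lemma contact_cover x : 0 <= x -> x <= 1 -> x = 0 \/ x = 1 \/ B x \/ O x.
Proof.
rewrite le_eqVlt => /orP[/eqP <-|x0]; first by left.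
rewrite le_eqVlt => /orP[/eqP ->|x1]; first by right; left.
by right; right; have [Ux|Ux] := sub_maximum x; [left|right].
Qed.

Lemma contact_sub : B `|` O `<=` `[0, 1]%classic.
Proof. by move=> x [[x0 x1 _]|[x0 x1 _]]; rewrite /= in_itv/= !ltW. Qed.

Lemma ae_noncontact : {ae mu, forall x, 0 < x -> x < 1 -> O x}.
Proof.
exists B; split.
- by apply: countable_measurable => //; exact: contact_countable.
- by apply: countable_lebesgue_measure0; exact: contact_countable.
- move=> x /= nO; have [] := pselect (0 < x /\ x < 1) => [[x0 x1]|n].
    have [Ux|Ux] := sub_maximum x; first by split.
    by exfalso; apply: nO => _ _.
  by exfalso; apply: nO => x0 x1; exfalso; apply: n.
Qed.

Lemma weak_Euler_Lagrange : is_extremal U m phi.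
Proof.
have [P P0 HP] := g_bounded; have [Kp Kp0 Hp] := p_lipschitz.
have [Q Q0 HQ] := q_bounded.
have co x (Ox : O x) : {for x, continuous phi}.
  by have [x0 x1 Ux] := Ox; have [_ dv _] := structure x0 x1 Ux; exact: (is_derive_cvg dv).
have cg x (Ox : O x) : {for x, continuous g}.
  apply: continuous_comp; last exact: sqrt_continuous.
  apply: cvgB; first exact: cvg_cst.
  apply: cvgM; first exact: cvg_cst.
  by apply: continuous_comp; [exact: co|exact: (is_Ck_cont CU)].
have cp x (Ox : O x) : {for x, continuous p}.
  by have [x0 x1 Ux] := Ox; have [_ _ dp] := structure x0 x1 Ux; exact: (is_derive_cvg dp).
have cq x (Ox : O x) : {for x, continuous q}.
  have [x0 x1 Ux] := Ox.
  apply: cvgN; apply: cvgZ; last first.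
    exact: (cvg_comp _ _ (co x Ox) (@grad_continuous _ _ _ _ CU (phi x))).
  by apply: cvgM; [exact: cvg_cst|apply: cvgV; [exact: lt0r_neq0 (g_gt0 Ux)|exact: cg]].
split.
- rewrite /geom_action; case: asboolP => [_|nA]; last first.
    exfalso; apply: nA; split; last by move=> al _; exact: Um.
    apply: (lipschitz_abs_cont (ltW M0)) => s t s0 st t1.
    rewrite -[t - s]ger0_norm ?subr_ge0//; apply: phi_lip => //; lra.
  suff h : itg 0 1 (fun al => g al * enorm (derive1 phi al)) by exact: (integrable_lty (mitv 0 1) h).
  (* At 0 and 1 nothing is known of the two-sided [derive1 phi], so its values there are built into
     the bound. *)
  pose K := P * (Ls + (enorm (derive1 phi 0) + enorm (derive1 phi 1))).
  have e0 := enorm_ge0 (derive1 phi 0); have e1 := enorm_ge0 (derive1 phi 1).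
  have k0 : enorm (derive1 phi 0) <= Ls + (enorm (derive1 phi 0) + enorm (derive1 phi 1)).
    by rewrite addrCA lerDl; exact: (addr_ge0 (ltW Ls0) e1).
  have k1 : enorm (derive1 phi 1) <= Ls + (enorm (derive1 phi 0) + enorm (derive1 phi 1)).
    by rewrite addrA lerDr; exact: (addr_ge0 (ltW Ls0) e0).
  have H al : 0 <= al -> al <= 1 ->
      enorm (derive1 phi al) <= Ls + (enorm (derive1 phi 0) + enorm (derive1 phi 1)) ->
      `|g al * enorm (derive1 phi al)| <= K.
    move=> a0 a1 h; rewrite ger0_norm ?mulr_ge0 ?g_ge0 ?enorm_ge0//.
    by apply: ler_pM; rewrite ?g_ge0 ?enorm_ge0// HP.
  apply: (@itg_off_countable B O _ (fun al => g al * Ls) 0 1 K contact_countable noncontact_open contact_cover contact_sub ler01).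
  - by move=> x [x0 x1 Ux]; have [-> _ _] := structure x0 x1 Ux.
  - by move=> x Ox; apply: cvgM; [exact: cg|exact: cvg_cst].
  move=> x x0 x1; have [->|[->|[[_ _ Ux]|[x0' x1' Ux]]]] := contact_cover x0 x1.
  - exact: (H 0 (lexx 0) (@ler01 R) k0).
  - exact: (H 1 (@ler01 R) (lexx 1) k1).
  - rewrite g_eq0// mul0r normr0; apply: (mulr_ge0 (ltW P0)).
    exact: (addr_ge0 (ltW Ls0) (addr_ge0 e0 e1)).
  - apply: (H x x0 x1); have [-> _ _] := structure x0' x1' Ux.
    by rewrite lerDl; exact: (addr_ge0 e0 e1).
- have h := ae_and ae_noncontact (ae_and (@ae_neq R 0) (@ae_neq R 1)).
  apply: (@filterS _ _ (ae_filter_ringOfSetsType mu) _ _ _ h) => x [Ox [x0 x1]]; rewrite in_itv/= => /andP[x0' x1'].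
  have [h0 h1] : 0 < x /\ x < 1 by split; rewrite lt_neqAle ?x0' ?x1' ?andbT// eq_sym.
  have [_ _ Ux] := Ox h0 h1; have [vL _ _] := structure h0 h1 Ux.
  by split=> //; apply/eqP => v0; move: Ls0; rewrite -vL v0 enorm0 ltxx.
move=> Phi [sm Phi0 Phi1].
have dPhi (t : R) : is_derive t 1 Phi (derive1 Phi t).
  by rewrite derive1E; apply: DeriveDef => //; exact: (sm 0%N t).
have cPhi' : continuous (derive1 Phi).
  by move=> t; have /derivable1_diffP /differentiable_continuous := sm 1%N t.
have cPhi x : {for x, continuous Phi} by exact: (is_derive_cvg (dPhi x)).
have [J J0 HJ] := continuous_bounded_on (@ler01 R) (enormc cPhi').
have {}HJ t : 0 <= t -> t <= 1 -> enorm (derive1 Phi t) <= J.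
  by move=> t0 t1; apply: le_trans (HJ t t0 t1); exact: ler_norm.
have lPhi s t : 0 <= s -> s <= t -> t <= 1 -> enorm (Phi t - Phi s) <= J * (t - s).
  by move=> s0 st t1; apply: (MVT_enorm (df := derive1 Phi)) => // r sr rt; apply: HJ; lra.
have bPhi t : 0 <= t -> t <= 1 -> enorm (Phi t) <= J.
  move=> t0 t1; have := lPhi 0 t (lexx 0) t0 t1; rewrite Phi0 !subr0.
  by move=> /le_trans; apply; rewrite ler_piMr// ltW.
have T1 x : O x -> EL_term1 U m phi Phi x = dot (p x) (derive1 Phi x).
  move=> [x0 x1 Ux]; have [vL _ _] := structure x0 x1 Ux.
  by rewrite /EL_term1 vL /p !dotZl mulrA.
have T2 x : O x -> EL_term2 U m phi Phi x = - dot (q x) (Phi x).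
  move=> [x0 x1 Ux]; have [vL _ _] := structure x0 x1 Ux.
  by rewrite /EL_term2 vL /q dotNl opprK dotZl -/(g x); ring.
have i1 : itg 0 1 (EL_term1 U m phi Phi).
  apply: (@itg_off_countable B O _ _ 0 1 (P * J) contact_countable noncontact_open contact_cover contact_sub ler01 T1).
    by move=> x Ox; apply: cvg_dot; [exact: cp|exact: cPhi'].
  move=> x x0 x1; rewrite /EL_term1 -/(g x) normrM (ger0_norm (g_ge0 x)).
  apply: ler_pM; rewrite ?g_ge0 ?HP//; apply: le_trans (normr_dot_le _ _) _.
  rewrite -[J]mul1r; apply: ler_pM; rewrite ?enorm_ge0 ?HJ//.
  rewrite enormZ normfV ger0_norm ?enorm_ge0//.
  (* Whatever [derive1 phi x] is, its normalization has norm at most 1; it is 0 by the convention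
     0^-1 = 0 if the derivative vanishes. *)
  have [->|n0] := eqVneq (enorm (derive1 phi x)) 0; first by rewrite mulr0.
  by rewrite mulVf.
have i2 : itg 0 1 (EL_term2 U m phi Phi).
  apply: (@itg_off_countable B O _ _ 0 1 (Q * J) contact_countable noncontact_open contact_cover contact_sub ler01 T2).
    by move=> x Ox; apply: cvgN; apply: cvg_dot; [exact: cq|exact: cPhi].
  have QJ : 0 <= Q * J by rewrite mulr_ge0// ltW.
  move=> x x0 x1; have [->|[->|[[_ _ Ux]|Ox]]] := contact_cover x0 x1.
  - by rewrite /EL_term2 Phi0 dot0r mulr0 mul0r normr0.
  - by rewrite /EL_term2 Phi1 dot0r mulr0 mul0r normr0.
  - by rewrite /EL_term2 (grad_at_maximum CU Um Ux) dot0l mulr0 mul0r normr0.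
  - rewrite T2// normrN; apply: le_trans (normr_dot_le _ _) _.
    by have [x0' x1' Ux] := Ox; apply: ler_pM; rewrite ?enorm_ge0 ?HQ ?bPhi.
split=> //; rewrite -(RintB i1 i2).
have F01 : dot (p 1) (Phi 1) - dot (p 0) (Phi 0) = 0 by rewrite Phi0 Phi1 !dot0r subrr.
apply: etrans F01; apply: (scalar_ac_FTC (F := fun t => dot (p t) (Phi t)) (@ler01 R)).
  have K0 : 0 <= P * J + Kp * J by rewrite addr_ge0// mulr_ge0// ltW.
  apply: (@lipschitz_scalar_ac R d 0 1 (fun t => dot (p t) (Phi t)) _ K0) => s t s0 st t1.
  have KJ : 0 <= Kp * J * (t - s) by rewrite mulr_ge0 ?subr_ge0// mulr_ge0// ltW.
  have PJ : 0 <= P * J * (t - s) by rewrite mulr_ge0 ?subr_ge0// mulr_ge0// ltW.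
  have pP r : 0 < r -> r < 1 -> enorm (p r) <= P by move=> r0 r1; rewrite p_norm// HP// ltW.
  have hPhi r : 0 < r -> r < 1 -> `|dot (p r) (Phi t - Phi s)| <= P * J * (t - s).
    move=> r0 r1; apply: le_trans (normr_dot_le _ _) _; rewrite -mulrA.
    by apply: ler_pM; rewrite ?enorm_ge0 ?pP ?lPhi.
  (* [p] is controlled only inside ]0, 1[. At the end points [Phi] vanishes, and the bound on [p]
     with the Lipschitz bound on [Phi] suffices. *)
  move: s0; rewrite le_eqVlt => /orP[/eqP s0|s0]; last first.
    move: t1; rewrite le_eqVlt => /orP[/eqP t1|t1].
      rewrite t1 Phi1 dot0r sub0r normrN; move: st; rewrite le_eqVlt => /orP[/eqP ->|s1].
        by rewrite t1 Phi1 dot0r normr0 subrr mulr0.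
      have := hPhi s s0; rewrite t1 Phi1 sub0r dotNr normrN => /(_ _) h.
      rewrite t1 in s1 KJ h *; have := h s1; lra.
    have -> : dot (p t) (Phi t) - dot (p s) (Phi s) = dot (p t) (Phi t - Phi s) + dot (p t - p s) (Phi s).
      by rewrite dotBr dotBl addrA subrK.
    apply: le_trans (ler_normD _ _) _; rewrite mulrDl; apply: lerD.
      by apply: hPhi => //; exact: lt_le_trans st.
    apply: le_trans (normr_dot_le _ _) _; rewrite mulrAC.
    by apply: ler_pM; rewrite ?enorm_ge0 ?Hp// bPhi//; lra.
  rewrite -s0 Phi0 dot0r subr0; rewrite -s0 in st hPhi KJ PJ.
  move: st; rewrite le_eqVlt => /orP[/eqP <-|t0]; first by rewrite Phi0 dot0r normr0 subrr mulr0.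
  move: t1; rewrite le_eqVlt => /orP[/eqP t1|t1].
    by rewrite t1 Phi1 dot0r normr0 subr0 mulr1.
  by have := hPhi t t0 t1; rewrite Phi0 subr0; lra.
apply: (@filterS _ _ (ae_filter_ringOfSetsType mu) _ _ _ ae_noncontact) => x H x0 x1; have Ox := H x0 x1; rewrite T1// T2// opprK.
have [_ _ Ux] := Ox; have [_ _ dp] := structure x0 x1 Ux.
by apply: (is_derive_eq (is_derive_dot dp (dPhi x))).
Qed.

End WeakEulerLagrange.

Lemma uniform_cvg_enorm (R : realType) (d : nat) (a b : R) (phi : nat -> R -> 'rV[R]_d)
    (psi : R -> 'rV[R]_d) :
  {uniform `[a, b]%classic, phi @ \oo --> psi} ->
  forall e, 0 < e -> \forall j \near \oo, forall al, a <= al -> al <= b ->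
    enorm (phi j al - psi al) < e.
Proof.
move=> cvg e e0; have de0 : 0 < e / d.+1%:R by rewrite divr_gt0.
apply: (cvg [set h | forall al, a <= al -> al <= b -> enorm (h al - psi al) < e]).
apply/uniform_nbhs; exists [set xy | ball xy.1 (PosNum de0)%:num xy.2]; split.
  exact: entourage_ball.
move=> h /= H al aal alb; have := H al; rewrite /= in_itv/= aal alb => /(_ isT).
rewrite -ball_normE/= distrC ltr_pdivlMr// mulrC; apply: le_lt_trans.
exact: enorm_le_mx_norm.
Qed.

Lemma constant_action (R : realType) (d k : nat) (U : 'rV[R]_d -> R) (T : R) x : is_Ck k.+2 U ->
  0 < T -> OM_action U T (fun=> x) = (- U x * T)%:E.
Proof.
move=> CU T0; rewrite (@OM_action_C1 _ _ U k T CU T0 (fun=> x) (fun=> 0)).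
- congr (_%:E); rewrite (_ : (fun t => _) = fun=> - U x); first by rewrite Rintegral_const ?ltW// subr0.
  by apply/funext => t; rewrite dot0l mulr0 sub0r.
- by move=> t; exact: cvg_cst.
Qed.

Theorem theorem3p10 (R : realType) (d : nat) (eps : R) (V : 'rV[R]_d -> R)
  (U := OM_potential eps V)
  (eps_gt0 : 0 < eps)
  (V_C7 : is_Ck 7 V)
  (A1 : has_nondeg_local_min V)
  (A2 : has_bounded_maxima U)
  (A3 : tame_level_sets U)
  (A4 : discrete_critical_set U)
  (A5 : nondeg_critical_points U)
  (A6 : unique_minimizers U)
  (A7 : bounded_arclengths U)
  (xs xf : 'rV[R]_d)
  (T : nat -> R) (T_gt0 : forall k, 0 < T k) (T_oo : T @ \oo --> +oo)
  (psi : nat -> R -> 'rV[R]_d)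
  (psi_min : forall k, is_minimizer U (T k) xs xf (psi k))
  (L_gt0 : forall k, 0 < arclength (T k) (psi k))
  (phi := fun k => arclength_reparam (T k) (psi k))
  (sigma : nat -> nat) (sigma_incr : {homo sigma : j k / (j < k)%N})
  (phistar : R -> 'rV[R]_d)
  (phi_cvg : {uniform `[0%R, 1%R]%classic,
                (fun j => phi (sigma j)) @ \oo --> phistar})
  (Estar : R) (EstarE : is_maximum U Estar) :
  (exists2 alpha : R, alpha \in `[0, 1] & critical_set U (phistar alpha)) /\
  is_extremal U Estar phistar.
Proof.
have CU : is_Ck 5 U by exact: is_Ck_OM_potential.
have Um x : U x <= Estar by apply: EstarE.2; exists x.
have [xc _ Uxc] := EstarE.1.
have [M M0 LM] := A7 xs xf.
pose Ts j := T (sigma j); pose Ls j := arclength (Ts j) (psi (sigma j)).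
have Ts0 j : 0 < Ts j by exact: T_gt0.
have Ls0 j : 0 < Ls j by exact: L_gt0.
have LsM j : Ls j <= M := LM _ _ (Ts0 j) (psi_min (sigma j)).
have sigma_ge j : (j <= sigma j)%N.
  by elim: j => // j IH; apply: leq_ltn_trans IH _; exact: sigma_incr.
have Tsoo B : \forall j \near \oo, B <= Ts j.
  have /cvgryPge /(_ B) [N _ HN] := T_oo.
  by exists N => // j /= Nj; apply: HN => /=; exact: leq_trans (sigma_ge j).
(* The constant path would have action [- Estar * T], strictly below that of [psi], which has
   positive length. *)
have nonconst : ~ (xs = xf /\ U xs = Estar).
  move=> [exf Ux]; have [X [W [l [E [tau [_ _ _ _ /(_ _ Um)[_ _ + _]]]]]]] :=
    minimizer_data CU (T_gt0 0%N) (psi_min 0%N) (L_gt0 0%N).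
  rewrite ltNge => /negP; apply; rewrite -Ux -(constant_action _ CU (T_gt0 0%N)).
  by apply: (psi_min 0%N).2; split=> //; exact: abs_cont_cst.
have /choice[X /choice[W /choice[l /choice[E /choice[tau H]]]]] :=
  fun j => minimizer_data CU (Ts0 j) (psi_min (sigma j)) (Ls0 j).
have ode j t : 0 <= t -> t <= Ts j ->
  [/\ is_derive t 1 (X j) (W j t), is_derive t 1 (W j) (- grad U (X j t)),
      is_derive t 1 (l j) (enorm (W j t)) & enorm (W j t) ^+ 2 = 2 * (E j - U (X j t))].
  by move=> t0 tT; have [ode _ _ _ _] := H j; exact: ode.
have l0 j : l j 0 = 0 by have [_ [h _] _ _ _] := H j; exact: h.
have lT j : l j (Ts j) = Ls j by have [_ [_ h] _ _ _] := H j; exact: h.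
have X0 j : X j 0 = xs by have [_ _ [h _] _ _] := H j; exact: h.
have XT j : X j (Ts j) = xf by have [_ _ [_ h] _ _] := H j; exact: h.
have tauP j al : 0 <= al -> al <= 1 ->
    [/\ 0 <= tau j al, tau j al <= Ts j & l j (tau j al) = al * Ls j].
  by move=> a0 a1; have [_ _ _ /(_ al a0 a1)[h1 h2 h3 _] _] := H j; split.
have mean j : exists2 t, 0 <= t <= Ts j & enorm (W j t) * Ts j = Ls j.
  by have [_ _ _ _ /(_ _ Um)[h _ _ _]] := H j; exact: h.
have [K0 HK] := competitor CU Um xs xf Uxc.
(* Chain: - E T <= action of psi <= action of the competitor <= K0 - Estar T. *)
have E_ge : \forall j \near \oo, Estar - K0 / Ts j <= E j.
  near=> j; have T2 : 2 <= Ts j by near: j; exact: Tsoo.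
  have [chi adm act] := HK _ T2.
  have [_ _ _ _ /(_ _ Um)[_ h _ _]] := H j.
  have := le_trans h (le_trans ((psi_min (sigma j)).2 chi adm) act).
  rewrite lee_fin => h2; rewrite -(ler_pM2r (Ts0 j)) mulrBl divfK ?gt_eqF//; lra.
have len := fun j => let: And5 _ _ _ _ h := H j in let: And4 _ _ _ h := h _ Um in h.
have phi_lim e : 0 < e -> \forall j \near \oo, forall al, 0 <= al -> al <= 1 ->
    enorm (X j (tau j al) - phistar al) < e.
  move=> /(uniform_cvg_enorm phi_cvg); apply: filterS => j h al a0 a1.
  by have [_ _ _ /(_ al a0 a1)[_ _ _ <-] _] := H j; exact: h.
have nd x : U x = Estar -> ~~ eigenvalue (hess U x) 0.
  by move=> Ux; apply: A5; rewrite /critical_set /= Ux.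
split.
  have [al [a0 a1] Ua] := limit_meets_maximum CU Um Ts0 Tsoo Ls0 LsM ode l0 lT X0 tauP mean E_ge phi_lim.
  by exists al; [rewrite in_itv/= a0|rewrite /critical_set /= Ua].
have [lam lam0 Hst] := limit_structure CU Um nonconst Ts0 Tsoo Ls0 LsM ode l0 lT X0 XT tauP mean
  E_ge len phi_lim nd.
apply: (weak_Euler_Lagrange CU Um lam0 M0 _ _ Hst).
  by move=> al be; exact: (phi_lipschitz Ls0 LsM ode tauP phi_lim).
move=> al a0 a1 Ua; exact: (maximum_isolated CU Um nonconst Ts0 Tsoo Ls0 LsM ode l0 lT X0 XT tauP
  mean E_ge len phi_lim a0 a1 Ua (nd _ Ua)).
Unshelve. all: by end_near. Qed.
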